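(* Consider either (a) covariance (in particular correlation) matrix completion: $\mathbb{S}^n$ is the real symmetric or Hermitian $n\times n$ matrices with the entry basis described below, $\alpha$ indexes a set of diagonal basis elements $\{e_ie_i^{\mathbb{T}}:i\in I\}$, and $\overline X$ is positive semidefinite with $\overline X_{ii}>0$ for $i\in I$; or (b) density matrix completion: $\mathbb{S}^n$ is the Hermitian $n\times n$ matrices, the orthonormal basis contains $\frac1{\sqrt n}I_n$, $\alpha$ indexes exactly this element, and $\overline X$ is positive semidefinite with $\mathrm{Tr}(\overline X)=1$. Assume uniform sampling ($p_k=1/d_2$ for all $k\in\beta$), $\rho_m\to0$, $\sqrt m\,\rho_m\to\infty$, $\gamma_m=O_p(1)$, and that $F$ is the spectral operator associated with a symmetric function $f:\mathbb{R}^n\to\mathbb{R}^n$ such that for each $i=1,\dots,n$: $f_i(x)\ge0$ for all $x\in\mathbb{R}^n_+$, and $f_i(x)=0$ if and only if $x_i=0$. Then the estimator $\widehat X_m$ from problem (RC+) is rank consistent, i.e., $\lim_{m\to\infty}\Pr(\mathrm{rank}(\widehat X_m)=\mathrm{rank}(\overline X))=1$.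
   Context: $\langle X,Y\rangle=\mathrm{Re}\,\mathrm{Tr}(X^{\mathbb{T}}Y)$ with $^{\mathbb{T}}$ transpose or conjugate transpose; $\|\cdot\|_F$ is the Frobenius norm; $e_i$ is the $i$-th unit vector. In case (a) the orthonormal basis is $\{e_ie_i^{\mathbb{T}}\}_{1\le i\le n}\cup\{\frac1{\sqrt2}(e_ie_j^{\mathbb{T}}+e_je_i^{\mathbb{T}})\}_{i<j}$ (real) or additionally with $\{\frac{\sqrt{-1}}{\sqrt2}(e_ie_j^{\mathbb{T}}-e_je_i^{\mathbb{T}})\}_{i<j}$ (complex). Generally $\{\Theta_1,\dots,\Theta_d\}$ denotes the orthonormal basis, $\beta=\{1,\dots,d\}\setminus\alpha$, $d_2=|\beta|$, $\mathcal{R}_\pi(X)=(\langle\Theta_k,X\rangle)_{k\in\pi}$. $\overline X$ has rank $r\ge1$. Observations: $\omega_1,\dots,\omega_m$ i.i.d. uniform on $\beta$; $\xi_i$ i.i.d., independent of the $\omega_i$, $\mathbb{E}\xi_i=0$, $\mathbb{E}\xi_i^2=1$; $\nu>0$; $y_i=\langle\Theta_{\omega_i},\overline X\rangle+\nu\xi_i$; $\mathcal{R}_\Omega(X)=(\langle\Theta_{\omega_i},X\rangle)_{i=1}^m$. $f$ symmetric means $f(x)=Q^{\mathbb{T}}f(Qx)$ for all signed permutation matrices $Q$; for positive semidefinite $X=P\mathrm{Diag}(\lambda(X))P^{\mathbb{T}}$, $F(X)=P\mathrm{Diag}(f(\lambda(X)))P^{\mathbb{T}}$. Problem (RC+): given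 a positive semidefinite initial estimator $\widetilde X_m$, $\rho_m>0$, $\gamma_m\ge0$, $\widehat X_m$ is an optimal solution of $\min_{X\in\mathbb{S}^n}\frac1{2m}\|y-\mathcal{R}_\Omega(X)\|_2^2+\rho_m(\langle I_n-F(\widetilde X_m),X\rangle+\frac{\gamma_m}2\|X-\widetilde X_m\|_F^2)$ s.t. $\mathcal{R}_\alpha(X)=\mathcal{R}_\alpha(\overline X)$, $X$ positive semidefinite. Standing assumptions: $n$ fixed, $m\to\infty$; $F$ continuous at $\overline X$; $\widetilde X_m\xrightarrow{p}\overline X$. *)

(* Defs.v *)
From HB Require Import structures.
From mathcomp Require Import all_boot all_order all_algebra.
From mathcomp Require Import all_classical all_reals all_analysis.
From mathcomp Require Import fingroup perm complex.
Set Implicit Arguments. Unset Strict Implicit. Unset Printing Implicit Defensive.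
Import Order.TTheory GRing.Theory Num.Theory.
Local Open Scope ring_scope.
Local Open Scope classical_set_scope.
Local Open Scope complex_scope.

Section MatrixDefs.
Variable R : realType.
Local Notation C := (R[i]).

Definition ctr m n (X : 'M[C]_(m, n)) : 'M[C]_(n, m) := (map_mx (@conjc R) X)^T.

Definition ip n (X Y : 'M[C]_n) : R := complex.Re (\tr (ctr X *m Y)).

Definition frob n (X : 'M[C]_n) : R := Num.sqrt (ip X X).

Definition hermitian n (X : 'M[C]_n) : Prop := ctr X = X.

(* S^n : real symmetric matrices (cplx = false) or Hermitian matrices (cplx = true) *)
Definition inS (cplx : bool) n (X : 'M[C]_n) : Prop :=
  hermitian X /\ (cplx = false -> forall i j, complex.Im (X i j) = 0).

Definition psd n (X : 'M[C]_n) : Prop :=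
  hermitian X /\ forall v : 'cV[C]_n, 0 <= ((ctr v) *m X *m v) 0 0.

Definition unitary n (P : 'M[C]_n) : Prop := P *m ctr P = 1%:M.

Definition real_mx m n (X : 'M[C]_(m, n)) : Prop :=
  forall i j, complex.Im (X i j) = 0.

Definition toC m n (A : 'M[R]_(m, n)) : 'M[C]_(m, n) := map_mx (fun a => a%:C) A.

Definition signed_perm n (Q : 'M[R]_n) : Prop :=
  exists (s : 'S_n) (e : 'I_n -> bool),
    Q = \matrix_(i, j) (if s i == j then (-1) ^+ e i else 0).

Definition symmetric_fun n (f : 'cV[R]_n -> 'cV[R]_n) : Prop :=
  forall Q, signed_perm Q -> forall x, f x = Q^T *m f (Q *m x).

Definition spectral_op (cplx : bool) n (f : 'cV[R]_n -> 'cV[R]_n)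
    (F : 'M[C]_n -> 'M[C]_n) : Prop :=
  forall (X P : 'M[C]_n) (lam : 'cV[R]_n),
    inS cplx X -> psd X -> unitary P -> (cplx = false -> real_mx P) ->
    (forall i j : 'I_n, (i <= j)%N -> lam j 0 <= lam i 0) ->
    X = P *m diag_mx (toC lam)^T *m ctr P ->
    F X = P *m diag_mx (toC (f lam))^T *m ctr P.

Definition basis_a (cplx : bool) n : set 'M[C]_n :=
  [set delta_mx i i | i in [set: 'I_n]]
  `|` [set X | exists i j : 'I_n, (i < j)%N /\
          X = ((Num.sqrt (2 : R))^-1)%:C *: (delta_mx i j + delta_mx j i)]
  `|` [set X | cplx /\ exists i j : 'I_n, (i < j)%N /\
          X = ('i * ((Num.sqrt (2 : R))^-1)%:C) *: (delta_mx i j - delta_mx j i)].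

Definition setting (cplx : bool) n d (Theta : 'I_d -> 'M[C]_n)
    (alpha : {set 'I_d}) (Xbar : 'M[C]_n) : Prop :=
  (injective Theta /\ range Theta = @basis_a cplx n /\
   exists I : {set 'I_n},
     alpha = [set k | [exists i in I, Theta k == delta_mx i i]]%SET /\
     psd Xbar /\ inS cplx Xbar /\ (forall i, i \in I -> 0 < Xbar i i))
  \/
  (cplx = true /\
   (forall k, hermitian (Theta k)) /\
   (forall k l, ip (Theta k) (Theta l) = (k == l)%:R) /\
   (forall X, hermitian X -> X = \sum_k (ip (Theta k) X)%:C *: Theta k) /\
   exists k0, Theta k0 = ((Num.sqrt (n%:R : R))^-1)%:C *: 1%:M /\
     alpha = [set k0]%SET /\
     psd Xbar /\ \tr Xbar = 1).

Definition rc_obj n d (Theta : 'I_d -> 'M[C]_n) (Xbar : 'M[C]_n) (nu : R)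
    (m : nat) (om : nat -> 'I_d) (xi : nat -> R)
    (F : 'M[C]_n -> 'M[C]_n) (Xt : 'M[C]_n) (rho gamma : R) (X : 'M[C]_n) : R :=
  (2 * m%:R)^-1 *
     \sum_(i < m) (ip (Theta (om i)) Xbar + nu * xi i - ip (Theta (om i)) X) ^+ 2
  + rho * (ip (1%:M - F Xt) X + gamma / 2 * frob (X - Xt) ^+ 2).

Definition rc_feasible (cplx : bool) n d (Theta : 'I_d -> 'M[C]_n)
    (alpha : {set 'I_d}) (Xbar X : 'M[C]_n) : Prop :=
  inS cplx X /\ psd X /\ (forall k, k \in alpha -> ip (Theta k) X = ip (Theta k) Xbar).

End MatrixDefs.

Definition indep_family (dT : measure_display) (T : measurableType dT)
    (R : realType) (P : probability T R) d
    (om : nat -> T -> 'I_d) (xi : nat -> T -> R) : Prop :=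
  forall (J : seq nat) (K : nat -> set 'I_d) (B : nat -> set R),
    uniq J -> (forall j, measurable (B j)) ->
    P (\big[setI/setT]_(j <- J) ([set w | K j (om j w)] `&` [set w | B j (xi j w)]))
    = (\prod_(j <- J) (P [set w | K j (om j w)] * P [set w | B j (xi j w)]))%E.

(* Main.v *)
(* Write D = (Xhat - Xbar) / rho. The sampling frequencies and the noise
   averages concentrate at rate m^(-1/2) = o(rho) (Chebyshev), so optimality
   tested at Xbar bounds D, and the gradient of the objective at Xhat divided by
   rho is k D + I - F(Xbar) + o(1), where k = 1/d_2. By optimality, subtracting a
   multiplier Y for the linear constraints (Y diagonal in case (a), scalar in case
   (b)) gives a positive semidefinite S with S Xhat = 0. Let Z = I - Y. Since Xhat
   tends to Xbar, S tends to 0 on the range of Xbar, so outside the block of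
   ker(Xbar) the matrix k D + Z - F(Xbar) is o(1). Its diagonal entries at
   constrained indices, resp. its trace, are free of D except for a nonnegative
   contribution of that block, and the positivity of F(Xbar) there bounds Z below
   by a positive multiple of I. Hence S is positive definite on ker(Xbar), so the
   range of Xhat meets ker(Xbar) trivially and rank Xhat <= rank Xbar; the reverse
   inequality is lower semicontinuity of the rank. *)
Require Import Defs.
From HB Require Import structures.
From mathcomp Require Import all_boot all_order all_algebra.
From mathcomp Require Import all_classical all_reals all_analysis.
From mathcomp Require Import fingroup perm complex.
From mathcomp Require Import spectral measurable_realfun ring lra.
Import Defs Order.TTheory GRing.Theory Num.Theory numFieldNormedType.Exports.
Set Implicit Arguments. Unset Strict Implicit. Unset Printing Implicit Defensive.
Local Open Scope ring_scope.
Local Open Scope classical_set_scope.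

(** * Norms and inner products *)

(** The matrix argument is free of probability. Its estimates hold uniformly over all realizations
    ([datum]) whose error terms lie below a level [seps], with constants depending only on the fixed
    data, and a fixed threshold on [seps] forces equal ranks. Probability serves only to show that
    such realizations occur with probability tending to 1. The bounds are obtained in two rounds,
    because part of the gradient error is itself proportional to D: optimality at Xbar is exploited
    with the part free of D ([stat_err]), and only then is the full error ([grad_err]) seen to be
    small. The multipliers are not taken from an abstract duality theorem but written down
    explicitly, as the only values compatible with S Xhat = 0; this also shows that they stay
    bounded. Their validity is proved by testing optimality on perturbations that are rescaled or
    normalized to be feasible. Of F(Xbar) only two facts enter the rank argument: it is positive
    semidefinite, and its kernel is that of Xbar. In the real case F is prescribed only through real
    eigenvector matrices, so an orthogonal diagonalization of real symmetric matrices is needed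
    besides the Hermitian one. *)

Section Norms.
Variable R : realType.
Local Notation C := (R[i]).
Local Notation "a %:C" := (real_complex R a).
Local Notation Re := (@complex.Re R).
Local Notation Im := (@complex.Im R).
Local Notation cabs := (@Normc.normc R).

Lemma ReD (x y : C) : Re (x + y) = Re x + Re y.
Proof. by case: x y => [? ?] []. Qed.

Lemma ReN (x : C) : Re (- x) = - Re x.
Proof. by case: x. Qed.

Lemma Re_sum (I : Type) (r : seq I) (p : pred I) (g : I -> C) :
  Re (\sum_(i <- r | p i) g i) = \sum_(i <- r | p i) Re (g i).
Proof.
by elim/big_rec2: _ => // i x y _ <-; rewrite ReD.
Qed.

Lemma ReZ (a : R) (x : C) : Re (a%:C * x) = a * Re x.
Proof. by case: x => x y /=; rewrite mul0r subr0. Qed.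

Lemma Re_conjM (x y : C) : Re (conjc x * y) = Re (conjc y * x).
Proof. by case: x y => [a b] [e g] /=; ring. Qed.

Lemma Re_conjMx (x : C) : Re (conjc x * x) = cabs x ^+ 2.
Proof.
case: x => a b /=; rewrite sqr_sqrtr ?addr_ge0 ?sqr_ge0 //; ring.
Qed.

Lemma cabs_ge0 (x : C) : 0 <= cabs x.
Proof. by case: x => a b /=; rewrite sqrtr_ge0. Qed.

Lemma cabsJ (x : C) : cabs (conjc x) = cabs x.
Proof. by case: x => a b /=; rewrite sqrrN. Qed.

Lemma cabs_real (a : R) : cabs a%:C = `|a|.
Proof. by rewrite /= expr0n /= addr0 sqrtr_sqr. Qed.

Lemma Re_le_cabs (x : C) : `|Re x| <= cabs x.
Proof.
case: x => a b /=; rewrite -sqrtr_sqr; apply: ler_wsqrtr.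
by rewrite lerDl sqr_ge0.
Qed.

Lemma cabs_sum (I : Type) (r : seq I) (p : pred I) (g : I -> C) :
  cabs (\sum_(i <- r | p i) g i) <= \sum_(i <- r | p i) cabs (g i).
Proof.
elim/big_rec2: _ => [|i x y _ le]; first by rewrite Normc.normc0.
exact: le_trans (le_normcD _ _) (lerD _ _).
Qed.

(** An entrywise norm, defined for rectangular matrices, submultiplicative and invariant under
    [ctr]. It replaces [frob] in all estimates; since dimensions are fixed, the equivalence
    constants do not matter. *)
Definition nrm m n (X : 'M[C]_(m, n)) : R := \sum_i \sum_j cabs (X i j).

Lemma nrm_ge0 m n (X : 'M[C]_(m, n)) : 0 <= nrm X.
Proof. by apply: sumr_ge0 => i _; apply: sumr_ge0 => j _; apply: cabs_ge0. Qed.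

Lemma nrmD m n (X Y : 'M[C]_(m, n)) : nrm (X + Y) <= nrm X + nrm Y.
Proof.
rewrite /nrm -big_split /=; apply: ler_sum => i _.
by rewrite -big_split /=; apply: ler_sum => j _; rewrite mxE le_normcD.
Qed.

Lemma nrmN m n (X : 'M[C]_(m, n)) : nrm (- X) = nrm X.
Proof. by do 2![apply: eq_bigr => ? _]; rewrite mxE normcN. Qed.

Lemma nrmZ m n (a : R) (X : 'M[C]_(m, n)) : nrm (a%:C *: X) = `|a| * nrm X.
Proof.
rewrite /nrm mulr_sumr; apply: eq_bigr => i _; rewrite mulr_sumr.
by apply: eq_bigr => j _; rewrite mxE Normc.normcM cabs_real.
Qed.

Lemma nrm0 m n : nrm (0 : 'M[C]_(m, n)) = 0.
Proof. by have := nrmZ 0 (0 : 'M[C]_(m, n)); rewrite scaler0 normr0 mul0r. Qed.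

Lemma cabs_le_nrm m n (X : 'M[C]_(m, n)) i j : cabs (X i j) <= nrm X.
Proof.
rewrite /nrm (bigD1 i) //= (bigD1 j) //= -addrA lerDl addr_ge0 //.
  by apply: sumr_ge0 => ? _; apply: cabs_ge0.
by apply: sumr_ge0 => ? _; apply: sumr_ge0 => ? _; apply: cabs_ge0.
Qed.

Lemma nrm_le0 m n (X : 'M[C]_(m, n)) : nrm X <= 0 -> X = 0.
Proof.
move=> X0; apply/matrixP => i j; rewrite mxE; apply: Normc.eq0_normc.
by apply/le_anti; rewrite cabs_ge0 (le_trans (cabs_le_nrm X i j)).
Qed.

Lemma nrmM m n p (X : 'M[C]_(m, n)) (Y : 'M[C]_(n, p)) :
  nrm (X *m Y) <= nrm X * nrm Y.
Proof.
rewrite /nrm mulr_suml; apply: ler_sum => i _.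
apply: (@le_trans _ _ (\sum_k \sum_j cabs (X i j) * cabs (Y j k))).
  apply: ler_sum => k _; rewrite mxE; apply: le_trans (cabs_sum _ _ _) _.
  by apply: ler_sum => j _; rewrite Normc.normcM.
rewrite exchange_big mulr_suml; apply: ler_sum => j _ /=.
rewrite -mulr_sumr ler_wpM2l ?cabs_ge0 // (bigD1 j) //= lerDl.
by do 2![apply: sumr_ge0 => ? _]; apply: cabs_ge0.
Qed.

Lemma ctrE m n (X : 'M[C]_(m, n)) i j : ctr X i j = conjc (X j i).
Proof. by rewrite !mxE. Qed.

Lemma ctrK m n (X : 'M[C]_(m, n)) : ctr (ctr X) = X.
Proof. by apply/matrixP => i j; rewrite !mxE conjcK. Qed.

Lemma ctrM m n p (X : 'M[C]_(m, n)) (Y : 'M[C]_(n, p)) :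
  ctr (X *m Y) = ctr Y *m ctr X.
Proof. by rewrite /ctr map_mxM trmx_mul. Qed.

Lemma ctrD m n (X Y : 'M[C]_(m, n)) : ctr (X + Y) = ctr X + ctr Y.
Proof. by rewrite /ctr map_mxD linearD. Qed.

Lemma ctrN m n (X : 'M[C]_(m, n)) : ctr (- X) = - ctr X.
Proof. by rewrite /ctr map_mxN linearN. Qed.

Lemma ctrB m n (X Y : 'M[C]_(m, n)) : ctr (X - Y) = ctr X - ctr Y.
Proof. by rewrite ctrD ctrN. Qed.

Lemma ctrZ m n (a : R) (X : 'M[C]_(m, n)) : ctr (a%:C *: X) = a%:C *: ctr X.
Proof. by apply/matrixP => i j; rewrite !mxE rmorphM; congr (_ * _); exact: conjc_real. Qed.

Lemma ctr0 m n : ctr (0 : 'M[C]_(m, n)) = 0.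
Proof. by apply/matrixP => i j; rewrite !mxE conjc0. Qed.

Lemma ctr1 n : ctr (1%:M : 'M[C]_n) = 1%:M.
Proof. by rewrite /ctr map_mx1 trmx1. Qed.

Lemma nrm_ctr m n (X : 'M[C]_(m, n)) : nrm (ctr X) = nrm X.
Proof.
rewrite /nrm exchange_big; do 2![apply: eq_bigr => ? _].
by rewrite ctrE cabsJ.
Qed.

Lemma ipE n (X Y : 'M[C]_n) :
  ip X Y = \sum_i \sum_j Re (conjc (X i j) * Y i j).
Proof.
rewrite /ip /mxtrace Re_sum exchange_big; apply: eq_bigr => i _ /=.
by rewrite mxE Re_sum; apply: eq_bigr => j _; rewrite ctrE.
Qed.

Lemma ipC n (X Y : 'M[C]_n) : ip X Y = ip Y X.
Proof. by rewrite !ipE; do 2![apply: eq_bigr => ? _]; rewrite Re_conjM. Qed.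

Lemma ipDr n (X Y Z : 'M[C]_n) : ip X (Y + Z) = ip X Y + ip X Z.
Proof. by rewrite /ip mulmxDr linearD ReD. Qed.

Lemma ipNr n (X Y : 'M[C]_n) : ip X (- Y) = - ip X Y.
Proof. by rewrite /ip mulmxN linearN ReN. Qed.

Lemma ipBr n (X Y Z : 'M[C]_n) : ip X (Y - Z) = ip X Y - ip X Z.
Proof. by rewrite ipDr ipNr. Qed.

Lemma ipZr n (a : R) (X Y : 'M[C]_n) : ip X (a%:C *: Y) = a * ip X Y.
Proof. by rewrite /ip -scalemxAr linearZ ReZ. Qed.

Lemma ipDl n (X Y Z : 'M[C]_n) : ip (X + Y) Z = ip X Z + ip Y Z.
Proof. by rewrite ipC ipDr !(ipC Z). Qed.

Lemma ipNl n (X Y : 'M[C]_n) : ip (- X) Y = - ip X Y.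
Proof. by rewrite ipC ipNr ipC. Qed.

Lemma ipBl n (X Y Z : 'M[C]_n) : ip (X - Y) Z = ip X Z - ip Y Z.
Proof. by rewrite ipDl ipNl. Qed.

Lemma ipZl n (a : R) (X Y : 'M[C]_n) : ip (a%:C *: X) Y = a * ip X Y.
Proof. by rewrite ipC ipZr ipC. Qed.

Lemma ip0r n (X : 'M[C]_n) : ip X 0 = 0.
Proof. by rewrite /ip mulmx0 mxtrace0. Qed.

Lemma ip_sumr n (I : Type) (r : seq I) (p : pred I) (X : 'M[C]_n) (g : I -> 'M[C]_n) :
  ip X (\sum_(i <- r | p i) g i) = \sum_(i <- r | p i) ip X (g i).
Proof.
by elim/big_rec2: _ => [|i x y _ <-]; rewrite ?ip0r ?ipDr.
Qed.

Lemma ip_suml n (I : Type) (r : seq I) (p : pred I) (X : 'M[C]_n) (g : I -> 'M[C]_n) :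
  ip (\sum_(i <- r | p i) g i) X = \sum_(i <- r | p i) ip (g i) X.
Proof. by rewrite ipC ip_sumr; apply: eq_bigr => i _; rewrite ipC. Qed.

Lemma ipxx n (X : 'M[C]_n) : ip X X = \sum_i \sum_j cabs (X i j) ^+ 2.
Proof. by rewrite ipE; do 2![apply: eq_bigr => ? _]; rewrite Re_conjMx. Qed.

Lemma ipxx_ge0 n (X : 'M[C]_n) : 0 <= ip X X.
Proof. by rewrite ipxx; do 2![apply: sumr_ge0 => ? _]; apply: sqr_ge0. Qed.

Lemma frob_sqr n (X : 'M[C]_n) : frob X ^+ 2 = ip X X.
Proof. by rewrite /frob sqr_sqrtr ?ipxx_ge0. Qed.

Lemma frob_ge0 n (X : 'M[C]_n) : 0 <= frob X.
Proof. exact: sqrtr_ge0. Qed.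

Lemma cabs_le_frob n (X : 'M[C]_n) i j : cabs (X i j) <= frob X.
Proof.
rewrite -ler_sqr ?nnegrE ?cabs_ge0 ?frob_ge0 // frob_sqr ipxx.
rewrite (bigD1 i) //= (bigD1 j) //= -addrA lerDl addr_ge0 //.
  by apply: sumr_ge0 => ? _; apply: sqr_ge0.
by do 2![apply: sumr_ge0 => ? _]; apply: sqr_ge0.
Qed.

Lemma nrm_le_frob n (X : 'M[C]_n) : nrm X <= (n * n)%:R * frob X.
Proof.
have -> : (n * n)%:R * frob X = \sum_(i < n) \sum_(j < n) frob X.
  under eq_bigr do rewrite sumr_const card_ord.
  by rewrite sumr_const card_ord -mulrnA mulr_natl.
by do 2![apply: ler_sum => ? _]; apply: cabs_le_frob.
Qed.

Lemma nrm_sqr_le n (X : 'M[C]_n) : nrm X ^+ 2 <= (n * n)%:R ^+ 2 * ip X X.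
Proof.
rewrite -frob_sqr -exprMn ler_sqr ?nnegrE ?nrm_ge0 ?nrm_le_frob //.
by rewrite mulr_ge0 ?frob_ge0.
Qed.

Lemma ip_le_nrm n (X Y : 'M[C]_n) : `|ip X Y| <= nrm X * nrm Y.
Proof.
rewrite ipE /nrm mulr_suml; apply: le_trans (ler_norm_sum _ _ _) _.
apply: ler_sum => i _; apply: le_trans (ler_norm_sum _ _ _) _.
rewrite mulr_suml; apply: ler_sum => j _; apply: le_trans (Re_le_cabs _) _.
by rewrite Normc.normcM cabsJ ler_wpM2l ?cabs_ge0 ?cabs_le_nrm.
Qed.

End Norms.

(** * Spectral theorem *)

Section RealSpectral.
Variable R : realType.

Definition orthogonal_mx n (Q : 'M[R]_n) := Q *m Q^T = 1%:M.

Lemma orthogonal_mul n (Q1 Q2 : 'M[R]_n) :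
  orthogonal_mx Q1 -> orthogonal_mx Q2 -> orthogonal_mx (Q1 *m Q2).
Proof.
by move=> o1 o2; rewrite /orthogonal_mx trmx_mul mulmxA -(mulmxA Q1) o2 mulmx1.
Qed.

Lemma scalar_mxE00 (X : 'M[R]_1) : X = (X 0 0)%:M.
Proof. by apply/matrixP => i j; rewrite !ord1 !mxE eqxx mulr1n. Qed.

Lemma dotT_ge0 n (v : 'cV[R]_n) : 0 <= (v^T *m v) 0 0.
Proof. by rewrite mxE sumr_ge0 // => i _; rewrite mxE -expr2 sqr_ge0. Qed.

Lemma dotT_eq0 n (v : 'cV[R]_n) : (v^T *m v) 0 0 = 0 -> v = 0.
Proof.
rewrite mxE => /psumr_eq0P v0; apply/matrixP => i j; rewrite ord1 mxE.
have /eqP : v^T 0 i * v i 0 = 0.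
  by apply: v0 => // k _; rewrite mxE -expr2 sqr_ge0.
by rewrite mxE mulf_eq0 orbb => /eqP.
Qed.

(* The Householder reflection exchanging the unit vectors [u] and [v]; when
   [u = v] the division by zero makes it the identity. *)
Lemma householder n (u v : 'cV[R]_n) :
  u^T *m u = 1%:M -> v^T *m v = 1%:M ->
  exists H : 'M[R]_n, [/\ H^T = H, orthogonal_mx H & H *m u = v].
Proof.
move=> uu vv; set w := v - u; set q := (w^T *m w) 0 0.
have wwE : w^T *m w = q%:M by rewrite [LHS]scalar_mxE00.
set H := 1%:M - (2 / q) *: (w *m w^T).
have HT : H^T = H by rewrite /H linearB /= trmx1 linearZ /= trmx_mul trmxK.
exists H; split=> //.
  set K := (2 / q) *: (w *m w^T) in H HT *.
  have KK : K *m K = K + K.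
    rewrite /K -scalemxAl -scalemxAr mulmxA -(mulmxA w) wwE mul_mx_scalar.
    rewrite -scalemxAl !scalerA -scalerDl; congr (_ *: _).
    have [->|q0] := eqVneq q 0; first by rewrite !(invr0, mulr0, mul0r) addr0.
    by field.
  rewrite /orthogonal_mx HT /H mulmxBl mul1mx mulmxBr mulmx1 KK.
  by rewrite opprB !addrA subrK addrK.
have uv : v^T *m u = u^T *m v.
  apply/matrixP => i j; rewrite !ord1 !mxE; apply: eq_bigr => k _.
  by rewrite !mxE mulrC.
set s := (u^T *m v) 0 0.
have sE : u^T *m v = s%:M by rewrite [LHS]scalar_mxE00.
have wT : w^T = v^T - u^T by rewrite /w linearB.
have qE : q = 2 - 2 * s.
  rewrite /q wT /w mulmxBl !mulmxBr uu vv uv sE !mxE eqxx !mulr1n; ring.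
have wu : w^T *m u = (s - 1)%:M.
  by rewrite wT mulmxBl uu uv sE raddfB.
rewrite mulmxBl mul1mx -scalemxAl -mulmxA wu mul_mx_scalar scalerA.
have [q0|q0] := eqVneq q 0.
  have w0 : w = 0 by apply: dotT_eq0.
  by rewrite w0 scaler0 subr0; apply/eqP; rewrite eq_sym -subr_eq0 -/w w0.
have -> : 2 / q * (s - 1) = -1.
  have -> : s - 1 = - (q / 2) by rewrite qE; field.
  by field.
by rewrite scaleN1r opprK /w addrC subrK.
Qed.

End RealSpectral.

Section Psd.
Variable R : realType.
Local Notation C := (R[i]).
Local Notation "a %:C" := (real_complex R a).
Local Notation Re := (@complex.Re R).
Local Notation Im := (@complex.Im R).

Lemma unitaryC n (P : 'M[C]_n) : unitary P -> ctr P *m P = 1%:M.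
Proof. exact: mulmx1C. Qed.

(** The spectral theorem for normal matrices gives X = S^-1 D S with S unitary, so P is the
    conjugate transpose of S; Hermitian symmetry makes D real. *)
Lemma hermitian_spectral n (X : 'M[C]_n) : hermitian X ->
  exists P : 'M[C]_n, exists lam : 'cV[R]_n,
    unitary P /\ X = P *m diag_mx (toC lam)^T *m ctr P.
Proof.
move=> hX.
have ctrq (Y : 'M[C]_n) : map_mx Num.conj Y^T = ctr Y by rewrite /ctr map_trmx.
have /orthomx_spectralP XE : X \is normalmx.
  by apply/normalmxP; rewrite ctrq hX.
have /mxOverP re : spectral_diag X \is a mxOver Num.real.
  by apply: hermitian_spectral_diag_real; apply/is_hermitianmxP; rewrite expr0 scale1r ctrq hX.
have uP := spectral_unitarymx X.
exists (ctr (spectralmx X)), (\col_i Re (spectral_diag X 0 i)); split.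
  rewrite /unitary ctrK; apply: mulmx1C.
  by move/unitarymxP: uP; rewrite ctrq.
have e : invmx (spectralmx X) = ctr (spectralmx X) := etrans (invmx_unitary uP) (ctrq _).
rewrite ctrK; apply: etrans XE _; move: re e.
set S := spectralmx X; set D := spectral_diag X => re ->.
have -> : (toC (\col_i Re (D 0 i)))^T = D by apply/rowP => i; rewrite !mxE (RRe_real (re 0 i)).
by [].
Qed.

Lemma toC_inj m n : injective (@toC R m n).
Proof. by move=> A B /matrixP e; apply/matrixP => i j; have := e i j; rewrite !mxE => -[]. Qed.

Lemma toCM m n p (A : 'M[R]_(m, n)) (B : 'M[R]_(n, p)) : toC (A *m B) = toC A *m toC B.
Proof. by rewrite /toC map_mxM. Qed.

Lemma toC_tr m n (A : 'M[R]_(m, n)) : toC A^T = ctr (toC A).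
Proof. by apply/matrixP => i j; rewrite !mxE /= oppr0. Qed.

(** A and the eigenvalue are real, so the real and imaginary parts of a complex eigenvector both
    satisfy the eigenvalue equation, and one of them is nonzero. *)
Lemma sym_eigenvector n (A : 'M[R]_n.+1) : A^T = A ->
  exists v : 'cV[R]_n.+1, exists a : R, v^T *m v = 1%:M /\ A *m v = a *: v.
Proof.
move=> sA.
have hA : hermitian (toC A) by rewrite /hermitian -toC_tr sA.
have [P [lam [uP AE]]] := hermitian_spectral hA.
pose u := col 0 P; pose a := lam 0 0.
have Au : toC A *m u = a%:C *: u.
  have : toC A *m P = P *m diag_mx (toC lam)^T.
    by rewrite AE -mulmxA (unitaryC uP) mulmx1.
  move/(congr1 (col 0)); rewrite colE -mulmxA -colE => ->.
  apply/matrixP => i j; rewrite !mxE (bigD1 0) //= big1 => [|k k0].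
    by rewrite !mxE eqxx mulr1n addr0 mulrC.
  by rewrite !mxE (negPf k0) mulr0n mulr0.
have u0 : u != 0.
  apply/eqP => u0; have : unitary P by []. move/unitaryC/matrixP/(_ 0 0).
  rewrite mxE big1 => [|k _]; first by rewrite !mxE eqxx => /eqP; rewrite eq_sym oner_eq0.
  by move/matrixP: u0 => /(_ k 0); rewrite !mxE => ->; rewrite mulr0.
have eig (g : C -> R) : (forall x y : C, g (x + y) = g x + g y) -> g 0 = 0 ->
    (forall (b : R) x, g (b%:C * x) = b * g x) ->
    A *m map_mx g u = a *: map_mx g u.
  move=> gD g0 gZ; apply/matrixP => i j; move/matrixP: Au => /(_ i j).
  rewrite !mxE => /(congr1 g); rewrite gZ => <-.
  rewrite (big_morph g gD g0); apply: eq_bigr => k _.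
  by rewrite !mxE gZ.
have [v [v0 Av]] : exists v : 'cV[R]_n.+1, v != 0 /\ A *m v = a *: v.
  have [re0|re0] := eqVneq (map_mx Re u) 0; last first.
    exists (map_mx Re u); split=> //; apply: eig => //; [exact: ReD|exact: ReZ].
  exists (map_mx Im u); split; last first.
    by apply: eig => // [[? ?] [? ?]//|b [x y]] /=; rewrite mul0r addr0.
  apply: contra u0 => /eqP im0; apply/eqP/matrixP => i j.
  move/matrixP: re0 => /(_ i j); move/matrixP: im0 => /(_ i j).
  by rewrite !mxE; case: (P i 0) => x y /= -> ->.
set q := (v^T *m v) 0 0.
have q0 : 0 < q.
  rewrite lt_neqAle dotT_ge0 andbT eq_sym; apply: contra v0 => /eqP.
  by move/dotT_eq0 => ->.
exists ((Num.sqrt q)^-1 *: v), a; split; last first.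
  by rewrite -scalemxAr Av !scalerA mulrC.
have -> : ((Num.sqrt q)^-1 *: v)^T = (Num.sqrt q)^-1 *: v^T by rewrite linearZ.
rewrite -scalemxAl -scalemxAr scalerA [v^T *m v]scalar_mxE00 -/q.
rewrite -invfM -expr2 sqr_sqrtr ?ltW // scale_scalar_mx mulVf //; exact: lt0r_neq0.
Qed.

(** Deflation: a Householder reflection H carries the first basis vector to a unit eigenvector, so H
    A H splits off a 1 x 1 block and the induction hypothesis applies to the rest. *)
Lemma sym_spectral n (A : 'M[R]_n) : A^T = A ->
  exists Q : 'M[R]_n, exists lam : 'cV[R]_n,
    orthogonal_mx Q /\ A = Q *m diag_mx lam^T *m Q^T.
Proof.
elim: n A => [|n IH] A sA.
  exists 1%:M, 0; split; first by rewrite /orthogonal_mx trmx1 mulmx1.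
  by apply/matrixP => -[].
have [v [a [vv Av]]] := sym_eigenvector sA.
pose e : 'cV[R]_(1 + n) := col_mx 1%:M 0.
have ee : e^T *m e = 1%:M by rewrite tr_col_mx mul_row_col trmx1 mulmx1 trmx0 mul0mx addr0.
have [H [HT HH He]] := householder ee vv.
have HH' : H *m H = 1%:M by rewrite -{2}HT.
have sB : (H *m A *m H)^T = H *m A *m H by rewrite !trmx_mul sA HT mulmxA.
pose B : 'M[R]_(1 + n) := H *m A *m H.
have Be : B *m e = a *: e.
  by rewrite /B -mulmxA He -mulmxA Av -scalemxAr -He mulmxA HH' mul1mx.
have BT : B^T = B by [].
have [Bul Bdl] : ulsubmx B = a%:M /\ dlsubmx B = 0.
  move: Be; rewrite -{1}(submxK B) mul_block_col !mulmx1 !mulmx0 !addr0.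
  by rewrite scale_col_mx scaler0 scalemx1 => /eq_col_mx.
have Bur : ursubmx B = 0 by rewrite -[ursubmx B]trmxK trmx_ursub BT Bdl trmx0.
have Bdr : (drsubmx B)^T = drsubmx B by rewrite trmx_drsub BT.
have [Q [lam [oQ BE]]] := IH _ Bdr.
pose K : 'M[R]_(1 + n) := block_mx 1%:M 0 0 Q.
exists (H *m K), (col_mx a%:M lam : 'cV[R]_(1 + n)); split.
  apply: (@orthogonal_mul _ (1 + n)) => //; rewrite /orthogonal_mx /K tr_block_mx !trmx0 trmx1.
  rewrite mulmx_block !mulmx0 !mul0mx mulmx1 !addr0 add0r oQ.
  exact: (esym (@scalar_mx_block R 1 n 1)).
have BK : B = K *m diag_mx (col_mx a%:M lam)^T *m K^T.
  rewrite -(submxK B) Bul Bdl Bur BE /K tr_block_mx !trmx0 trmx1.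
  rewrite tr_col_mx diag_mx_row tr_scalar_mx.
  have -> : diag_mx (a%:M : 'rV[R]_1) = a%:M.
    by apply/matrixP => i j; rewrite !ord1 !mxE eqxx !mulr1n.
  by rewrite !mulmx_block !(mulmx0, mul0mx, mulmx1, mul1mx, addr0, add0r).
have AE : (A : 'M[R]_(1 + n)) = H *m B *m H.
  have -> : H *m B = (A : 'M[R]_(1 + n)) *m H by rewrite /B -(mulmxA H A) mulmxA HH' mul1mx.
  by rewrite -mulmxA HH' mulmx1.
rewrite AE.
by rewrite BK (@trmx_mul _ _ (1 + n)) HT !mulmxA.
Qed.

End Psd.

(** * Positive semidefinite matrices *)

Section PsdTheory.
Variable R : realType.
Local Notation C := (R[i]).
Local Notation "a %:C" := (real_complex R a).
Local Notation Re := (@complex.Re R).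
Local Notation Im := (@complex.Im R).

Lemma hermitianD n (X Y : 'M[C]_n) : hermitian X -> hermitian Y -> hermitian (X + Y).
Proof. by rewrite /hermitian ctrD => -> ->. Qed.

Lemma hermitianN n (X : 'M[C]_n) : hermitian X -> hermitian (- X).
Proof. by rewrite /hermitian ctrN => ->. Qed.

Lemma hermitianB n (X Y : 'M[C]_n) : hermitian X -> hermitian Y -> hermitian (X - Y).
Proof. by move=> hX hY; apply/hermitianD/hermitianN. Qed.

Lemma hermitianZ n (a : R) (X : 'M[C]_n) : hermitian X -> hermitian (a%:C *: X).
Proof. by rewrite /hermitian ctrZ => ->. Qed.

Lemma hermitian0 n : hermitian (0 : 'M[C]_n).
Proof. exact: ctr0. Qed.

Lemma hermitian1 n : hermitian (1%:M : 'M[C]_n).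
Proof. exact: ctr1. Qed.

Lemma hermitian_congr m n (X : 'M[C]_n) (A : 'M[C]_(n, m)) :
  hermitian X -> hermitian (ctr A *m X *m A).
Proof. by rewrite /hermitian !ctrM ctrK mulmxA => ->. Qed.

(** The real part keeps all inequalities in the real field; for Hermitian X nothing is lost, by
    [hermitian_qf]. *)
Definition qf n (X : 'M[C]_n) (v : 'cV[C]_n) : R := Re ((ctr v *m X *m v) 0 0).

Lemma qfD n (X Y : 'M[C]_n) v : qf (X + Y) v = qf X v + qf Y v.
Proof. by rewrite /qf mulmxDr mulmxDl mxE ReD. Qed.

Lemma qfN n (X : 'M[C]_n) v : qf (- X) v = - qf X v.
Proof. by rewrite /qf mulmxN mulNmx mxE ReN. Qed.

Lemma qfZ n a (X : 'M[C]_n) v : qf (a%:C *: X) v = a * qf X v.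
Proof. by rewrite /qf -scalemxAr -scalemxAl mxE ReZ. Qed.

Lemma qf_ip n (X : 'M[C]_n) v : hermitian X -> qf X v = ip X (v *m ctr v).
Proof.
by move=> hX; rewrite /ip hX /qf mulmxA mxtrace_mulC mulmxA /mxtrace big_ord1.
Qed.

Lemma hermitian_qf n (X : 'M[C]_n) v : hermitian X ->
  (ctr v *m X *m v) 0 0 = (qf X v)%:C.
Proof.
move=> hX; have : ctr (ctr v *m X *m v) = ctr v *m X *m v by exact: hermitian_congr.
move/matrixP/(_ 0 0); rewrite ctrE /qf; case: (_ 0 0) => x y /= [] /eqP.
by rewrite eq_sym -addr_eq0 -mulr2n mulrn_eq0 /= => /eqP ->.
Qed.

Lemma psdP n (X : 'M[C]_n) : psd X <-> hermitian X /\ forall v, 0 <= qf X v.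
Proof.
split=> -[hX pX]; split=> // v; have := pX v; by rewrite hermitian_qf // ler0c.
Qed.

Lemma psdD n (X Y : 'M[C]_n) : psd X -> psd Y -> psd (X + Y).
Proof.
move=> /psdP[hX pX] /psdP[hY pY]; apply/psdP; split; first exact: hermitianD.
by move=> v; rewrite qfD addr_ge0.
Qed.

Lemma psdZ n a (X : 'M[C]_n) : 0 <= a -> psd X -> psd (a%:C *: X).
Proof.
move=> a0 /psdP[hX pX]; apply/psdP; split; first exact: hermitianZ.
by move=> v; rewrite qfZ mulr_ge0.
Qed.

Lemma psd_congr m n (X : 'M[C]_n) (A : 'M[C]_(n, m)) : psd X -> psd (ctr A *m X *m A).
Proof.
move=> [hX pX]; split; first exact: hermitian_congr.
by move=> v; have := pX (A *m v); rewrite ctrM !mulmxA.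
Qed.

Lemma qf1 n (v : 'cV[C]_n) : qf 1%:M v = \sum_i Normc.normc (v i 0) ^+ 2.
Proof.
by rewrite /qf mulmx1 mxE Re_sum; apply: eq_bigr => i _; rewrite ctrE Re_conjMx.
Qed.

Lemma psd1 n : psd (1%:M : 'M[C]_n).
Proof.
apply/psdP; split; first exact: hermitian1.
by move=> v; rewrite qf1 sumr_ge0 // => i _; rewrite sqr_ge0.
Qed.

Lemma psd_gram m n (A : 'M[C]_(m, n)) : psd (ctr A *m A).
Proof. by rewrite -[X in X *m A]mulmx1; apply/psd_congr/psd1. Qed.

Lemma psd_rank1 n (v : 'cV[C]_n) : psd (v *m ctr v).
Proof. by rewrite -{1}(ctrK v); apply: psd_gram. Qed.

Lemma unitary_eigen n (P : 'M[C]_n) (lam : 'cV[R]_n) i : unitary P ->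
  qf (P *m diag_mx (toC lam)^T *m ctr P) (col i P) = lam i 0.
Proof.
move=> /unitaryC uP; rewrite /qf !mulmxA.
have e : ctr (col i P) *m P = delta_mx 0 i.
  apply/matrixP => a b; rewrite ord1; move/matrixP: uP => /(_ i b).
  rewrite [1%:M _ _]mxE [delta_mx _ _ _ _]mxE eqxx /= (eq_sym b) => <-.
  by rewrite !mxE; apply: eq_bigr => k _; rewrite !ctrE !mxE.
have e' : ctr P *m col i P = delta_mx i 0.
  by rewrite -[LHS]ctrK ctrM ctrK e; apply/matrixP => a b; rewrite !mxE andbC conjc_nat.
rewrite e -mulmxA e' -rowE -colE !mxE eqxx mulr1n //.
Qed.

Lemma psd_eigen_ge0 n (P : 'M[C]_n) (lam : 'cV[R]_n) : unitary P ->
  psd (P *m diag_mx (toC lam)^T *m ctr P) -> forall i, 0 <= lam i 0.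
Proof. by move=> uP /psdP[_ pX] i; rewrite -(unitary_eigen lam i uP). Qed.

Lemma diag_mx_toCM n (a b : 'cV[R]_n) : diag_mx (toC a)^T *m diag_mx (toC b)^T =
  diag_mx (toC (\col_i (a i 0 * b i 0)))^T.
Proof.
rewrite mulmx_diag; congr diag_mx; apply/rowP => i.
by rewrite !mxE rmorphM.
Qed.

Lemma ctr_diag n (a : 'cV[R]_n) : ctr (diag_mx (toC a)^T) = diag_mx (toC a)^T.
Proof.
apply/matrixP => i j; rewrite ctrE !mxE.
by case: eqVneq => [->|] /=; rewrite ?mulr1n ?mulr0n ?conjc0 //= oppr0.
Qed.

Lemma psd_sqrt n (X : 'M[C]_n) : psd X -> exists B : 'M[C]_n, X = B *m ctr B.
Proof.
move=> pX; have [P [lam [uP XE]]] := hermitian_spectral pX.1.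
have lam0 : forall i, 0 <= lam i 0 by apply: (psd_eigen_ge0 uP); rewrite -XE.
exists (P *m diag_mx (toC (\col_i Num.sqrt (lam i 0)))^T).
rewrite ctrM ctr_diag -mulmxA (mulmxA (diag_mx _)) diag_mx_toCM mulmxA XE.
congr (_ *m diag_mx (toC _)^T *m _); apply/colP => i.
by rewrite !mxE -expr2 sqr_sqrtr.
Qed.

Lemma gram_eq0 m n (A : 'M[C]_(m, n)) : ctr A *m A = 0 -> A = 0.
Proof.
move=> AA; apply/matrixP => i j; rewrite mxE; apply: Normc.eq0_normc.
move/matrixP: AA => /(_ j j); rewrite !mxE => /(congr1 Re).
rewrite Re_sum => /psumr_eq0P h; apply/eqP; rewrite -sqrf_eq0 -Re_conjMx.
have := h _ i isT; rewrite ctrE => -> // k _.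
by rewrite ctrE Re_conjMx sqr_ge0.
Qed.

Lemma ip_gram_eq0 n (X : 'M[C]_n) : ip X X = 0 -> X = 0.
Proof.
move=> X0; apply: nrm_le0; have := nrm_sqr_le X; rewrite X0 mulr0.
by move=> h; rewrite -(@ler_pXn2r _ 2) ?nnegrE ?nrm_ge0 // expr0n.
Qed.

(** With X = B B^*, the form at v is the squared length of B^* v. *)
Lemma psd_qf0 n (X : 'M[C]_n) v : psd X -> qf X v = 0 -> X *m v = 0.
Proof.
move=> pX q0; have [B XE] := psd_sqrt pX.
have : ctr (ctr B *m v) *m (ctr B *m v) = 0.
  apply/matrixP => i j; rewrite !ord1 ctrM ctrK !mulmxA -(mulmxA _ B) -XE.
  by rewrite hermitian_qf ?q0 ?mxE //; case: pX.
by move/gram_eq0 => Bv; rewrite XE -mulmxA Bv mulmx0.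
Qed.

Lemma ip_gramE n (A B : 'M[C]_n) :
  ip (A *m ctr A) (B *m ctr B) = ip (ctr A *m B) (ctr A *m B).
Proof.
by rewrite /ip !ctrM !ctrK !mulmxA mxtrace_mulC !mulmxA.
Qed.

Lemma psd_ip_ge0 n (X Y : 'M[C]_n) : psd X -> psd Y -> 0 <= ip X Y.
Proof.
by move=> /psd_sqrt[A ->] /psd_sqrt[B ->]; rewrite ip_gramE ipxx_ge0.
Qed.

(** Complementarity: with X = A A^* and Y = B B^*, the inner product is the squared Frobenius norm
    of A^* B. *)
Lemma psd_ip0 n (X Y : 'M[C]_n) : psd X -> psd Y -> ip X Y = 0 -> X *m Y = 0.
Proof.
move=> /psd_sqrt[A ->] /psd_sqrt[B ->]; rewrite ip_gramE => /ip_gram_eq0 AB.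
by rewrite !mulmxA -(mulmxA A) AB mulmx0 mul0mx.
Qed.

(** If A is injective on the range of B, then A B has the rank of B. Both rank inequalities are
    obtained this way. The proof transposes because kernels and spans here are those of row
    vectors. *)
Lemma mxrank_le_ker n (A B : 'M[C]_n) :
  (forall v : 'cV[C]_n, A *m B *m v = 0 -> B *m v = 0) -> (\rank B <= \rank A)%N.
Proof.
move=> h; rewrite -mxrank_tr; apply: (@leq_trans (\rank (A *m B))); last exact: mxrankM_maxl.
rewrite -[X in (_ <= X)%N]mxrank_tr trmx_mul.
have <- := mxrank_mul_ker B^T A^T; rewrite -[X in (_ <= X)%N]addn0 leq_add2l leqn0 mxrank_eq0.
rewrite -submx0; apply/row_subP => i.
have := row_sub i (B^T :&: kermx A^T)%MS; set u := row i _.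
rewrite sub_capmx => /andP[/submxP[x ux] /sub_kermxP uk].
have Bx : B *m x^T = u^T by rewrite ux trmx_mul trmxK.
rewrite -(trmxK u) -Bx h ?trmx0 ?sub0mx //.
by rewrite -mulmxA Bx -(trmxK A) -trmx_mul uk trmx0.
Qed.

(** The scalar-field half of [inS], separated because it is stable under products and meaningful for
    rectangular matrices. *)
Definition inF (cplx : bool) m n (X : 'M[C]_(m, n)) := cplx = false -> real_mx X.

Lemma inFD cplx m n (X Y : 'M[C]_(m, n)) : inF cplx X -> inF cplx Y -> inF cplx (X + Y).
Proof.
move=> h1 h2 c i j; have := h1 c i j; have := h2 c i j; rewrite mxE.
by case: (X i j) (Y i j) => ? ? [? ?] /= -> ->; rewrite addr0.
Qed.

Lemma inFN cplx m n (X : 'M[C]_(m, n)) : inF cplx X -> inF cplx (- X).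
Proof.
by move=> h1 c i j; have := h1 c i j; rewrite mxE; case: (X i j) => ? ? /= ->; rewrite oppr0.
Qed.

Lemma Im_mul0 (x y : C) : Im x = 0 -> Im y = 0 -> Im (x * y) = 0.
Proof. by case: x y => [a b] [e f] /= -> ->; rewrite mulr0 mul0r addr0. Qed.

Lemma Im_sum0 (I : Type) (r : seq I) (p : pred I) (g : I -> C) :
  (forall i, Im (g i) = 0) -> Im (\sum_(i <- r | p i) g i) = 0.
Proof.
move=> h; elim/big_ind: _ => // x y; case: x y => [a b] [e f] /= -> ->.
exact: addr0.
Qed.

Lemma inFM cplx m n p (X : 'M[C]_(m, n)) (Y : 'M[C]_(n, p)) :
  inF cplx X -> inF cplx Y -> inF cplx (X *m Y).
Proof.
move=> h1 h2 c i j; rewrite mxE; apply: Im_sum0 => k.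
by apply: Im_mul0; [apply: h1|apply: h2].
Qed.

Lemma inF_toC cplx m n (A : 'M[R]_(m, n)) : inF cplx (toC A).
Proof. by move=> c i j; rewrite mxE. Qed.

Lemma inF_diag cplx n (a : 'cV[R]_n) : inF cplx (diag_mx (toC a)^T).
Proof. by move=> c i j; rewrite !mxE; case: eqP => //= _; rewrite ?mulr1n ?mulr0n. Qed.

Lemma inFZ cplx m n (a : R) (X : 'M[C]_(m, n)) : inF cplx X -> inF cplx (a%:C *: X).
Proof. by move=> h c i j; rewrite mxE; apply: Im_mul0 => //; apply: h. Qed.

Lemma inF_ctr cplx m n (X : 'M[C]_(m, n)) : inF cplx X -> inF cplx (ctr X).
Proof.
by move=> h c i j; rewrite ctrE; have := h c j i; case: (X j i) => ? ? /= ->; rewrite oppr0.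
Qed.

Lemma inSD cplx n (X Y : 'M[C]_n) : inS cplx X -> inS cplx Y -> inS cplx (X + Y).
Proof. by move=> [? ?] [? ?]; split; [apply: hermitianD|apply: inFD]. Qed.

Lemma inSN cplx n (X : 'M[C]_n) : inS cplx X -> inS cplx (- X).
Proof. by move=> [? ?]; split; [apply: hermitianN|apply: inFN]. Qed.

Lemma inSB cplx n (X Y : 'M[C]_n) : inS cplx X -> inS cplx Y -> inS cplx (X - Y).
Proof. by move=> ? ?; apply/inSD/inSN. Qed.

Lemma inSZ cplx n a (X : 'M[C]_n) : inS cplx X -> inS cplx (a%:C *: X).
Proof. by move=> [? ?]; split; [apply: hermitianZ|apply: inFZ]. Qed.

Lemma inS0 cplx n : inS cplx (0 : 'M[C]_n).
Proof. by split; [exact: hermitian0|move=> _ i j; rewrite mxE]. Qed.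

Lemma inS1 cplx n : inS cplx (1%:M : 'M[C]_n).
Proof. by split; [exact: hermitian1|move=> _ i j; rewrite !mxE; case: eqP]. Qed.

Lemma inS_sum cplx n (I : Type) (r : seq I) (p : pred I) (g : I -> 'M[C]_n) :
  (forall i, inS cplx (g i)) -> inS cplx (\sum_(i <- r | p i) g i).
Proof.
move=> h; elim/big_ind: _ => //; [exact: inS0|by move=> *; apply: inSD].
Qed.

Lemma real_mx_toC m n (X : 'M[C]_(m, n)) : real_mx X -> X = toC (map_mx Re X).
Proof.
move=> rX; apply/matrixP => i j; rewrite !mxE; have := rX i j.
by case: (X i j) => a b /= ->.
Qed.

(** [spectral_op] prescribes the value of F only on decompositions with nonincreasing eigenvalues,
    so eigenvalues have to be sorted. *)
Lemma sorting_perm n (lam : 'cV[R]_n) : exists s : 'S_n,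
  forall i j : 'I_n, (i <= j)%N -> lam (s j) 0 <= lam (s i) 0.
Proof.
pose t := [tuple lam i 0 | i < n].
have st : size (sort >=%R t) == n by rewrite size_sort size_tuple.
have [s sE] : exists s : 'S_n, Tuple st = [tuple tnth t (s i) | i < n] :> seq R.
  by apply/perm.tuple_permP; rewrite /= perm_sort.
exists s => i j ij.
have srt : sorted >=%R (Tuple st) by apply: sort_sorted => x y; exact: le_total.
have e k : lam (s k) 0 = tnth (Tuple st) k.
  by rewrite (tnth_nth 0) sE -tnth_nth tnth_mktuple tnth_mktuple.
rewrite !e !(tnth_nth 0).
have tr : transitive (>=%R : rel R) by move=> y x z xy yz; apply: le_trans yz xy.
have re : reflexive (>=%R : rel R) by move=> x; exact: lexx.
by apply: (sorted_leq_nth tr re 0 srt) => //; rewrite inE size_tuple.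
Qed.

Lemma spectral_sorted cplx n (X : 'M[C]_n) : inS cplx X ->
  exists P : 'M[C]_n, exists lam : 'cV[R]_n,
  [/\ unitary P, inF cplx P,
      forall i j : 'I_n, (i <= j)%N -> lam j 0 <= lam i 0 &
      X = P *m diag_mx (toC lam)^T *m ctr P].
Proof.
move=> [hX rX].
have [P [lam [uP cP XE]]] : exists P : 'M[C]_n, exists lam : 'cV[R]_n,
    [/\ unitary P, inF cplx P & X = P *m diag_mx (toC lam)^T *m ctr P].
  case: cplx rX => rX.
    by have [P [lam [? ?]]] := hermitian_spectral hX; exists P, lam.
  have XE := real_mx_toC (rX erefl).
  have /sym_spectral[Q [lam [oQ AE]]] : (map_mx Re X)^T = map_mx Re X.
    by apply: (@toC_inj R); rewrite toC_tr -XE.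
  exists (toC Q), lam; split=> //; last 1 first.
    rewrite {1}XE AE !toCM toC_tr; congr (_ *m _ *m _).
    by rewrite /toC map_diag_mx map_trmx.
  - by rewrite /unitary -toC_tr -toCM oQ /toC map_mx1.
  - exact: inF_toC.
have [s sP] := sorting_perm lam.
pose S : 'M[C]_n := perm_mx s.
have SS : ctr S = perm_mx s^-1.
  by rewrite -tr_perm_mx; apply/matrixP => i j; rewrite !mxE conjc_nat.
have S1 : ctr S *m S = 1%:M by rewrite SS -perm_mxM mulVg perm_mx1.
exists (P *m ctr S), (\col_i lam (s i) 0); split.
- by rewrite /unitary ctrM ctrK mulmxA -(mulmxA P) S1 mulmx1.
- apply/inFM/inF_ctr => // _ i j; rewrite !mxE; by case: eqP.
- by move=> i j ij; rewrite !mxE; apply: sP.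
rewrite XE ctrM ctrK !mulmxA; congr (_ *m _); rewrite -!mulmxA; congr (_ *m _).
have -> : diag_mx (toC (\col_i lam (s i) 0))^T = S *m diag_mx (toC lam)^T *m ctr S.
  rewrite SS -row_permE -col_permE; apply/matrixP => i j; rewrite !mxE.
  by rewrite (inj_eq perm_inj).
by rewrite !mulmxA S1 mul1mx -mulmxA S1 mulmx1.
Qed.

End PsdTheory.

(** * Asymptotics of the dual certificate *)

Section BigO.
Variables (R : realType) (J : Type).
Local Notation C := (R[i]).
Local Notation "a %:C" := (real_complex R a).

(* Uniform domination |a| <= K g of families indexed by [J]; below, an index is a
   whole realization of the data, and g is constant or the error level. *)
Definition bR (g a : J -> R) := exists2 K : R, 0 <= K & forall j, `|a j| <= K * g j.

Definition bO (g : J -> R) m n (U : J -> 'M[C]_(m, n)) := bR g (fun j => nrm (U j)).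

Lemma bR_le (g a b : J -> R) : (forall j, `|a j| <= `|b j|) -> bR g b -> bR g a.
Proof. by move=> ab [K K0 h]; exists K => // j; apply: le_trans (h j). Qed.

Lemma bR_cst (c : R) : bR (fun=> 1) (fun=> c).
Proof. by exists `|c| => // j; rewrite mulr1. Qed.

Lemma bRD (g a b : J -> R) : bR g a -> bR g b -> bR g (fun j => a j + b j).
Proof.
move=> [K K0 h] [L L0 h']; exists (K + L); first exact: addr_ge0.
by move=> j; rewrite mulrDl; apply: le_trans (ler_normD _ _) (lerD _ _).
Qed.

Lemma bRM (g a b : J -> R) : bR (fun=> 1) a -> bR g b -> bR g (fun j => a j * b j).
Proof.
move=> [K K0 h] [L L0 h']; exists (K * L); first exact: mulr_ge0.
move=> j; rewrite normrM -mulrA; apply: ler_pM => //.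
by rewrite -[K]mulr1.
Qed.

Lemma bR_sum (g : J -> R) (I : Type) (r : seq I) (a : I -> J -> R) :
  (forall i, bR g (a i)) -> bR g (fun j => \sum_(i <- r) a i j).
Proof.
move=> h; elim: r => [|i r IH].
  by exists 0 => // j; rewrite big_nil normr0 mul0r.
by apply: bR_le (bRD (h i) IH) => j; rewrite big_cons.
Qed.

Lemma bR_weaken (g a : J -> R) : (forall j, g j <= 1) -> bR g a -> bR (fun=> 1) a.
Proof.
by move=> g1 [K K0 h]; exists K => // j; apply: le_trans (h j) _; rewrite ler_wpM2l.
Qed.

Lemma bO_le (g : J -> R) m n p q (U : J -> 'M[C]_(m, n)) (V : J -> 'M[C]_(p, q)) :
  (forall j, nrm (U j) <= nrm (V j)) -> bO g V -> bO g U.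
Proof. by move=> h; apply: bR_le => j; rewrite !ger0_norm ?nrm_ge0. Qed.

Lemma bO_eq (g : J -> R) m n (U V : J -> 'M[C]_(m, n)) : U =1 V -> bO g V -> bO g U.
Proof. by move=> h; apply: bO_le => j; rewrite h. Qed.

Lemma bO_cst m n (U : 'M[C]_(m, n)) : bO (fun=> 1) (fun=> U).
Proof. exact: bR_cst. Qed.

Lemma bOD (g : J -> R) m n (U V : J -> 'M[C]_(m, n)) :
  bO g U -> bO g V -> bO g (fun j => U j + V j).
Proof.
move=> hU hV; apply: bR_le (bRD hU hV) => j.
by rewrite !ger0_norm ?addr_ge0 ?nrm_ge0 // nrmD.
Qed.

Lemma bON (g : J -> R) m n (U : J -> 'M[C]_(m, n)) : bO g U -> bO g (fun j => - U j).
Proof. by apply: bO_le => j; rewrite nrmN. Qed.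

Lemma bOB (g : J -> R) m n (U V : J -> 'M[C]_(m, n)) :
  bO g U -> bO g V -> bO g (fun j => U j - V j).
Proof. by move=> hU hV; apply: bOD => //; apply: bON. Qed.

Lemma bOMr (g : J -> R) m n p (U : J -> 'M[C]_(m, n)) (V : J -> 'M[C]_(n, p)) :
  bO (fun=> 1) U -> bO g V -> bO g (fun j => U j *m V j).
Proof.
move=> hU hV; apply: bR_le (bRM hU hV) => j.
by rewrite !ger0_norm ?mulr_ge0 ?nrm_ge0 // nrmM.
Qed.

Lemma bOMl (g : J -> R) m n p (U : J -> 'M[C]_(m, n)) (V : J -> 'M[C]_(n, p)) :
  bO g U -> bO (fun=> 1) V -> bO g (fun j => U j *m V j).
Proof.
move=> hU hV; apply: bR_le (bRM hV hU) => j.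
by rewrite !ger0_norm ?mulr_ge0 ?nrm_ge0 // mulrC nrmM.
Qed.

Lemma bOZ (g : J -> R) m n (a : J -> R) (U : J -> 'M[C]_(m, n)) :
  bR g a -> bO (fun=> 1) U -> bO g (fun j => (a j)%:C *: U j).
Proof.
move=> ha hU; apply: bR_le (bRM hU ha) => j.
by rewrite nrmZ !normrM !normr_id mulrC.
Qed.

Lemma bO_ctr (g : J -> R) m n (U : J -> 'M[C]_(m, n)) : bO g U -> bO g (fun j => ctr (U j)).
Proof. by apply: bO_le => j; rewrite nrm_ctr. Qed.

Lemma bOZc (g : J -> R) m n (a : R) (U : J -> 'M[C]_(m, n)) :
  bO g U -> bO g (fun j => a%:C *: U j).
Proof.
move=> hU; apply: bR_le (bRM (bR_cst a) hU) => j.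
by rewrite nrmZ !normrM !normr_id.
Qed.

Lemma bO_ip (g : J -> R) n (U V : J -> 'M[C]_n) :
  bO (fun=> 1) U -> bO g V -> bR g (fun j => ip (U j) (V j)).
Proof.
move=> hU hV; apply: bR_le (bRM hU hV) => j.
by rewrite [X in _ <= X]ger0_norm ?mulr_ge0 ?nrm_ge0 // ip_le_nrm.
Qed.

End BigO.

Section Core.
Variable R : realType.
Local Notation C := (R[i]).
Local Notation "a %:C" := (real_complex R a).
Local Notation Re := (@complex.Re R).
Local Notation Im := (@complex.Im R).

Lemma colmx_eqP m n (X Y : 'M[C]_(m, n)) : (forall v : 'cV[C]_n, X *m v = Y *m v) -> X = Y.
Proof. by move=> h; apply/matrixP => i j; move/matrixP: (h (delta_mx j 0)) => /(_ i 0); rewrite -!colE !mxE. Qed.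

(** Everything is read off one sorted eigenbasis: F X has eigenvalues f(lam), which are nonnegative
    and vanish exactly where lam does. [Xp] is the pseudo-inverse of X. *)
Lemma spectral_op_psd cplx n (f : 'cV[R]_n -> 'cV[R]_n) (F : 'M[C]_n -> 'M[C]_n) (X : 'M[C]_n) :
  (forall (i : 'I_n) (x : 'cV[R]_n), (forall j, 0 <= x j 0) -> 0 <= f x i 0) ->
  (forall (i : 'I_n) (x : 'cV[R]_n), f x i 0 = 0 <-> x i 0 = 0) ->
  spectral_op cplx f F -> inS cplx X -> psd X ->
  [/\ psd (F X), inS cplx (F X), (forall v : 'cV[C]_n, F X *m v = 0 <-> X *m v = 0) &
   exists Xp : 'M[C]_n, [/\ hermitian Xp, X *m Xp = Xp *m X & X *m Xp *m X = X]].
Proof.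
move=> f0 fE FE sX pX; have [P [lam [uP cP srt XE]]] := spectral_sorted sX.
have FXE : F X = P *m diag_mx (toC (f lam))^T *m ctr P.
  by apply: FE => // c; apply: cP.
have lam0 i : 0 <= lam i 0 by apply: (psd_eigen_ge0 uP); rewrite -XE.
have uC := unitaryC uP.
have uI : P \in unitmx by have [] := mulmx1_unit uP.
have hd (a : 'cV[R]_n) : hermitian (P *m diag_mx (toC a)^T *m ctr P).
  by rewrite /hermitian !ctrM ctrK ctr_diag mulmxA.
have mulE (a b : 'cV[R]_n) : P *m diag_mx (toC a)^T *m ctr P *m (P *m diag_mx (toC b)^T *m ctr P) =
    P *m diag_mx (toC (\col_i (a i 0 * b i 0)))^T *m ctr P.
  by rewrite -diag_mx_toCM !mulmxA; congr (_ *m _ *m _); rewrite -mulmxA uC mulmx1.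
split.
(* Writing f(lam) as the square of its root exhibits F X as a Gram matrix. *)
- rewrite FXE; have -> : f lam = \col_i (Num.sqrt (f lam i 0) * Num.sqrt (f lam i 0)).
    by apply/colP => i; rewrite mxE -expr2 sqr_sqrtr // f0.
  set s := (X in diag_mx (toC X)^T); have -> : s = \col_i ((\col_j Num.sqrt (f lam j 0)) i 0 * (\col_j Num.sqrt (f lam j 0)) i 0).
    by apply/colP => i; rewrite !mxE.
  rewrite -mulE -{1}(hd (\col_j Num.sqrt (f lam j 0))).
  exact: psd_gram.
- rewrite FXE; split; first exact: hd.
  by apply: inFM; [apply: inFM => //; exact: inF_diag|exact: inF_ctr].
- move=> v; set w := ctr P *m v.
  have key (a : 'cV[R]_n) : P *m diag_mx (toC a)^T *m ctr P *m v = 0 <-> forall i, (a i 0)%:C * w i 0 = 0.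
    rewrite -mulmxA -/w -mulmxA; split=> [h i|h].
      have /matrixP/(_ i 0) : diag_mx (toC a)^T *m w = 0.
        by rewrite -[LHS](mulKmx uI) h mulmx0.
      by rewrite mul_diag_mx !mxE.
    rewrite (_ : diag_mx _ *m w = 0) ?mulmx0 //; apply/colP => i.
    by have := h i; rewrite mul_diag_mx !mxE.
  rewrite FXE {1}XE !key; split=> h i; move: (h i) => /eqP; rewrite mulf_eq0 => /orP[/eqP[]|/eqP ->]; rewrite ?mulr0 //.
    by move/fE => ->; rewrite mul0r.
  by move/fE => ->; rewrite mul0r.
(* Since the inverse of 0 is 0, this is the Moore-Penrose inverse. *)
exists (P *m diag_mx (toC (\col_i (lam i 0)^-1))^T *m ctr P); split; first exact: hd.
  rewrite {1 2}XE !mulE; congr (_ *m diag_mx (toC _)^T *m _).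
  by apply/colP => i; rewrite !mxE mulrC.
rewrite {1 2}XE !mulE [RHS]XE; congr (_ *m diag_mx (toC _)^T *m _).
apply/colP => i; rewrite !mxE.
have [->|l0] := eqVneq (lam i 0) 0; first by rewrite mulr0.
by rewrite mulfV // mul1r.
Qed.

Section Asymptotics.
(** The section abstracts what the rank argument uses: [Xb + rho D] is the estimator, [S] the dual
    matrix, [Z] the identity minus the multiplier, [E] the gradient error, and [Xp] a Hermitian
    generalized inverse commuting with [Xb]. *)
Variables (J : Type) (n : nat) (k : R) (Xb Xp Fb : 'M[C]_n).
Variables (eps rho : J -> R) (D S E Z : J -> 'M[C]_n).

Hypothesis k_gt0 : 0 < k.
Hypothesis psdXb : psd Xb.
Hypothesis hXp : hermitian Xp.
Hypothesis XpC : Xb *m Xp = Xp *m Xb.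
Hypothesis XpK : Xb *m Xp *m Xb = Xb.
Hypothesis Fb_ker : forall v : 'cV[C]_n, Fb *m v = 0 <-> Xb *m v = 0.
Hypothesis eps_ge0 : forall j, 0 <= eps j.
Hypothesis eps_le1 : forall j, eps j <= 1.
Hypothesis rho_gt0 : forall j, 0 < rho j.
Hypothesis rho_le : forall j, rho j <= eps j.
Hypothesis bD : bO (fun=> 1) D.
Hypothesis bZ : bO (fun=> 1) Z.
Hypothesis bE : bO eps E.
Hypothesis hD : forall j, hermitian (D j).
Hypothesis hS : forall j, psd (S j).
Hypothesis SE : forall j, S j = k%:C *: D j + Z j - Fb + E j.
Hypothesis SX : forall j, S j *m (Xb + (rho j)%:C *: D j) = 0.
Hypothesis psdXh : forall j, psd (Xb + (rho j)%:C *: D j).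

(** [P1] and [P2] are the orthogonal projections onto the range and the kernel of [Xb]. *)
Variables P1 P2 : 'M[C]_n.
Hypothesis P1E : P1 = Xb *m Xp.
Hypothesis P2E : P2 = 1%:M - P1.

Lemma P1_herm : ctr P1 = P1.
Proof. by rewrite P1E ctrM hXp (psdXb.1 : ctr Xb = Xb) XpC. Qed.

Lemma P2_herm : ctr P2 = P2.
Proof. by rewrite P2E ctrB ctr1 P1_herm. Qed.

Lemma XbP2 : Xb *m P2 = 0.
Proof. by rewrite P2E mulmxBr mulmx1 P1E XpC mulmxA XpK subrr. Qed.

Lemma P2Xb : P2 *m Xb = 0.
Proof. by rewrite -[LHS]ctrK ctrM P2_herm (psdXb.1 : ctr Xb = Xb) XbP2 ctr0. Qed.

Lemma FbP2 : Fb *m P2 = 0.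
Proof.
apply: colmx_eqP => v; rewrite mul0mx -mulmxA; apply/Fb_ker.
by rewrite mulmxA XbP2 mul0mx.
Qed.

Lemma P2P2 : P2 *m P2 = P2.
Proof. by rewrite {1}P2E mulmxBl mul1mx P1E XpC -mulmxA XbP2 mulmx0 subr0. Qed.

Lemma P1P1 : P1 *m P1 = P1.
Proof. by rewrite P1E mulmxA XpK. Qed.

Lemma psdP1 : psd P1.
Proof. by rewrite -P1P1 -{1}P1_herm; apply: psd_gram. Qed.

(** Compressing the estimator to the kernel of [Xb] removes [Xb] and leaves a positive multiple of
    the compressed D. *)
Lemma psd_P2DP2 j : psd (P2 *m D j *m P2).
Proof.
have -> : P2 *m D j *m P2 = (rho j)^-1%:C *: (ctr P2 *m (Xb + (rho j)%:C *: D j) *m P2).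
  rewrite P2_herm mulmxDr P2Xb add0r -scalemxAr -scalemxAl scalerA -rmorphM.
  by rewrite mulVf ?gt_eqF // scale1r.
by apply: psdZ (psd_congr _ (psdXh j)); rewrite invr_ge0 ltW.
Qed.

Lemma bS : bO (fun=> 1) S.
Proof.
apply: bO_eq (bOD (bOB (bOD (bOZc k bD) bZ) (bO_cst J Fb)) (bR_weaken eps_le1 bE)).
exact: SE.
Qed.

Lemma bO_rho : bR eps rho.
Proof.
by exists 1 => // j; rewrite mul1r ger0_norm ?rho_le // ltW.
Qed.

(** From S (Xb + rho D) = 0 one gets S Xb = - rho S D; multiplying by [Xp] on the right turns S Xb
    into S P1. *)
Lemma bO_SP1 : bO eps (fun j => S j *m P1).
Proof.
apply: bO_eq (bOMl (bON (bOZ bO_rho (bOMr bS bD))) (bO_cst J Xp)) => j.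
rewrite P1E mulmxA; congr (_ *m _); apply/eqP.
by rewrite -addr_eq0 scalemxAr -mulmxDr SX.
Qed.

(* S kills the estimator, hence is small on the range of Xb; only the compression
   of S to the kernel of Xb can be large. *)
Lemma off_diagonal_small :
  bO eps (fun j => k%:C *: (D j - P2 *m D j *m P2) + (Z j - P2 *m Z j *m P2) - Fb).
Proof.
have bP2 : bO (fun=> 1) (fun _ : J => P2) := bO_cst J P2.
(* The decomposition is S - P2 S P2 = S P1 + P1 S P2, where P1 S is the adjoint of S P1. *)
have b1 : bO eps (fun j => S j - P2 *m S j *m P2).
  apply: bO_eq (bOD bO_SP1 (bOMl (bO_ctr bO_SP1) bP2)) => j.
  rewrite ctrM P1_herm ((hS j).1 : ctr (S j) = S j) -[P1](subKr 1%:M) -P2E.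
  rewrite mulmxBr mulmx1 mulmxBl mul1mx mulmxBl addrA.
  by rewrite subrK.
apply: bO_eq (bOB b1 (bOB bE (bOMl (bOMr bP2 bE) bP2))) => j.
rewrite SE !(mulmxDr, mulmxDl, mulmxBr, mulmxBl, mulmxN, mulNmx) -(mulmxA P2 Fb) FbP2 mulmx0.
rewrite subr0 -!scalemxAr -!scalemxAl scalerBr; apply/matrixP => a b; rewrite !mxE; ring.
Qed.

Lemma qf_bound m (U : 'M[C]_m) (v : 'cV[C]_m) : `|qf U v| <= nrm U * qf 1%:M v.
Proof.
rewrite qf1 /qf mxE Re_sum; set N := \sum_i Normc.normc _ ^+ 2.
have N_ge i : Normc.normc (v i 0) ^+ 2 <= N.
  by rewrite /N (bigD1 i) // lerDl sumr_ge0 // => l _; rewrite sqr_ge0.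
apply: le_trans (ler_norm_sum _ _ _) _.
rewrite /nrm exchange_big mulr_suml; apply: ler_sum => b _.
rewrite mxE; apply: le_trans (Re_le_cabs _) _; rewrite Normc.normcM.
apply: (@le_trans _ _ (\sum_i Normc.normc (v i 0) * Normc.normc (U i b) * Normc.normc (v b 0))).
  rewrite -mulr_suml ler_wpM2r ?cabs_ge0 //; apply: le_trans (cabs_sum _ _ _) _.
  by apply: ler_sum => i _; rewrite Normc.normcM ctrE cabsJ.
rewrite mulr_suml; apply: ler_sum => i _.
rewrite mulrAC mulrC ler_wpM2l ?cabs_ge0 //.
(* The product of the moduli of two coordinates of v is at most half the sum of their squares, hence
   at most N. *)
have := N_ge i; have := N_ge b; have := sqr_ge0 (Normc.normc (v i 0) - Normc.normc (v b 0)).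
nra.
Qed.

Lemma qf1_eq0 m (v : 'cV[C]_m) : qf 1%:M v <= 0 -> v = 0.
Proof.
move=> h; have /(psd_qf0 (psd1 R m)) : qf 1%:M v = 0.
  by apply/le_anti; rewrite h; have /psdP[_ ->] := psd1 R m.
by rewrite mul1mx.
Qed.

(** Used with N the squared length of a vector u, and q, z, e the contributions of kD, Z and E to
    the form of S at u: then c N <= z <= - e <= (c / 2) N. *)
Lemma le0_of_balance (c N z e a q : R) : 0 < c -> 0 <= N -> c * N <= z ->
  - (a * N) <= e -> a <= c / 2 -> 0 <= q -> q + z + e = 0 -> N <= 0.
Proof.
move=> c0 N0 cz ae ac q0 qze.
have aN : a * N <= c / 2 * N by rewrite ler_wpM2r.
by rewrite -(pmulr_rle0 N c0); lra.
Qed.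

Lemma rank_eq_of_dual_lower_bound c e1 : 0 < c -> 0 < e1 ->
  (forall j v, eps j <= e1 -> c * qf 1%:M v <= qf (Z j) v) ->
  exists2 e0, 0 < e0 & forall j, eps j <= e0 -> \rank (Xb + (rho j)%:C *: D j)%R = \rank Xb.
Proof.
move=> c0 e10 hZ; have [K K0 hE] := bE; have [L L0 hL] := bOMr (bO_cst J Xp) bD.
(* [M] dominates the constants of both E and Xp D and is positive. The threshold keeps E below c / 2
   and rho times the norm of Xp D below 1 / 2. *)
set M := K + L + 1; have M0 : 0 < M by rewrite /M ltr_wpDl // addr_ge0.
have e00 : 0 < Num.min e1 (Num.min (c / 2 / M) (2^-1 / M)).
  by rewrite !lt_min e10 !divr_gt0.
exists (Num.min e1 (Num.min (c / 2 / M) (2^-1 / M))) => // j.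
rewrite !le_min => /and3P[je1 je2 je3].
have eM1 : eps j * M <= c / 2 by rewrite -ler_pdivlMr.
have eM2 : eps j * M <= 2^-1 by rewrite -ler_pdivlMr.
have ej := eps_ge0 j.
apply/eqP; rewrite eqn_leq; apply/andP; split; apply: mxrank_le_ker => v Xv.
  (* Here u lies in the range of the estimator, which S annihilates, and in the kernel of [Xb], on
     which [Fb] vanishes and D is nonnegative; positivity of Z then forces u = 0. *)
  set u := (Xb + (rho j)%:C *: D j) *m v.
  have Xu : Xb *m u = 0 by rewrite /u mulmxA.
  have Su : S j *m u = 0 by rewrite /u mulmxA SX mul0mx.
  have : qf (S j) u = 0 by rewrite /qf -mulmxA Su mulmx0 mxE.
  have Fu : qf Fb u = 0 by rewrite /qf -mulmxA (proj2 (Fb_ker u)) // mulmx0 mxE.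
  have Du : 0 <= qf (D j) u.
    have /psdP[_ /(_ u)] := psdXh j; rewrite qfD qfZ {1}/qf -mulmxA Xu mulmx0 mxE add0r.
    by rewrite pmulr_rge0.
  rewrite SE qfD qfD qfN qfD qfZ Fu subr0 => e.
  apply: qf1_eq0.
  have N0 : 0 <= qf 1%:M u by have /psdP[_ ->] := psd1 R n.
  have := qf_bound (E j) u; rewrite ler_norml => /andP[E1 _].
  have EK : nrm (E j) <= c / 2.
    apply: le_trans eM1; apply: le_trans (le_trans (ler_norm _) (hE j)) _.
    by rewrite mulrC ler_wpM2l // /M -addrA lerDl addr_ge0.
  have kD : 0 <= k * qf (D j) u by rewrite mulr_ge0 // ltW.
  exact: le0_of_balance c0 N0 (hZ j u je1) E1 EK kD e.
have [u uX] : exists u, u = Xb *m v by exists (Xb *m v).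
rewrite -uX.
(* Conversely, u is in the range of [Xb] and killed by the estimator. Applying [Xp] makes u a fixed
   point of the map - rho Xp D, which contracts by 1 / 2. *)
have uE : u = - ((rho j)%:C *: (Xp *m D j *m u)).
  have : Xp *m ((Xb + (rho j)%:C *: D j) *m u) = 0 by rewrite uX (mulmxA _ Xb) Xv mulmx0.
  rewrite mulmxDl mulmxDr -scalemxAl -scalemxAr !mulmxA -XpC.
  have -> : Xb *m Xp *m u = u by rewrite uX mulmxA XpK.
  by move/eqP; rewrite addr_eq0 => /eqP.
apply: nrm_le0.
have : nrm u <= 2^-1 * nrm u.
  rewrite {1}uE nrmN nrmZ; apply: (@le_trans _ _ (rho j * (L * nrm u))).
    rewrite gtr0_norm //; apply: ler_wpM2l; first exact: ltW.
    apply: le_trans (nrmM _ _) _.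
    by rewrite ler_wpM2r ?nrm_ge0 // (le_trans (ler_norm _)) // (le_trans (hL j)) // mulr1.
  rewrite mulrA ler_wpM2r ?nrm_ge0 //; apply: le_trans eM2.
  by apply: ler_pM => //; [exact: ltW|rewrite /M; lra].
by have := nrm_ge0 u; lra.
Qed.

Lemma Re_entry_le m (U : 'M[C]_m) i l : `|Re (U i l)| <= nrm U.
Proof. exact: le_trans (Re_le_cabs _) (cabs_le_nrm _ _ _). Qed.

Lemma qf_delta m (U : 'M[C]_m) i : qf U (delta_mx i 0) = Re (U i i).
Proof.
have e : ctr (delta_mx i 0 : 'cV[C]_m) = delta_mx 0 i.
  by apply/matrixP => a b; rewrite ctrE !mxE andbC conjc_nat.
by rewrite /qf e -rowE -colE !mxE.
Qed.

Lemma psd_diag_ge0 m (U : 'M[C]_m) i : psd U -> 0 <= Re (U i i).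
Proof. by move=> /psdP[_ h]; rewrite -qf_delta. Qed.

(** The default value 1 of the minimum covers an empty index set. *)
Lemma pos_lower_bound (T : finType) (p : pred T) (g : T -> R) :
  (forall i, p i -> 0 < g i) -> exists2 c, 0 < c & forall i, p i -> c <= g i.
Proof.
move=> h; exists (\big[Num.min/1]_(i | p i) g i); first exact: lt_bigmin ltr01 h.
by move=> i pi; apply: bigmin_le_cond.
Qed.

(* At an index where [z] is minimal the averages on the right cannot exceed [z]
   unless [z] is nonnegative there. *)
Lemma averaged_lower_bound m (I : {set 'I_m}) (z : 'I_m -> R) (p : 'I_m -> 'I_m -> R) c :
  0 < c -> (forall i l, 0 <= p i l) -> (forall i, \sum_l p i l <= 1) ->
  (forall i, i \notin I -> z i = 1) ->
  (forall i, i \in I -> \sum_l p i l * z l + c <= z i) ->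
  forall i, Num.min 1 c <= z i.
Proof.
move=> c0 p0 p1 zI zc i.
have [i0 _ h] := @Order.TotalTheory.arg_minP _ _ _ i xpredT z isT.
apply: le_trans (h i isT); have [iI|/zI ->] := boolP (i0 \in I); last by rewrite ge_min lexx.
rewrite ge_min; apply/orP; right; have := zc _ iI.
have h1 : \sum_l p i0 l * z i0 <= \sum_l p i0 l * z l.
  by apply: ler_sum => l _; rewrite ler_wpM2l // h.
have := p1 i0; have : 0 <= \sum_l p i0 l by apply: sumr_ge0.
rewrite -mulr_suml in h1; move: h1; set q := \sum_l p i0 l; set t := \sum_l _.
move=> h1 q0 q1 h2; have [zi|zi] := lerP 0 (z i0).
  have : 0 <= q * z i0 by rewrite mulr_ge0.
  lra.
have : z i0 <= q * z i0 by nra.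
lra.
Qed.

(** The i-th diagonal entry of [off_diagonal_small], for i in I, reads z_i - sum_l p_il z_l - Fb_ii
    - k (P2 D P2)_ii = O(eps), with weights p_il = |P2_li|^2. Dropping the nonnegative D-term and
    giving up half of the least Fb_ii to the error yields the hypothesis of
    [averaged_lower_bound]. *)
Lemma dual_bound_diag (I : {set 'I_n}) (z : J -> 'I_n -> R) :
  (forall j, Z j = diag_mx (toC (\col_i z j i))^T) ->
  (forall j i, i \notin I -> z j i = 1) -> (forall j i, i \in I -> D j i i = 0) ->
  (forall i, i \in I -> 0 < Re (Fb i i)) ->
  exists c e1, [/\ 0 < c, 0 < e1 & forall j v, eps j <= e1 -> c * qf 1%:M v <= qf (Z j) v].
Proof.
move=> ZE zI DI FI; have [c0 c00 hc0] := pos_lower_bound FI.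
have [K K0 hK] := off_diagonal_small.
have K1 : 0 < K + 1 by rewrite ltr_wpDl.
exists (Num.min 1 (c0 / 2)), (c0 / 2 / (K + 1)); split.
- by rewrite lt_min ltr01 divr_gt0.
- by rewrite !divr_gt0.
move=> j v je.
have eK : K * eps j <= c0 / 2.
  move: je; rewrite ler_pdivlMr // => je; have := eps_ge0 j; nra.
have P2J i l : P2 i l = conjc (P2 l i) by rewrite -{1}P2_herm ctrE.
have zlb : forall i, Num.min 1 (c0 / 2) <= z j i.
  apply: (@averaged_lower_bound _ I _ (fun i l => Normc.normc (P2 l i) ^+ 2)).
  - exact: divr_gt0.
  - by move=> i l; apply: sqr_ge0.
  (* The weights are substochastic: they sum to (P2 P2)_ii = (P2)_ii = 1 - (P1)_ii. *)
  - move=> i; have -> : \sum_l Normc.normc (P2 l i) ^+ 2 = Re (P2 i i).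
      rewrite -{2}P2P2 mxE Re_sum; apply: eq_bigr => l _.
      by rewrite (P2J i l) Re_conjMx.
    by rewrite P2E !mxE eqxx ReD ReN /= gerBl; apply: psd_diag_ge0; exact: psdP1.
  - exact: zI.
  move=> i iI; have := le_trans (le_trans (Re_entry_le _ i i) (ler_norm _)) (hK j).
  rewrite ler_norml => /andP[+ _].
  have -> : \sum_l Normc.normc (P2 l i) ^+ 2 * z j l = Re ((P2 *m Z j *m P2) i i).
    rewrite mxE Re_sum; apply: eq_bigr => l _.
    rewrite ZE mul_mx_diag !mxE (P2J i l).
    by rewrite -mulrA mulrCA ReZ Re_conjMx mulrC.
  move: (psd_diag_ge0 i (psd_P2DP2 j)) (hc0 _ iI).
  set W1 := P2 *m D j *m P2; set W2 := P2 *m Z j *m P2; move=> W10 Fi.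
  have -> : (k%:C *: (D j - W1) + (Z j - W2) - Fb) i i =
     k%:C * (D j i i - W1 i i) + (Z j i i - W2 i i) - Fb i i by rewrite !mxE.
  rewrite DI // ZE.
  have -> : diag_mx (toC (\col_i0 z j i0))^T i i = (z j i)%:C by rewrite !mxE eqxx mulr1n.
  rewrite !(ReD, ReN, ReZ) /= => h.
  have kW : 0 <= k * Re (W1 i i) by rewrite mulr_ge0 // ltW.
  lra.
have -> : qf (Z j) v = \sum_i z j i * Normc.normc (v i 0) ^+ 2.
  rewrite /qf ZE mul_mx_diag mxE Re_sum; apply: eq_bigr => i _.
  rewrite [X in X * v i 0]mxE ctrE [(toC _)^T _ _]mxE [toC _ _ _]mxE mulrAC mulrC ReZ Re_conjMx.
  by rewrite !mxE.
rewrite qf1 mulr_sumr; apply: ler_sum => i _.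
by rewrite ler_wpM2r ?sqr_ge0.
Qed.

(** Taking traces, z tr(1 - P2) = z tr P1 must exceed tr Fb up to O(eps). As tr P1 >= 0, this forces
    z > 0, and the denominator tr P1 + 1 needs no separate proof that tr P1 is nonzero. *)
Lemma dual_bound_scalar (z : J -> R) :
  (forall j, Z j = (z j)%:C%:M) -> (forall j, ip 1%:M (D j) = 0) -> 0 < ip 1%:M Fb ->
  exists c e1, [/\ 0 < c, 0 < e1 & forall j v, eps j <= e1 -> c * qf 1%:M v <= qf (Z j) v].
Proof.
move=> ZE trD trF; set c0 := ip 1%:M Fb in trF.
have [K K0 hK] := bO_ip (bO_cst J (1%:M : 'M[C]_n)) off_diagonal_small.
have K1 : 0 < K + 1 by rewrite ltr_wpDl.
have t0 : 0 <= ip 1%:M P1 by apply: psd_ip_ge0 => //; [exact: psd1|exact: psdP1].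
have t1 : 0 < ip 1%:M P1 + 1 by rewrite ltr_wpDl.
exists (c0 / 2 / (ip 1%:M P1 + 1)), (c0 / 2 / (K + 1)); split.
- by rewrite !divr_gt0.
- by rewrite !divr_gt0.
move=> j v je.
have eK : K * eps j <= c0 / 2.
  move: je; rewrite ler_pdivlMr // => je; have := eps_ge0 j; nra.
have ZS : Z j = (z j)%:C *: 1%:M by rewrite ZE scalemx1.
have := hK j; rewrite ler_norml => /andP[h _].
move: h; rewrite ipBr ipDr ipZr !ipBr trD {1}ZS ipZr.
have -> : P2 *m Z j *m P2 = (z j)%:C *: P2.
  by rewrite ZS -scalemxAr mulmx1 -scalemxAl P2P2.
have -> : ip 1%:M ((z j)%:C *: P2) = z j * (ip 1%:M (1%:M : 'M[C]_n) - ip 1%:M P1).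
  by rewrite ipZr P2E ipBr.
have := psd_ip_ge0 (psd1 R n) (psd_P2DP2 j); set W := ip _ (P2 *m D j *m P2).
move: t0 t1; set t := ip 1%:M P1; set q := ip 1%:M 1%:M; rewrite -/c0 => t0 t1 W0 h.
have kW : 0 <= k * W by rewrite mulr_ge0 // ltW.
have zt : c0 / 2 <= z j * t by move: h; rewrite sub0r mulrN; lra.
have z0 : 0 < z j.
  rewrite ltNge; apply/negP => zn; have : z j * t <= 0 by rewrite mulr_le0_ge0.
  lra.
rewrite ZS qfZ ler_wpM2r //; last by rewrite ler_pdivrMr // mulrDr mulr1; lra.
by have /psdP[_ ->] := psd1 R n.
Qed.

End Asymptotics.
End Core.

(** * Optimality conditions *)

Section KKT.
Variable R : realType.
Local Notation C := (R[i]).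
Local Notation "a %:C" := (real_complex R a).
Local Notation Re := (@complex.Re R).
Local Notation Im := (@complex.Im R).

Lemma hermitian_diag n (X : 'M[C]_n) i : hermitian X -> X i i = (Re (X i i))%:C.
Proof.
move/matrixP/(_ i i); rewrite ctrE; case: (X i i) => x y /= [] /eqP.
by rewrite eq_sym -addr_eq0 -mulr2n mulrn_eq0 /= => /eqP ->.
Qed.

Definition dgm n (a : 'I_n -> R) : 'M[C]_n := diag_mx (toC (\col_i a i))^T.

Lemma dgmE n (a : 'I_n -> R) i j : dgm a i j = if i == j then (a i)%:C else 0.
Proof. by rewrite !mxE; case: eqVneq => [->|]; rewrite ?mulr1n ?mulr0n. Qed.

Lemma inS_dgm cplx n (a : 'I_n -> R) : inS cplx (dgm a).
Proof. by split; [exact: ctr_diag|exact: inF_diag]. Qed.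

Lemma ip_dgm n (a : 'I_n -> R) (X : 'M[C]_n) : ip (dgm a) X = \sum_i a i * Re (X i i).
Proof.
rewrite ipE; apply: eq_bigr => i _; rewrite (bigD1 i) //= big1 => [|j ji].
  by rewrite dgmE eqxx conjc_real ReZ addr0.
by rewrite dgmE eq_sym (negPf ji) conjc0 mul0r.
Qed.

Lemma psd_dgm n (a : 'I_n -> R) : (forall i, 0 <= a i) -> psd (dgm a).
Proof.
move=> a0; pose b i := Num.sqrt (a i).
have -> : dgm a = ctr (dgm b) *m dgm b.
  rewrite ctr_diag diag_mx_toCM; congr (diag_mx (toC _)^T); apply/colP => i.
  by rewrite !mxE -expr2 sqr_sqrtr.
exact: psd_gram.
Qed.

Lemma mul_dgm_entry n (b : 'I_n -> R) (Y : 'M[C]_n) i :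
  (dgm b *m Y *m dgm b) i i = (b i ^+ 2)%:C * Y i i.
Proof.
rewrite mul_mx_diag mxE mul_diag_mx !mxE mulrAC -expr2.
by rewrite rmorphXn.
Qed.

Lemma tr_dgm n (a : 'I_n -> R) (X : 'M[C]_n) :
  Re (\tr (dgm a *m X)) = \sum_i a i * Re (X i i).
Proof.
rewrite /mxtrace Re_sum; apply: eq_bigr => i _; rewrite mul_diag_mx !mxE.
exact: ReZ.
Qed.

(** For negative c1, a step e with e (|c2| + |c3| + 1) <= - c1 / 2 would make the polynomial
    negative. The cubic term is there for the diagonal perturbations, which are cubic in e. *)
Lemma first_order_ge0 (e0 c1 c2 c3 : R) : 0 < e0 -> e0 <= 1 ->
  (forall e, 0 < e -> e <= e0 -> 0 <= e * c1 + e ^+ 2 * c2 + e ^+ 3 * c3) -> 0 <= c1.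
Proof.
move=> e00 e01 h; rewrite leNgt; apply/negP => c1n.
pose K := `|c2| + `|c3| + 1; have K0 : 0 < K by rewrite /K ltr_wpDl ?addr_ge0.
pose e := Num.min e0 (- c1 / 2 / K).
have e_gt0 : 0 < e by rewrite lt_min e00 !divr_gt0 // oppr_gt0.
have e1 : e <= 1 by apply: le_trans e01; rewrite ge_min lexx.
have eK : e * K <= - c1 / 2 by rewrite -ler_pdivlMr // ge_min lexx orbT.
have := h e e_gt0; rewrite ge_min lexx => /(_ isT).
have -> : e * c1 + e ^+ 2 * c2 + e ^+ 3 * c3 = e * (c1 + e * (c2 + e * c3)) by ring.
rewrite pmulr_rge0 // => h1.
have h2 : e * (c2 + e * c3) <= e * K.
  rewrite ler_wpM2l ?(ltW e_gt0) //.
  have : e * c3 <= `|c3|.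
    by apply: le_trans (ler_norm _) _; rewrite normrM gtr0_norm // ler_piMl.
  have := ler_norm c2; rewrite /K; lra.
lra.
Qed.

Lemma map_conj_psd n (X : 'M[C]_n) : psd X -> psd (map_mx (@conjc R) X).
Proof.
move=> /psd_sqrt[B ->]; rewrite map_mxM /=.
have -> : map_mx (@conjc R) (ctr B) = ctr (map_mx (@conjc R) B).
  by apply/matrixP => i j; rewrite !mxE.
by rewrite -{1}[map_mx _ B]ctrK; apply: psd_gram.
Qed.

Lemma ip_map_conj n (S X : 'M[C]_n) : real_mx S -> ip S (map_mx (@conjc R) X) = ip S X.
Proof.
move=> rS; rewrite !ipE; apply: eq_bigr => i _; apply: eq_bigr => j _.
rewrite mxE; case: (S i j) (rS i j) => [a b] /= ->.
by case: (X i j) => x y /=; rewrite oppr0 !mul0r.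
Qed.

(* The test matrix v v^* is replaced by its real part in the real symmetric case. *)
Lemma psd_of_ip cplx n (S : 'M[C]_n) : inS cplx S ->
  (forall W, inS cplx W -> psd W -> 0 <= ip S W) -> psd S.
Proof.
move=> [hS cS] h; apply/psdP; split=> // v; rewrite qf_ip //.
have pv := psd_rank1 v.
case: cplx cS h => cS h; first by apply: h => //; split=> //; case: pv.
pose W := v *m ctr v + map_mx (@conjc R) (v *m ctr v).
have pW : psd W by apply/psdD/map_conj_psd.
have : 0 <= ip S W.
  apply: h => //; split; first by case: pW.
  by move=> _ i j; rewrite /W mxE [map_mx _ _ i j]mxE; case: ((v *m ctr v) i j) => x y /=; rewrite subrr.
by rewrite ipDr (ip_map_conj _ (cS erefl)) -mulr2n pmulrn_lge0.
Qed.

(** Expansion in powers of e of (1 - eA)(X + eW)(1 - eA) + e^2 (D0 - e D1) - X, with the matrix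
    products replaced by atoms so that it becomes an entrywise ring identity. *)
Lemma perturbation_identity (K : comNzRingType) n (e : K)
  (x w t1 t2 t3 t4 t5 t6 t7 t8 : 'M[K]_n) :
  x + e *: w - (e *: t3 + e *: (e *: t5)) -
    (e *: t4 + e *: (e *: t6) - (e *: (e *: t1) + e *: (e *: (e *: t2)))) +
    e ^+ 2 *: (t7 - e *: t8) - x =
  e *: (w - (t3 + t4)) + e ^+ 2 *: (t1 - (t5 + t6) + t7) + e ^+ 3 *: (t2 - t8).
Proof. by apply/matrixP => i j; rewrite !mxE; ring. Qed.

(** * Multipliers for prescribed diagonal entries *)

Section Diagonal.
Variables (cplx : bool) (n : nat) (I : {set 'I_n}) (G Xh : 'M[C]_n).
Hypothesis sG : inS cplx G.
Hypothesis sX : inS cplx Xh.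
Hypothesis pX : psd Xh.
Hypothesis xI : forall i, i \in I -> 0 < Re (Xh i i).
Hypothesis VI : forall X, inS cplx X -> psd X -> (forall i, i \in I -> X i i = Xh i i) ->
  0 <= ip G (X - Xh).

(** The i-th diagonal entry of (G - Diag(y)) Xh = 0 reads (G Xh)_ii = y_i Xh_ii, which leaves no
    other choice of y_i. *)
Definition diag_multiplier i : R :=
  if i \in I then Re ((G *m Xh) i i) / Re (Xh i i) else 0.

Let S := G - dgm diag_multiplier.

(* Conjugating Xh + e W by 1 - e A, with A = Diag_I (W_ii / (2 X_ii)), restores the
   prescribed diagonal up to a nonnegative term of order e^2. *)
Lemma dual_ge0 W : inS cplx W ->
  (forall e, 0 < e -> e <= 1 -> psd (Xh + e%:C *: W)) -> 0 <= ip S W.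
Proof.
move=> sW pW.
pose x i := Re (Xh i i); pose w i := Re (W i i).
pose a i := if i \in I then w i / (2 * x i) else 0.
(* The corrections solve (1 - e a)^2 (x + e w) + e^2 (d0 - e d1) = x for a = w / (2 x). *)
pose d0 i := if i \in I then 3 * w i ^+ 2 / (4 * x i) else 0.
pose d1 i := if i \in I then w i ^+ 3 / (4 * x i ^+ 2) else 0.
pose A := dgm a.
have [c c0 hc] := pos_lower_bound xI.
have N0 : 0 < nrm W + 1 by rewrite ltr_wpDl ?nrm_ge0.
(* Below this bound e w_i <= x_i, so the diagonal correction, a positive multiple of w_i^2 (3 x_i -
   e w_i), is nonnegative. *)
pose e0 := Num.min 1 (c / (nrm W + 1)).
have e00 : 0 < e0 by rewrite lt_min ltr01 divr_gt0.
have e01 : e0 <= 1 by rewrite ge_min lexx.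
pose Q1 := W - (A *m Xh + Xh *m A).
pose Q2 := A *m Xh *m A - (A *m W + W *m A) + dgm d0.
pose Q3 := A *m W *m A - dgm d1.
(* The conjugation contributes - 2 sum_i a_i (G Xh)_ii = - sum_i y_i w_i at first order, which is
   exactly the multiplier term of S. *)
have c1E : ip G Q1 = ip S W.
  rewrite /Q1 /S ipBr ipBl ipDr; congr (_ - _); rewrite ip_dgm.
  have AC : ctr A = A by exact: ctr_diag.
  have -> : ip G (A *m Xh) = \sum_i a i * Re ((G *m Xh) i i).
    by rewrite ipC /ip ctrM AC (sX.1 : ctr Xh = Xh) -mulmxA mxtrace_mulC -mulmxA tr_dgm.
  have -> : ip G (Xh *m A) = \sum_i a i * Re ((G *m Xh) i i).
    by rewrite /ip (sG.1 : ctr G = G) mulmxA mxtrace_mulC tr_dgm.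
  rewrite -big_split /=; apply: eq_bigr => i _.
  rewrite /a /diag_multiplier /w /x; case: ifP => [iI|_]; last by rewrite !mul0r addr0.
  by field; rewrite gt_eqF // xI.
rewrite -c1E; apply: (first_order_ge0 (c2 := ip G Q2) (c3 := ip G Q3) e00 e01) => e ep ee0.
pose b i := 1 - e * a i; pose d i := e ^+ 2 * (d0 i - e * d1 i).
have Xe := VI (X := dgm b *m (Xh + e%:C *: W) *m dgm b + dgm d).
have bE : dgm b = 1%:M - e%:C *: A.
  apply/matrixP => i j; rewrite dgmE !mxE; case: eqVneq => [->|_] /=; rewrite ?mulr1n ?mulr0n.
    by rewrite /b rmorphB rmorph1 rmorphM.
  by rewrite mulr0 subr0.
have dE : dgm d = (e ^+ 2)%:C *: (dgm d0 - e%:C *: dgm d1).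
  apply/matrixP => i j; rewrite dgmE !mxE; case: eqVneq => [->|_] /=; rewrite ?mulr1n ?mulr0n.
    by rewrite /d -(rmorphM _ e) -rmorphB -rmorphM.
  by rewrite mulr0 subr0 mulr0.
have diffE : dgm b *m (Xh + e%:C *: W) *m dgm b + dgm d - Xh =
    e%:C *: Q1 + (e ^+ 2)%:C *: Q2 + (e ^+ 3)%:C *: Q3.
  rewrite bE dE /Q1 /Q2 /Q3 !(mulmxBl, mulmxDl, mulmxBr, mulmxDr, mul1mx, mulmx1, mulNmx, mulmxN).
  rewrite -!(scalemxAl, scalemxAr).
  move: (A *m Xh *m A) (A *m W *m A) => t1 t2.
  move: (A *m Xh) (Xh *m A) (A *m W) (W *m A) (dgm d0) (dgm d1) => t3 t4 t5 t6 t7 t8.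
  have -> : (e ^+ 2)%:C = e%:C ^+ 2 by exact: rmorphXn.
  have -> : (e ^+ 3)%:C = e%:C ^+ 3 by exact: rmorphXn.
  exact: perturbation_identity.
rewrite -!ipZr -!ipDr -diffE; apply: Xe.
- apply: inSD; last exact: inS_dgm.
  have sb := inS_dgm cplx b; split; first by rewrite -{1}sb.1; apply/hermitian_congr/hermitianD/hermitianZ; case: sW; case: sX.
  by do 2?apply: inFM; try exact: sb.2; apply: inFD; [case: sX|apply: inFZ; case: sW].
- apply: psdD; last first.
    apply: psd_dgm => i; rewrite /d mulr_ge0 ?sqr_ge0 // /d0 /d1.
    case: ifP => iI; last by rewrite mulr0 subr0.
    have xi : 0 < x i by apply: xI.
    have -> : 3 * w i ^+ 2 / (4 * x i) - e * (w i ^+ 3 / (4 * x i ^+ 2)) =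
        w i ^+ 2 * (3 * x i - e * w i) / (4 * x i ^+ 2) by field; rewrite gt_eqF.
    apply: divr_ge0; last by rewrite mulr_ge0 ?sqr_ge0.
    apply: mulr_ge0; first exact: sqr_ge0.
    rewrite subr_ge0.
    have ew : e * w i <= e * (nrm W + 1).
      rewrite ler_wpM2l ?(ltW ep) //; apply: le_trans (ler_norm _) _.
      by apply: le_trans (Re_entry_le _ _ _) _; rewrite lerDl.
    have : e * (nrm W + 1) <= c by rewrite -ler_pdivlMr // (le_trans ee0) // ge_min lexx orbT.
    have := hc i iI; rewrite -/(x i); lra.
  rewrite -{1}(inS_dgm cplx b).1; apply/psd_congr/pW => //; exact: le_trans e01.
- move=> i iI; rewrite mxE mul_dgm_entry dgmE eqxx mxE [(_ *: W) i i]mxE.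
  rewrite (hermitian_diag i sX.1) (hermitian_diag i sW.1) -/(x i) -/(w i).
  rewrite -!(rmorphM, rmorphD) /=; congr (_%:C).
  have xi : 0 < x i by apply: xI.
  rewrite /b /d /a /d0 /d1 iI; field; by rewrite gt_eqF.
Qed.

(** Positive semidefinite directions W show that S is positive semidefinite; the direction - Xh,
    admissible because (1 - e) Xh stays in the cone, gives complementarity. *)
Lemma kkt_diag : psd S /\ S *m Xh = 0.
Proof.
have sS : inS cplx S by apply: inSB => //; exact: inS_dgm.
have pS : psd S.
  apply: (psd_of_ip sS) => W sW pW; apply: dual_ge0 => // e e0 _.
  by apply: psdD => //; apply: psdZ => //; apply: ltW.
split=> //; apply: psd_ip0 => //; apply/le_anti; rewrite psd_ip_ge0 // andbT.
have : 0 <= ip S (- Xh).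
  apply: dual_ge0 => [|e e0 e1]; first exact: inSN.
  have -> : Xh + e%:C *: - Xh = (1 - e)%:C *: Xh.
    by rewrite scalerN rmorphB rmorph1 scalerBl scale1r.
  by apply: psdZ => //; rewrite subr_ge0.
by rewrite ipNr oppr_ge0.
Qed.

End Diagonal.

(** * Multiplier for the trace constraint *)

Section Trace.
Variables (n : nat) (G Xh : 'M[C]_n).
Hypothesis hG : hermitian G.
Hypothesis pX : psd Xh.
Hypothesis trX : ip 1%:M Xh = 1.
Hypothesis VI : forall X, psd X -> ip 1%:M X = 1 -> 0 <= ip G (X - Xh).

(** The multiplier is forced by <S, Xh> = 0 and the unit trace. Positivity follows by testing
    against the normalized rank-one matrices v v^* / |v|^2, which are feasible. *)
Lemma kkt_trace : psd (G - (ip G Xh)%:C%:M) /\ (G - (ip G Xh)%:C%:M) *m Xh = 0.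
Proof.
set y := ip G Xh; have -> : y%:C%:M = y%:C *: 1%:M :> 'M[C]_n by rewrite scalemx1.
have hS : hermitian (G - y%:C *: 1%:M) by apply: hermitianB => //; apply/hermitianZ/hermitian1.
have pS : psd (G - y%:C *: 1%:M).
  apply/psdP; split=> // v; rewrite qfD qfN qfZ.
  have [t0|t0] := ler0P (qf 1%:M v).
    have -> : v = 0 by apply: qf1_eq0.
    by rewrite /qf !mulmx0 mxE mulr0 subr0.
  have := VI (X := (qf 1%:M v)^-1%:C *: (v *m ctr v)).
  rewrite ipZr -!qf_ip ?mulVf ?gt_eqF //; last exact: hermitian1.
  rewrite ipBr ipZr -qf_ip // -/y => /(_ _ erefl) h.
  have {h} : 0 <= (qf 1%:M v)^-1 * qf G v - y.
    by apply: h; apply: psdZ; [rewrite invr_ge0 ltW|exact: psd_rank1].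
  rewrite subr_ge0 mulrC ler_pdivlMr // => h; by rewrite subr_ge0.
split=> //; apply: psd_ip0 => //.
by rewrite ipBl ipZl trX mulr1 -/y subrr.
Qed.

End Trace.
End KKT.

(** * The entry basis *)

Section Basis.
Variable R : realType.
Local Notation C := (R[i]).
Local Notation "a %:C" := (real_complex R a).
Local Notation Re := (@complex.Re R).
Local Notation Im := (@complex.Im R).

Lemma ip_delta n (a : C) i j (Y : 'M[C]_n) :
  ip (a *: delta_mx i j) Y = Re (conjc a * Y i j).
Proof.
rewrite ipE (bigD1 i) //= (bigD1 j) //= !big1 => [|k ki|k kj].
- by rewrite !mxE !eqxx mulr1 !addr0.
- by rewrite big1 // => l _; rewrite !mxE (negPf ki) mulr0 conjc0 mul0r.
- by rewrite !mxE (negPf kj) andbF mulr0 conjc0 mul0r.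
Qed.

Let s : R := (Num.sqrt 2)^-1.

Definition sym_unit n (i j : 'I_n) : 'M[C]_n := s%:C *: (delta_mx i j + delta_mx j i).
Definition skew_unit n (i j : 'I_n) : 'M[C]_n :=
  ('i%C * s%:C) *: (delta_mx i j - delta_mx j i).

Lemma s_sqr : s * s = 2^-1.
Proof. by rewrite -expr2 /s exprVn sqr_sqrtr. Qed.

Lemma ip_sym_unit n (i j : 'I_n) (Y : 'M[C]_n) :
  ip (sym_unit i j) Y = s * (Re (Y i j) + Re (Y j i)).
Proof.
by rewrite /sym_unit scalerDr ipDl !ip_delta !conjc_real !ReZ mulrDr.
Qed.

Lemma ip_skew_unit n (i j : 'I_n) (Y : 'M[C]_n) :
  ip (skew_unit i j) Y = s * (Im (Y i j) - Im (Y j i)).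
Proof.
rewrite /skew_unit scalerBr ipBl !ip_delta.
by case: (Y i j) (Y j i) => [a b] [c d] /=; ring.
Qed.

Lemma ip_delta1 n (i j : 'I_n) (Y : 'M[C]_n) : ip (delta_mx i j) Y = Re (Y i j).
Proof. by rewrite -[delta_mx i j]scale1r ip_delta conjc1 mul1r. Qed.

Lemma sym_unitE n (i j k l : 'I_n) : sym_unit i j k l =
  (s * (((k == i) && (l == j))%:R + ((k == j) && (l == i))%:R))%:C.
Proof. by rewrite !mxE rmorphM rmorphD !rmorph_nat. Qed.

Lemma skew_unitE n (i j k l : 'I_n) : skew_unit i j k l =
  'i%C * (s * (((k == i) && (l == j))%:R - ((k == j) && (l == i))%:R))%:C.
Proof. by rewrite !mxE rmorphM rmorphB !rmorph_nat mulrA. Qed.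

Lemma swap_neq n (i j k l : 'I_n) : (i < j)%N -> (k < l)%N -> (i == l) && (j == k) = false.
Proof.
move=> ij kl; apply/negbTE/negP => /andP[/eqP il /eqP jk].
by move: ij kl; rewrite il jk => lk /(ltn_trans lk); rewrite ltnn.
Qed.

Lemma ReiM (a : R) : Re ('i%C * a%:C) = 0.
Proof. by rewrite /= mul0r mul1r subr0. Qed.

Lemma ImiM (a : R) : Im ('i%C * a%:C) = a.
Proof. by rewrite /= mul0r mul1r add0r. Qed.

Lemma conj_iM (a : R) : conjc ('i%C * a%:C) = 'i%C * (- a)%:C.
Proof. by apply/eqP; rewrite eq_complex /=; apply/andP; split; apply/eqP; ring. Qed.

Lemma Re_real (a : R) : Re a%:C = a. Proof. by []. Qed.

Lemma ip_sym_sym n (i j k l : 'I_n) : (i < j)%N -> (k < l)%N ->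
  ip (sym_unit i j) (sym_unit k l) = ((i == k) && (j == l))%:R.
Proof.
move=> ij kl; rewrite ip_sym_unit !sym_unitE !Re_real.
rewrite (swap_neq ij kl) [(j == k) && _]andbC (swap_neq ij kl) [(j == l) && _]andbC.
by rewrite addr0 add0r -mulrDr mulrA s_sqr -mulr2n -[_ *+ 2]mulr_natr; field.
Qed.

Lemma ip_skew_skew n (i j k l : 'I_n) : (i < j)%N -> (k < l)%N ->
  ip (skew_unit i j) (skew_unit k l) = ((i == k) && (j == l))%:R.
Proof.
move=> ij kl; rewrite ip_skew_unit !skew_unitE !ImiM.
rewrite (swap_neq ij kl) [(j == k) && _]andbC (swap_neq ij kl) [(j == l) && _]andbC.
by rewrite subr0 sub0r mulrN opprK -mulrDr mulrA s_sqr -mulr2n -[_ *+ 2]mulr_natr; field.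
Qed.

Lemma ip_sym_skew n (i j k l : 'I_n) : ip (sym_unit i j) (skew_unit k l) = 0.
Proof. by rewrite ip_sym_unit !skew_unitE !ReiM addr0 mulr0. Qed.

Lemma offdiag_neq n (i k l : 'I_n) : (k < l)%N -> (i == k) && (i == l) = false.
Proof.
by move=> kl; apply/negbTE/negP => /andP[/eqP -> /eqP kl']; move: kl; rewrite kl' ltnn.
Qed.

Lemma ip_delta_sym n (i k l : 'I_n) : (k < l)%N -> ip (delta_mx i i) (sym_unit k l) = 0.
Proof.
move=> kl; rewrite ip_delta1 sym_unitE Re_real (offdiag_neq _ kl).
by rewrite [(i == l) && _]andbC (offdiag_neq _ kl) addr0 mulr0.
Qed.

Lemma ip_delta_skew n (i k l : 'I_n) : ip (delta_mx i i) (skew_unit k l) = 0.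
Proof. by rewrite ip_delta1 skew_unitE ReiM. Qed.

Lemma ip_delta_delta n (i k : 'I_n) : ip (delta_mx i i : 'M[C]_n) (delta_mx k k) = (i == k)%:R.
Proof. by rewrite ip_delta1 mxE andbb; case: eqP. Qed.

Lemma basis_aP cplx n (X : 'M[C]_n) : basis_a cplx X ->
  [\/ exists i, X = delta_mx i i,
      exists i j : 'I_n, (i < j)%N /\ X = sym_unit i j |
      cplx /\ exists i j : 'I_n, (i < j)%N /\ X = skew_unit i j].
Proof.
case=> [[[i _ <-]|[i [j [ij ->]]]]|[c [i [j [ij ->]]]]].
- by constructor 1; exists i.
- by constructor 2; exists i, j.
- by constructor 3; split=> //; exists i, j.
Qed.

Lemma basis_a_orthonormal cplx n (X Y : 'M[C]_n) : basis_a cplx X -> basis_a cplx Y ->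
  ip X Y = (X == Y)%:R.
Proof.
(* [same] and [diff] turn a value of the inner product computed from indices into the equality test
   on matrices: unit norm makes equality and orthogonality incompatible. *)
have same (T : Type) (b : bool) (Z W : 'M[C]_n) : (b -> Z = W) -> ip Z W = b%:R -> ip Z Z = 1 -> ip Z W = (Z == W)%:R.
  move=> bZ e e1; have [ZW|ZW] := eqVneq Z W; first by rewrite -ZW.
  by rewrite e; case: b bZ {e} => // /(_ isT) /eqP; rewrite (negPf ZW).
have diff (Z W : 'M[C]_n) : ip Z W = 0 -> ip Z Z = 1 -> ip Z W = (Z == W)%:R.
  move=> e e1; have [ZW|//] := eqVneq Z W.
  by move: e; rewrite -ZW e1 => /eqP; rewrite oner_eq0.
move=> /basis_aP[[i ->]|[i [j [ij ->]]]|[_ [i [j [ij ->]]]]];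
  move=> /basis_aP[[k ->]|[k [l [kl ->]]]|[_ [k [l [kl ->]]]]].
- by apply: (same nat (i == k)) => [/eqP ->//||]; rewrite ip_delta_delta // eqxx.
- by apply: diff; rewrite ?ip_delta_sym // ip_delta_delta eqxx.
- by apply: diff; rewrite ?ip_delta_skew // ip_delta_delta eqxx.
- by apply: diff; rewrite ?ip_sym_sym ?eqxx // ipC ip_delta_sym.
- by apply: (same nat ((i == k) && (j == l))) => [/andP[/eqP -> /eqP ->]//||]; rewrite ip_sym_sym // !eqxx.
- by apply: diff; rewrite ?ip_sym_sym ?eqxx // ip_sym_skew.
- by apply: diff; rewrite ?ip_skew_skew ?eqxx // ipC ip_delta_skew.
- by apply: diff; rewrite ?ip_skew_skew ?eqxx // ipC ip_sym_skew.
- by apply: (same nat ((i == k) && (j == l))) => [/andP[/eqP -> /eqP ->]//||]; rewrite ip_skew_skew // !eqxx.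
Qed.

Lemma inS_basis_a cplx n (X : 'M[C]_n) : basis_a cplx X -> inS cplx X.
Proof.
move=> /basis_aP[[i ->]|[i [j [ij ->]]]|[c [i [j [ij ->]]]]]; split.
- by apply/matrixP => a b; rewrite ctrE !mxE conjc_nat andbC.
- by move=> _ a b; rewrite mxE; case: (_ && _).
- apply/matrixP => a b; rewrite ctrE !sym_unitE. rewrite [(b == i) && _]andbC [(b == j) && _]andbC addrC; exact: conjc_real.
- by move=> _ a b; rewrite sym_unitE.
- apply/matrixP => a b; rewrite ctrE !skew_unitE conj_iM -mulrN opprB.
  by rewrite [(b == i) && _]andbC [(b == j) && _]andbC.
- by rewrite c.
Qed.

Section Expansion.
Variables (cplx : bool) (n d : nat) (Theta : 'I_d -> 'M[C]_n).

Definition expands (X : 'M[C]_n) := X = \sum_k (ip (Theta k) X)%:C *: Theta k.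

Lemma expands0 : expands 0.
Proof. by rewrite /expands big1 // => k _; rewrite ip0r scale0r. Qed.

Lemma expandsD X Y : expands X -> expands Y -> expands (X + Y).
Proof.
move=> eX eY; rewrite /expands {1}eX {1}eY -big_split /=; apply: eq_bigr => k _.
by rewrite ipDr rmorphD scalerDl.
Qed.

Lemma expandsZ (a : R) X : expands X -> expands (a%:C *: X).
Proof.
move=> eX; rewrite /expands {1}eX scaler_sumr; apply: eq_bigr => k _.
by rewrite ipZr rmorphM scalerA.
Qed.

Lemma expands_sum (T : Type) (r : seq T) (p : pred T) (g : T -> 'M[C]_n) :
  (forall i, expands (g i)) -> expands (\sum_(i <- r | p i) g i).
Proof.
by move=> h; elim/big_ind: _ => //; [exact: expands0|exact: expandsD].
Qed.

Hypothesis Theta_inj : injective Theta.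
Hypothesis Theta_range : range Theta = @basis_a R cplx n.

Lemma basis_a_expands X : basis_a cplx X -> expands X.
Proof.
move=> bX; have [l _ lX] : range Theta X by rewrite Theta_range.
rewrite /expands -lX (bigD1 l) //= big1 ?addr0 => [|k kl].
  by rewrite (@basis_a_orthonormal cplx) ?eqxx ?scale1r // lX.
rewrite (@basis_a_orthonormal cplx) ?lX //; last by rewrite -Theta_range; exists k.
by rewrite -lX (inj_eq Theta_inj) (negPf kl) scale0r.
Qed.

(** Expandable matrices form a real vector space, so it suffices to write X as a real combination of
    basis elements. Averaging X with its adjoint does this; the skew part drops out for real X. *)
Lemma inS_expands X : inS cplx X -> expands X.
Proof.
move=> [hX rX].
have sq2 : Num.sqrt 2 * s = 1 :> R by rewrite /s mulfV // gt_eqF // sqrtr_gt0.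
have e_sym (i j : 'I_n) : expands (delta_mx i j + delta_mx j i).
  have lt (a b : 'I_n) : (a < b)%N -> expands (delta_mx a b + delta_mx b a).
    move=> ab; have -> : delta_mx a b + delta_mx b a = (Num.sqrt 2)%:C *: sym_unit a b.
      by rewrite /sym_unit scalerA -rmorphM sq2 scale1r.
    by apply/expandsZ/basis_a_expands; left; right; exists a, b.
  have [ij|ij|/val_inj ->] := ltngtP i j; [exact: lt|by rewrite addrC; apply: lt|].
  by apply: expandsD; apply: basis_a_expands; left; left; exists j.
have e_skew (i j : 'I_n) : cplx -> expands ('i%C *: (delta_mx i j - delta_mx j i)).
  move=> c; have lt (a b : 'I_n) : (a < b)%N -> expands ('i%C *: (delta_mx a b - delta_mx b a)).
    move=> ab; have -> : 'i%C *: (delta_mx a b - delta_mx b a) = (Num.sqrt 2)%:C *: skew_unit a b.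
      by rewrite /skew_unit scalerA mulrCA -rmorphM sq2 mulr1.
    by apply/expandsZ/basis_a_expands; right; split=> //; exists a, b.
  have [ij|ij|/val_inj ->] := ltngtP i j; [exact: lt| |by rewrite subrr scaler0; exact: expands0].
  rewrite -opprB scalerN -scaleN1r -(rmorphN1 (real_complex R)).
  by apply: expandsZ; apply: lt.
have -> : X = 2^-1%:C *: \sum_i \sum_j
    ((Re (X i j))%:C *: (delta_mx i j + delta_mx j i) +
     (Im (X i j))%:C *: ('i%C *: (delta_mx i j - delta_mx j i))).
  have e1 : X = \sum_i \sum_j X i j *: delta_mx i j by exact: matrix_sum_delta.
  have e2 : X = \sum_i \sum_j conjc (X i j) *: delta_mx j i.
    rewrite -{1}hX {1}(matrix_sum_delta (ctr X)) exchange_big.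
    by do 2![apply: eq_bigr => ? _]; rewrite ctrE.
  have -> : X = 2^-1%:C *: (X + X).
    apply/matrixP => i j; rewrite !mxE; case: (X i j) => a b; apply/eqP.
    by rewrite eq_complex /=; apply/andP; split; apply/eqP; field.
  congr (_ *: _); apply: etrans (congr2 +%R e1 e2) _; rewrite -big_split /=; apply: eq_bigr => i _.
  rewrite -big_split /=; apply: eq_bigr => j _.
  move: (delta_mx i j : 'M[C]_n) (delta_mx j i) => U V; apply/matrixP => k l; rewrite !mxE.
  case: (X i j) (U k l) (V k l) => [a b] [u1 u2] [v1 v2]; apply/eqP.
  by rewrite eq_complex /=; apply/andP; split; apply/eqP; field.
apply/expandsZ/expands_sum => i; apply: expands_sum => j.
apply: expandsD; first exact: expandsZ.
case: cplx rX e_skew => rX e_skew; first by apply/expandsZ/e_skew.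
by rewrite rX // scale0r; exact: expands0.
Qed.

End Expansion.
End Basis.

(** * Rank recovery for a single realization *)

Section Deterministic.
Variable R : realType.
Local Notation C := (R[i]).
Local Notation "a %:C" := (real_complex R a).
Local Notation Re := (@complex.Re R).
Local Notation Im := (@complex.Im R).

Definition freq d (m : nat) (om : nat -> 'I_d) (k : 'I_d) : R :=
  m%:R^-1 * \sum_(i < m) (om i == k)%:R.

Definition noise d (m : nat) (om : nat -> 'I_d) (xi : nat -> R) (k : 'I_d) : R :=
  m%:R^-1 * \sum_(i < m) (om i == k)%:R * xi i.

(** Regroups the observations by the basis element sampled, so that only frequencies and noise
    averages remain. *)
Lemma sum_by_index d (V : nmodType) m (om : nat -> 'I_d) (g : 'I_d -> 'I_m -> V) :
  \sum_(i < m) g (om i) i = \sum_k \sum_(i < m) (if om i == k then g k i else 0).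
Proof.
rewrite exchange_big; apply: eq_bigr => i _ /=.
rewrite (bigD1 (om i)) //= eqxx big1 ?addr0 // => k /negPf.
by rewrite eq_sym => ->.
Qed.

(** * Gradient of the objective and variational inequality *)

Section Gradient.
Variables (cplx : bool) (n d : nat) (Theta : 'I_d -> 'M[C]_n) (alpha : {set 'I_d}).
Variables (Xb : 'M[C]_n) (nu : R) (F : 'M[C]_n -> 'M[C]_n).
Variables (m : nat) (om : nat -> 'I_d) (xi : nat -> R) (Xt : 'M[C]_n) (rho gam : R).
Variable Xh : 'M[C]_n.

Definition rc_grad : 'M[C]_n :=
  m%:R^-1%:C *: (\sum_(i < m) (ip (Theta (om i)) (Xh - Xb) - nu * xi i)%:C *: Theta (om i))
  + rho%:C *: (1%:M - F Xt + gam%:C *: (Xh - Xt)).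

Lemma rc_gradE : rc_grad =
  \sum_k (freq m om k * ip (Theta k) (Xh - Xb) - nu * noise m om xi k)%:C *: Theta k
  + rho%:C *: (1%:M - F Xt + gam%:C *: (Xh - Xt)).
Proof.
rewrite /rc_grad; congr (_ + _).
rewrite (sum_by_index om (fun k (i : 'I_m) => (ip (Theta k) (Xh - Xb) - nu * xi i)%:C *: Theta k)).
rewrite scaler_sumr; apply: eq_bigr => k _.
have -> : freq m om k * ip (Theta k) (Xh - Xb) - nu * noise m om xi k =
    m%:R^-1 * \sum_(i < m) (om i == k)%:R * (ip (Theta k) (Xh - Xb) - nu * xi i).
  rewrite /freq /noise -mulrA mulr_suml mulrCA -mulrBr; congr (_ * _).
  rewrite mulr_sumr -sumrB; apply: eq_bigr => i _; ring.
rewrite rmorphM rmorph_sum -scalerA scaler_suml; congr (_ *: _).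
apply: eq_bigr => i _; case: eqP => _; first by rewrite mul1r.
by rewrite mul0r scale0r.
Qed.

(** The objective is quadratic, so the expansion is exact and no differentiability is involved. *)
Lemma rc_obj_expand t (H : 'M[C]_n) :
  rc_obj Theta Xb nu m om xi F Xt rho gam (Xh + t%:C *: H) =
  rc_obj Theta Xb nu m om xi F Xt rho gam Xh + t * ip rc_grad H +
  t ^+ 2 * ((2 * m%:R)^-1 * \sum_(i < m) ip (Theta (om i)) H ^+ 2 + rho * (gam / 2 * ip H H)).
Proof.
rewrite /rc_obj !frob_sqr.
have -> : Xh + t%:C *: H - Xt = (Xh - Xt) + t%:C *: H by rewrite addrAC.
have -> D : ip (D + t%:C *: H) (D + t%:C *: H) = ip D D + 2 * t * ip D H + t ^+ 2 * ip H H.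
  by rewrite ipDl !ipDr !ipZl !ipZr (ipC H D); ring.
have -> : \sum_(i < m) (ip (Theta (om i)) Xb + nu * xi i - ip (Theta (om i)) (Xh + t%:C *: H)) ^+ 2 =
  \sum_(i < m) (ip (Theta (om i)) Xb + nu * xi i - ip (Theta (om i)) Xh) ^+ 2
  + 2 * t * \sum_(i < m) (ip (Theta (om i)) (Xh - Xb) - nu * xi i) * ip (Theta (om i)) H
  + t ^+ 2 * \sum_(i < m) ip (Theta (om i)) H ^+ 2.
  rewrite !mulr_sumr -!big_split /=; apply: eq_bigr => i _.
  rewrite ipDr ipZr ipBr; ring.
have -> : ip rc_grad H =
    m%:R^-1 * (\sum_(i < m) (ip (Theta (om i)) (Xh - Xb) - nu * xi i) * ip (Theta (om i)) H)
    + rho * (ip (1%:M - F Xt) H + gam * ip (Xh - Xt) H).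
  rewrite /rc_grad [LHS]ipDl !ipZl ip_suml (ipDl _ (gam%:C *: _)) ipZl.
  by congr (_ * _ + _); apply: eq_bigr => i _; rewrite ipZl.
rewrite ipDr ipZr.
(* Also true for m = 0, where both inverses are 0. *)
have -> : m%:R^-1 = 2 * (2 * m%:R)^-1 :> R.
  by rewrite invfM mulrA mulfV ?mul1r // pnatr_eq0.
move: ((2 * m%:R)^-1 : R) => c; by field.
Qed.

Lemma feasible_convex t X Y : 0 <= t -> t <= 1 ->
  rc_feasible cplx Theta alpha Xb X -> rc_feasible cplx Theta alpha Xb Y ->
  rc_feasible cplx Theta alpha Xb (X + t%:C *: (Y - X)).
Proof.
move=> t0 t1 [sX [pX aX]] [sY [pY aY]]; split; first by apply/inSD/inSZ/inSB.
split=> [|k ka].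
  have -> : X + t%:C *: (Y - X) = (1 - t)%:C *: X + t%:C *: Y.
    by rewrite rmorphB rmorph1 scalerBl scale1r scalerBr addrA addrAC.
  by apply: psdD; apply: psdZ => //; rewrite subr_ge0.
by rewrite ipDr ipZr ipBr aX ?aY // subrr mulr0 addr0.
Qed.

Lemma variational_inequality : rc_feasible cplx Theta alpha Xb Xh ->
  (forall X, rc_feasible cplx Theta alpha Xb X ->
     rc_obj Theta Xb nu m om xi F Xt rho gam Xh <= rc_obj Theta Xb nu m om xi F Xt rho gam X) ->
  forall X, rc_feasible cplx Theta alpha Xb X -> 0 <= ip rc_grad (X - Xh).
Proof.
move=> fXh opt X fX.
apply: (first_order_ge0 (e0 := 1) (c2 := (2 * m%:R)^-1 *
  \sum_(i < m) ip (Theta (om i)) (X - Xh) ^+ 2 + rho * (gam / 2 * ip (X - Xh) (X - Xh)))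
  (c3 := 0)) => // t t0 t1.
have := opt _ (feasible_convex (ltW t0) t1 fXh fX).
by rewrite rc_obj_expand mulr0 addr0 -addrA lerDl.
Qed.

End Gradient.

(** * Uniform estimates over realizations *)

Section Realizations.
Variables (cplx : bool) (n d : nat) (Theta : 'I_d -> 'M[C]_n) (alpha : {set 'I_d}).
Variables (Xb : 'M[C]_n) (nu k0 : R) (F : 'M[C]_n -> 'M[C]_n).

Definition prob k : R := if k \in ~: alpha then k0 else 0.

(* A realization of the data and of the estimator all of whose error terms are
   controlled by [seps]. *)
Record datum := Datum {
  sm : nat; som : nat -> 'I_d; sxi : nat -> R; sXt : 'M[C]_n; srho : R; sgam : R;
  sXh : 'M[C]_n; seps : R;
  srho_gt0 : 0 < srho;
  sgam_ge0 : 0 <= sgam;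
  seps_le1 : seps <= 1;
  seps_le : seps <= k0 / 2;
  srho_le : srho <= seps;
  sgr_le : sgam * srho <= seps;
  sgX_le : sgam * frob (sXt - Xb) <= seps;
  sF_le : frob (F sXt - F Xb) <= seps;
  sfreq_le : forall k, `|freq sm som k - prob k| <= seps;
  snoise_le : forall k, `|noise sm som sxi k| <= seps * srho;
  sXt_inS : inS cplx (F sXt);
  sXt_inS' : inS cplx sXt;
  sXh_feas : rc_feasible cplx Theta alpha Xb sXh;
  sXh_opt : forall X, rc_feasible cplx Theta alpha Xb X ->
     rc_obj Theta Xb nu sm som sxi F sXt srho sgam sXh <=
     rc_obj Theta Xb nu sm som sxi F sXt srho sgam X }.

Hypothesis k0_gt0 : 0 < k0.
Hypothesis Theta_inS : forall k, inS cplx (Theta k).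
Hypothesis Theta_exp : forall X, inS cplx X -> expands Theta X.
Hypothesis sXb : inS cplx Xb.
Hypothesis pXb : psd Xb.

Let Fb := F Xb.
Definition rel_err (j : datum) : 'M[C]_n := (srho j)^-1%:C *: (sXh j - Xb).

Definition scaled_grad (j : datum) : 'M[C]_n :=
  (srho j)^-1%:C *:
   rc_grad Theta Xb nu F (sm j) (som j) (sxi j) (sXt j) (srho j) (sgam j) (sXh j).

(** The part of the gradient error that does not involve [rel_err]: noise, error of F, and offset of
    the initial estimator. It can be bounded before [rel_err] is. *)
Definition stat_err (j : datum) : 'M[C]_n :=
  \sum_k (- nu * (noise (sm j) (som j) (sxi j) k / srho j))%:C *: Theta k
  - (F (sXt j) - Fb) - (sgam j)%:C *: (sXt j - Xb).

Definition grad_err (j : datum) : 'M[C]_n :=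
  stat_err j + \sum_k ((freq (sm j) (som j) k - prob k) * ip (Theta k) (rel_err j))%:C *: Theta k
  + (sgam j * srho j)%:C *: rel_err j.

Lemma srho_neq0 j : srho j != 0. Proof. by rewrite gt_eqF // srho_gt0. Qed.

Lemma seps_ge0 j : 0 <= seps j.
Proof. exact: le_trans (ltW (srho_gt0 j)) (srho_le j). Qed.

Lemma sXhE j : sXh j = Xb + (srho j)%:C *: rel_err j.
Proof. by rewrite /rel_err scalerA -rmorphM mulfV ?srho_neq0 // scale1r addrC subrK. Qed.

Lemma inS_D j : inS cplx (rel_err j).
Proof. by apply/inSZ/inSB => //; case: (sXh_feas j). Qed.

Lemma ip_alpha_D j k : k \in alpha -> ip (Theta k) (rel_err j) = 0.
Proof. by move=> ka; rewrite ipZr ipBr; case: (sXh_feas j) => _ [_ ->] //; rewrite subrr mulr0. Qed.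

Lemma sum_sqr_coord X : inS cplx X -> ip X X = \sum_k ip (Theta k) X ^+ 2.
Proof.
move=> sX; rewrite {1}(Theta_exp sX) ip_suml; apply: eq_bigr => k _.
by rewrite ipZl expr2.
Qed.

Lemma scaled_gradE0 j : scaled_grad j =
  \sum_k (freq (sm j) (som j) k * ip (Theta k) (rel_err j))%:C *: Theta k
  + (1%:M - Fb + stat_err j) + (sgam j * srho j)%:C *: rel_err j.
Proof.
have rK : (srho j)^-1%:C * (srho j)%:C = 1 :> C.
  by rewrite -rmorphM mulVf ?srho_neq0 // rmorph1.
rewrite /scaled_grad rc_gradE scalerDr scaler_sumr scalerA rK scale1r.
have -> : \sum_k (srho j)^-1%:C *: ((freq (sm j) (som j) k * ip (Theta k) (sXh j - Xb) -
     nu * noise (sm j) (som j) (sxi j) k)%:C *: Theta k) =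
   \sum_k (freq (sm j) (som j) k * ip (Theta k) (rel_err j))%:C *: Theta k +
   \sum_k (- nu * (noise (sm j) (som j) (sxi j) k / srho j))%:C *: Theta k.
  rewrite -big_split /=; apply: eq_bigr => k _.
  rewrite scalerA -rmorphM -scalerDl -rmorphD /rel_err ipZr; congr (_%:C *: _); ring.
have -> : sXh j - sXt j = (srho j)%:C *: rel_err j - (sXt j - Xb).
  by rewrite [in LHS]sXhE opprB addrA (addrC Xb).
rewrite /stat_err rmorphM -scalerA.
set a := \sum_k (freq (sm j) (som j) k * ip (Theta k) (rel_err j))%:C *: Theta k.
set b := \sum_k (- nu * (noise (sm j) (som j) (sxi j) k / srho j))%:C *: Theta k.
move: a b (F (sXt j)) Fb (rel_err j) (sXt j - Xb) => a b c e f g.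
apply/matrixP => x y; rewrite !mxE; ring.
Qed.

(** Replacing frequencies by probabilities turns the weighted expansion into k0 D, because the
    coordinates of D on [alpha] vanish by feasibility. *)
Lemma scaled_gradE j : scaled_grad j = k0%:C *: rel_err j + 1%:M - Fb + grad_err j.
Proof.
rewrite scaled_gradE0 /grad_err.
have -> : k0%:C *: rel_err j = \sum_k (prob k * ip (Theta k) (rel_err j))%:C *: Theta k.
  rewrite {1}(Theta_exp (inS_D j)) scaler_sumr; apply: eq_bigr => k _.
  rewrite scalerA -rmorphM /prob inE; case: ifP => // /negbFE ka.
  by rewrite ip_alpha_D // !mulr0.
have -> : \sum_k (freq (sm j) (som j) k * ip (Theta k) (rel_err j))%:C *: Theta k =
   \sum_k (prob k * ip (Theta k) (rel_err j))%:C *: Theta k +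
   \sum_k ((freq (sm j) (som j) k - prob k) * ip (Theta k) (rel_err j))%:C *: Theta k.
  rewrite -big_split /=; apply: eq_bigr => k _.
  by rewrite -scalerDl -rmorphD; congr (_%:C *: _); ring.
set a := \sum_k (prob k * ip (Theta k) (rel_err j))%:C *: Theta k.
set b := \sum_k ((freq (sm j) (som j) k - prob k) * ip (Theta k) (rel_err j))%:C *: Theta k.
move: a b (stat_err j) (rel_err j) Fb => a b c e f.
apply/matrixP => x y; rewrite !mxE; ring.
Qed.

Lemma inS_scaled_grad j : inS cplx (scaled_grad j).
Proof.
apply/inSZ/inSD; last by apply/inSZ/inSD; [apply/inSB/sXt_inS/inS1|apply/inSZ/inSB/sXt_inS'; case: (sXh_feas j)].
by apply/inSZ/inS_sum => i; apply: inSZ.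
Qed.

Lemma scaled_VI j X : rc_feasible cplx Theta alpha Xb X ->
  0 <= ip (scaled_grad j) (X - sXh j).
Proof.
move=> fX; rewrite ipZl mulr_ge0 ?invr_ge0 ?(ltW (srho_gt0 j)) //.
exact: variational_inequality (sXh_feas j) (@sXh_opt j) _ fX.
Qed.

Lemma feasible_Xb : rc_feasible cplx Theta alpha Xb Xb.
Proof. by []. Qed.

Lemma bR_frob (g a : datum -> R) (U : datum -> 'M[C]_n) :
  (forall j, 0 <= a j) -> (forall j, a j * frob (U j) <= g j) -> bO g (fun j => (a j)%:C *: U j).
Proof.
move=> a0 h; exists (n * n)%:R => // j.
rewrite ger0_norm ?nrm_ge0 // nrmZ ger0_norm //.
apply: le_trans (ler_wpM2l (a0 j) (nrm_le_frob _)) _.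
by rewrite mulrCA ler_wpM2l.
Qed.

Lemma bO_sum (g : datum -> R) (a : 'I_d -> datum -> R) :
  (forall k, bR g (a k)) -> bO g (fun j => \sum_k (a k j)%:C *: Theta k).
Proof.
move=> h; have : bR g (fun j => \sum_k nrm ((a k j)%:C *: Theta k)).
  by apply: bR_sum => k; apply: (bOZ (h k) (bO_cst _ _)).
apply: bR_le => j; rewrite ger0_norm ?nrm_ge0 //; apply: le_trans (ler_norm _).
elim/big_rec2: _ => [|k x y _ le]; first by rewrite nrm0.
exact: le_trans (nrmD _ _) (lerD (lexx _) le).
Qed.

Lemma bO_E0 : bO seps stat_err.
Proof.
apply: bOB; first apply: bOB.
- apply: bO_sum => k; apply: bRM; first exact: bR_cst.
  exists 1 => // j; rewrite mul1r normrM normfV (gtr0_norm (srho_gt0 j)).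
  by rewrite ler_pdivrMr ?srho_gt0 // snoise_le.
- apply: bO_eq (bR_frob (a := fun=> 1) _ _) => [j|//|j]; first by rewrite scale1r.
  by rewrite mul1r sF_le.
- by apply: bR_frob => j; [exact: sgam_ge0|exact: sgX_le].
Qed.

Lemma le_of_balance (a p v q l : R) :
  p + v + q <= 0 -> a <= p -> 0 <= q -> - v <= l -> a <= l.
Proof. lra. Qed.

(** Strong convexity along D: optimality against Xb gives (k0 / 2) |D|^2 <= - <V, D>, where V is
    bounded and independent of D; the proximal term has the right sign and is dropped. Dividing by
    the norm of D ends the proof. *)
Lemma bO_D : bO (fun=> 1) rel_err.
Proof.
have [L L0 hL] : bO (fun=> 1) (fun j => 1%:M - Fb + stat_err j).
  exact: bOD (bO_cst _ _) (bR_weaken seps_le1 bO_E0).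
have N0 : 0 <= (n * n)%:R ^+ 2 :> R by exact: sqr_ge0.
exists ((n * n)%:R ^+ 2 * (2 / k0) * L).
  by rewrite !mulr_ge0 // ?invr_ge0 ?ltW.
move=> j; rewrite mulr1 ger0_norm ?nrm_ge0 //.
have := scaled_VI j feasible_Xb; rewrite sXhE opprD addrA subrr sub0r ipNr ipZr.
rewrite oppr_ge0 pmulr_rle0 ?srho_gt0 // scaled_gradE0.
move: (1%:M - Fb + stat_err j) (hL j) => V; rewrite mulr1 ger0_norm ?nrm_ge0 // => hV.
rewrite !ipDl ip_suml ipZl.
have h1 : k0 / 2 * ip (rel_err j) (rel_err j) <=
    \sum_k ip ((freq (sm j) (som j) k * ip (Theta k) (rel_err j))%:C *: Theta k) (rel_err j).
  rewrite (sum_sqr_coord (inS_D j)) mulr_sumr; apply: ler_sum => k _.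
  rewrite ipZl -[X in _ <= X]mulrA -expr2; have [ka|ka] := boolP (k \in alpha).
    by rewrite ip_alpha_D // expr0n /= !mulr0.
  rewrite ler_wpM2r ?sqr_ge0 //.
  (* As [seps] is at most k0 / 2, each unconstrained index keeps a frequency of at least k0 / 2. *)
  have := sfreq_le j k; rewrite /prob inE ka ler_norml => /andP[+ _].
  have := seps_le j; lra.
have h2 : 0 <= sgam j * srho j * ip (rel_err j) (rel_err j).
  by rewrite !mulr_ge0 ?ipxx_ge0 ?sgam_ge0 // ltW ?srho_gt0.
move=> h3.
have h4 : - ip V (rel_err j) <= L * nrm (rel_err j).
  apply: le_trans (ler_norm _) _; rewrite normrN; apply: le_trans (ip_le_nrm _ _) _.
  by rewrite ler_wpM2r ?nrm_ge0.
have h5 : k0 / 2 * ip (rel_err j) (rel_err j) <= L * nrm (rel_err j) := le_of_balance h3 h1 h2 h4.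
have h6 : nrm (rel_err j) ^+ 2 <= (n * n)%:R ^+ 2 * (2 / k0) * L * nrm (rel_err j).
  apply: le_trans (nrm_sqr_le _) _; rewrite -2!mulrA; apply: ler_wpM2l => //.
  have k2 : 0 < k0 / 2 by rewrite divr_gt0.
  rewrite -(ler_pM2l k2); apply: le_trans h5 _.
  by rewrite le_eqVlt; apply/orP; left; apply/eqP; field; rewrite gt_eqF.
have [e|ne] := eqVneq (nrm (rel_err j)) 0; first by rewrite e !mulr_ge0 // invr_ge0 ltW.
have n0 : 0 < nrm (rel_err j) by rewrite lt_neqAle eq_sym ne nrm_ge0.
by rewrite -(ler_pM2r n0) -expr2.
Qed.

Lemma bO_E : bO seps grad_err.
Proof.
apply: bOD; first apply: bOD.
- exact: bO_E0.
- apply: bO_sum => k.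
  have h : bR seps (fun j => freq (sm j) (som j) k - prob k).
    by exists 1 => // j; rewrite mul1r sfreq_le.
  have h' : bR (fun=> 1) (fun j => ip (Theta k) (rel_err j)) by apply: bO_ip bO_D; exact: bO_cst.
  by apply: bR_le (bRM h' h) => j; rewrite mulrC.
- apply: bOZ bO_D; exists 1 => // j; rewrite mul1r ger0_norm ?sgr_le //.
  by rewrite mulr_ge0 ?sgam_ge0 // ltW ?srho_gt0.
Qed.

Lemma bO_scaled_grad : bO (fun=> 1) scaled_grad.
Proof.
apply: bO_eq (bOD (bOB (bOD (bOZc k0 bO_D) (bO_cst _ 1%:M)) (bO_cst _ Fb)) (bR_weaken seps_le1 bO_E)).
exact: scaled_gradE.
Qed.

Lemma bO_sXh : bO (fun=> 1) sXh.
Proof.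
have hr : bR seps srho by exists 1 => // j; rewrite mul1r gtr0_norm ?srho_gt0 // srho_le.
apply: bO_eq (bOD (bO_cst _ Xb) (bR_weaken seps_le1 (bOZ hr bO_D))).
exact: sXhE.
Qed.

Hypothesis pFb : psd Fb.
Hypothesis Fb_ker : forall v : 'cV[C]_n, Fb *m v = 0 <-> Xb *m v = 0.
Variable Xp : 'M[C]_n.
Hypothesis hXp : hermitian Xp.
Hypothesis XpC : Xb *m Xp = Xp *m Xb.
Hypothesis XpK : Xb *m Xp *m Xb = Xb.

Lemma psd_sXh j : psd (Xb + (srho j)%:C *: rel_err j).
Proof. by rewrite -sXhE; case: (sXh_feas j) => _ []. Qed.

Lemma dual_decomposition (Y : datum -> 'M[C]_n) j :
  scaled_grad j - Y j = k0%:C *: rel_err j + (1%:M - Y j) - Fb + grad_err j.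
Proof. by apply/matrixP => x y; rewrite scaled_gradE !mxE; ring. Qed.

(** The threshold is the same for all realizations and sample sizes, which is what lets the
    statement pass to probabilities. *)
Definition rank_conclusion := exists2 e0 : R, 0 < e0 &
  forall j, seps j <= e0 -> \rank (sXh j) = \rank Xb.

Lemma rank_of_dual_bound (Y : datum -> 'M[C]_n) c e1 :
  bO (fun=> 1) (fun j => 1%:M - Y j) ->
  (forall j, psd (scaled_grad j - Y j) /\ (scaled_grad j - Y j) *m sXh j = 0) ->
  0 < c -> 0 < e1 ->
  (forall j v, seps j <= e1 -> c * qf 1%:M v <= qf (1%:M - Y j) v) -> rank_conclusion.
Proof.
move=> bZ kkt c0 e10 hZ.
have SX j : (scaled_grad j - Y j) *m (Xb + (srho j)%:C *: rel_err j) = 0.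
  by rewrite -sXhE (kkt j).2.
have [e0 e00 h] := rank_eq_of_dual_lower_bound (S := fun j => scaled_grad j - Y j)
  k0_gt0 XpC XpK Fb_ker seps_ge0 srho_gt0 srho_le bO_D bO_E
  (dual_decomposition Y) SX psd_sXh c0 e10 hZ.
by exists e0 => // j je; rewrite sXhE h.
Qed.

Lemma bO_dgm (g : datum -> R) (a : datum -> 'I_n -> R) :
  (forall i, bR g (fun j => a j i)) -> bO g (fun j => dgm (a j)).
Proof.
move=> h; have hs : bR g (fun j => \sum_i `|a j i|).
  by apply: bR_sum => i; apply: bR_le (h i) => j; rewrite normr_id.
apply: bR_le hs => j; rewrite !ger0_norm ?nrm_ge0 ?sumr_ge0 //.
rewrite /nrm; apply: ler_sum => i _.
rewrite (eq_bigr (fun l => if l == i then `|a j i| else 0)).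
  by rewrite -big_mkcond big_pred1_eq.
by move=> l _; rewrite dgmE eq_sym; case: eqP => _; [rewrite cabs_real|rewrite Normc.normc0].
Qed.

Lemma rank_diagonal_case (I : {set 'I_n}) :
  (forall X, rc_feasible cplx Theta alpha Xb X <->
    [/\ inS cplx X, psd X & forall i, i \in I -> X i i = Xb i i]) ->
  (forall i, i \in I -> 0 < Re (Xb i i)) -> rank_conclusion.
Proof.
move=> feas xI.
have XI j i : i \in I -> sXh j i i = Xb i i by have /feas[_ _] := sXh_feas j; apply.
pose a j := diag_multiplier I (scaled_grad j) (sXh j).
have kkt j : psd (scaled_grad j - dgm (a j)) /\ (scaled_grad j - dgm (a j)) *m sXh j = 0.
  have /feas[sX pX _] := sXh_feas j.
  apply: (kkt_diag (inS_scaled_grad j) sX pX) => [i iI|X sX' pX' h]; first by rewrite XI // xI.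
  by apply/scaled_VI/feas; split=> // i iI; rewrite h // XI.
pose z j i := 1 - a j i.
have ZE j : 1%:M - dgm (a j) = dgm (z j).
  apply/matrixP => i l; rewrite dgmE [LHS]mxE [(- dgm (a j)) i l]mxE dgmE [1%:M i l]mxE /z.
  by case: eqP => _; rewrite ?rmorphB ?rmorph1 ?mulr1n // subr0.
(* Feasibility fixes the denominators of the multipliers to the constants Xb_ii, so they stay
   bounded. *)
have ba : bO (fun=> 1) (fun j => dgm (a j)).
  apply: bO_dgm => i; have [iI|iI] := boolP (i \in I); last first.
    by exists 0 => // j; rewrite /a /diag_multiplier (negPf iI) normr0 mul0r.
  have h : bR (fun=> 1) (fun j => Re ((scaled_grad j *m sXh j) i i)).
    apply: bR_le (bOMr bO_scaled_grad bO_sXh) => j.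
    by rewrite [X in _ <= X]ger0_norm ?nrm_ge0 // Re_entry_le.
  apply: bR_le (bRM (bR_cst _ (Re (Xb i i))^-1) h) => j.
  by rewrite /a /diag_multiplier iI XI // mulrC.
(* If Fb_ii were 0, the i-th unit vector would lie in the kernel of [Fb], hence of [Xb], against
   Xb_ii > 0. *)
have FI i : i \in I -> 0 < Re (Fb i i).
  move=> iI; rewrite lt_neqAle psd_diag_ge0 // andbT eq_sym; apply/negP => /eqP e.
  have : Fb *m (delta_mx i 0 : 'cV[C]_n) = 0 by apply: psd_qf0 => //; rewrite qf_delta.
  move/Fb_ker; rewrite -colE => /matrixP/(_ i 0); rewrite !mxE => Xii.
  by have := xI _ iI; rewrite Xii /= ltxx.
have SX j : (scaled_grad j - dgm (a j)) *m (Xb + (srho j)%:C *: rel_err j) = 0.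
  by rewrite -sXhE (kkt j).2.
have bZ : bO (fun=> 1) (fun j => 1%:M - dgm (a j)) := bOB (bO_cst _ _) ba.
have zI j i : i \notin I -> z j i = 1.
  by move=> iI; rewrite /z /a /diag_multiplier (negPf iI) subr0.
have DI j i : i \in I -> rel_err j i i = 0.
  by move=> iI; rewrite /rel_err !mxE XI // subrr mulr0.
have [c [e1 [c0 e10 hZ]]] := dual_bound_diag (S := fun j => scaled_grad j - dgm (a j))
  k0_gt0 pXb hXp XpC XpK Fb_ker seps_ge0 seps_le1 srho_gt0 srho_le bO_D bZ bO_E
  (fun j => (kkt j).1) (dual_decomposition (fun j => dgm (a j))) SX psd_sXh
  erefl erefl ZE zI DI FI.
exact: rank_of_dual_bound bZ kkt c0 e10 hZ.
Qed.

Lemma rank_trace_case : ip 1%:M Xb = 1 ->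
  (forall X, rc_feasible cplx Theta alpha Xb X <-> psd X /\ ip 1%:M X = 1) ->
  rank_conclusion.
Proof.
move=> trX feas.
pose y j := ip (scaled_grad j) (sXh j).
have kkt j : psd (scaled_grad j - (y j)%:C%:M) /\ (scaled_grad j - (y j)%:C%:M) *m sXh j = 0.
  have /feas[pX tX] := sXh_feas j.
  apply: kkt_trace => //; first by case: (inS_scaled_grad j).
  by move=> X pX' tX'; apply/scaled_VI/feas.
have ZE j : 1%:M - (y j)%:C%:M = (1 - y j)%:C%:M :> 'M[C]_n.
  by rewrite rmorphB rmorph1 raddfB.
have trD j : ip 1%:M (rel_err j) = 0.
  have /feas[_ tX] := sXh_feas j.
  by rewrite ipZr ipBr tX trX subrr mulr0.
(* A positive semidefinite matrix of trace 0 vanishes; [Fb] = 0 would make the kernel of [Xb]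
   everything, against its unit trace. *)
have trF : 0 < ip 1%:M Fb.
  rewrite lt_neqAle psd_ip_ge0 ?andbT //; last exact: psd1.
  rewrite eq_sym; apply/eqP => /(psd_ip0 (psd1 R n) pFb); rewrite mul1mx => F0.
  have X0 : Xb = 0 by apply: colmx_eqP => v; rewrite mul0mx; apply/Fb_ker; rewrite F0 mul0mx.
  by move: trX; rewrite X0 ip0r => /eqP; rewrite eq_sym oner_eq0.
have SX j : (scaled_grad j - (y j)%:C%:M) *m (Xb + (srho j)%:C *: rel_err j) = 0.
  by rewrite -sXhE (kkt j).2.
have bZ : bO (fun=> 1) (fun j => 1%:M - (y j)%:C%:M : 'M[C]_n).
  apply: bOB (bO_cst _ _) _.
  apply: bO_eq (bOZ (bO_ip bO_scaled_grad bO_sXh) (bO_cst _ (1%:M : 'M[C]_n))) => j.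
  by rewrite scalemx1.
have [c [e1 [c0 e10 hZ]]] := dual_bound_scalar (S := fun j => scaled_grad j - (y j)%:C%:M)
  k0_gt0 pXb hXp XpC XpK Fb_ker seps_ge0 seps_le1 srho_gt0 srho_le bO_D bZ bO_E
  (fun j => (kkt j).1) (dual_decomposition (fun j => (y j)%:C%:M)) SX psd_sXh
  erefl erefl ZE trD trF.
exact: rank_of_dual_bound bZ kkt c0 e10 hZ.
Qed.

End Realizations.
End Deterministic.

(** * The two completion problems as instances *)

Section FromSetting.
Variable R : realType.
Local Notation C := (R[i]).
Local Notation "a %:C" := (real_complex R a).
Local Notation Re := (@complex.Re R).
Local Notation Im := (@complex.Im R).

Lemma rank_conclusion_of_setting cplx n d (Theta : 'I_d -> 'M[C]_n) (alpha : {set 'I_d})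
  (Xb : 'M[C]_n) (nu k0 : R) (f : 'cV[R]_n -> 'cV[R]_n) (F : 'M[C]_n -> 'M[C]_n) :
  setting cplx Theta alpha Xb -> (0 < \rank Xb)%N -> 0 < k0 ->
  (forall (i : 'I_n) (x : 'cV[R]_n), (forall j, 0 <= x j 0) -> 0 <= f x i 0) ->
  (forall (i : 'I_n) (x : 'cV[R]_n), f x i 0 = 0 <-> x i 0 = 0) ->
  spectral_op cplx f F ->
  rank_conclusion cplx Theta alpha Xb nu k0 F.
Proof.
move=> hset rk k00 f0 fE FE.
have n0 : (0 < n)%N by apply: leq_trans rk (rank_leq_row _).
case: hset => [[Tinj [Trange [I [aE [pX [sX xI]]]]]]|[c [hT [oT [eT [l0 [Tl0 [aE [pX tX]]]]]]]]].
  have [pF _ Fker [Xp [hXp XpC XpK]]] := spectral_op_psd f0 fE FE sX pX.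
  have bT k : basis_a cplx (Theta k) by rewrite -Trange; exists k.
  have sT k : inS cplx (Theta k) by apply: inS_basis_a.
  have eT X : inS cplx X -> expands Theta X by apply: inS_expands.
  apply: (rank_diagonal_case nu k00 sT eT sX pX pF Fker hXp XpC XpK (I := I)); last first.
    by move=> i /xI; rewrite ltcE /= => /andP[].
  move=> X; split=> [[sX' [pX' h]]|[sX' pX' h]].
    split=> // i iI; have [k _ kE] : range Theta (delta_mx i i).
      by rewrite Trange; left; left; exists i.
    (* The linear constraint fixes only the real part of a diagonal entry; Hermitian symmetry
       supplies the rest. *)
    have := h k; rewrite kE !ip_delta1 => e.
    rewrite (hermitian_diag i sX'.1) (hermitian_diag i sX.1) e //.
    by rewrite aE inE; apply/existsP; exists i; rewrite iI kE eqxx.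
  split=> //; split=> // k; rewrite aE inE => /existsP[i /andP[iI /eqP ->]].
  by rewrite !ip_delta1 h.
have hX := pX.1.
have sX : inS cplx Xb by split=> //; rewrite c.
have [pF _ Fker [Xp [hXp XpC XpK]]] := spectral_op_psd f0 fE FE sX pX.
have sT k : inS cplx (Theta k) by split; [exact: hT|rewrite c].
have eT' X : inS cplx X -> expands Theta X by move=> [h _]; apply: eT.
have ip1 X : ip 1%:M X = Re (\tr X) by rewrite /ip ctr1 mul1mx.
have trX : ip 1%:M Xb = 1 by rewrite ip1 tX.
apply: (rank_trace_case nu k00 sT eT' sX pX pF Fker hXp XpC XpK trX).
set s := (Num.sqrt (n%:R : R))^-1 in Tl0.
(* The positive rank of [Xb] excludes n = 0, where this factor would be 0. *)
have s0 : s != 0 by rewrite invr_eq0 gt_eqF // sqrtr_gt0 ltr0n.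
move=> X; split=> [[sX' [pX' h]]|[pX' h]].
  split=> //; have := h l0; rewrite aE inE eqxx => /(_ isT).
  by rewrite Tl0 !ipZl trX => /(mulfI s0).
split; first by split; [case: pX'|rewrite c].
by split=> // k; rewrite aE inE => /eqP ->; rewrite Tl0 !ipZl trX h.
Qed.

End FromSetting.

(** * Concentration of the observations *)

Section Moments.
Context (R : realType) (dT : measure_display) (T : measurableType dT) (P : probability T R).
Local Open Scope ereal_scope.

Definition indep_rv (X Y : T -> R) := forall A B : set R, measurable A -> measurable B ->
  P (X @^-1` A `&` Y @^-1` B) = P (X @^-1` A) * P (Y @^-1` B).

Lemma integrable_of_sqr (X : T -> R) : measurable_fun setT X ->
  P.-integrable setT (EFin \o (fun w => X w ^+ 2)%R) -> P.-integrable setT (EFin \o X).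
Proof.
move=> mX iX2.
have i1 := finite_measure_integrable_cst P 1 (@measurableT _ T).
apply: le_integrable (integrableD measurableT i1 iX2) => //; first exact/measurable_EFinP.
move=> w _ /=; rewrite lee_fin [X in (_ <= X)%R]ger0_norm ?addr_ge0 ?sqr_ge0 //.
rewrite -[(X w ^+ 2)%R]real_normK ?num_real //.
have := sqr_ge0 (`|X w| - 1)%R; have := normr_ge0 (X w); nra.
Qed.

Lemma integrable_mul (X Y : T -> R) : measurable_fun setT X -> measurable_fun setT Y ->
  P.-integrable setT (EFin \o (fun w => X w ^+ 2)%R) ->
  P.-integrable setT (EFin \o (fun w => Y w ^+ 2)%R) ->
  P.-integrable setT (EFin \o (fun w => X w * Y w)%R).
Proof.
move=> mX mY iX iY; apply: le_integrable (integrableD measurableT iX iY) => //.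
  by apply/measurable_EFinP; apply: measurable_funM.
move=> w _ /=; rewrite lee_fin [X in (_ <= X)%R]ger0_norm ?addr_ge0 ?sqr_ge0 //.
rewrite ler_norml; apply/andP; split.
  have := sqr_ge0 (X w + Y w)%R; have := sqr_ge0 (X w - Y w)%R; nra.
have := sqr_ge0 (X w + Y w)%R; have := sqr_ge0 (X w - Y w)%R; nra.
Qed.

(** By uniqueness of the product measure the joint law of (X, Y) is the product of the marginals.
    Fubini then integrates y first, where the mean is 0. *)
Lemma integral_mul_indep0 (X Y : T -> R) :
  measurable_fun setT X -> measurable_fun setT Y -> indep_rv X Y ->
  P.-integrable setT (EFin \o Y) ->
  P.-integrable setT (EFin \o (fun w => X w * Y w)%R) ->
  \int[P]_w (Y w)%:E = 0 -> \int[P]_w (X w * Y w)%:E = 0.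
Proof.
move=> mX mY ind iY iXY EY.
pose RR := (R * R)%type.
pose X' : {mfun T >-> R} :=
  MeasurableFun.Pack (MeasurableFun.Class (isMeasurableFun.Build _ _ _ _ _ mX)).
pose Y' : {mfun T >-> R} :=
  MeasurableFun.Pack (MeasurableFun.Class (isMeasurableFun.Build _ _ _ _ _ mY)).
pose Z (w : T) : RR := (X w, Y w).
have mZ : measurable_fun setT Z by apply/measurable_fun_pairP; split.
pose Z' : {mfun T >-> RR} :=
  MeasurableFun.Pack (MeasurableFun.Class (isMeasurableFun.Build _ _ _ _ _ mZ)).
pose m1 := distribution P X'; pose m2 := distribution P Y'; pose mz := distribution P Z'.
have uniq A : measurable A -> (m1 \x m2) A = mz A.
  apply: product_measure_unique => B D mB mD.
  rewrite /mz /m1 /m2 /distribution /pushforward /= -ind //.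
have ei (h : RR -> \bar R) : \int[m1 \x m2]_z h z = \int[mz]_z h z.
  by apply: eq_measure_integral => A mA _; exact: uniq.
pose g (z : RR) := (z.1 * z.2)%:E.
have mg : measurable_fun setT g.
  by apply/measurable_EFinP; apply: measurable_funM; [exact: measurable_fst|exact: measurable_snd].
have e1 : \int[mz]_z g z = \int[P]_w (X w * Y w)%:E.
  by rewrite /mz /distribution (integral_pushforward (phi := Z')).
have ig : mz.-integrable setT g by apply: (integrable_pushforward (phi := Z')).
have ig' : (m1 \x m2).-integrable setT g.
  apply/integrableP; split=> //; have /integrableP[_] := ig.
  by rewrite ei.
rewrite -e1 -ei.
rewrite -integral12_prod_meas1 //.
have iY2 : m2.-integrable setT (EFin : R -> \bar R).
  by apply: (integrable_pushforward (phi := Y')).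
have EY2 : \int[m2]_y y%:E = 0.
  by rewrite /m2 /distribution (integral_pushforward (phi := Y')).
rewrite integral0_eq // => x _; rewrite /fubini_F /g /=.
under eq_integral do rewrite EFinM.
by rewrite integralZl // EY2 mule0.
Qed.

Lemma integral_same_law (X Y : T -> R) (h : R -> R) :
  measurable_fun setT X -> measurable_fun setT Y -> measurable_fun setT h ->
  (forall B, measurable B -> P (X @^-1` B) = P (Y @^-1` B)) ->
  P.-integrable setT (EFin \o (h \o Y)) ->
  P.-integrable setT (EFin \o (h \o X)) /\
  \int[P]_w (h (X w))%:E = \int[P]_w (h (Y w))%:E.
Proof.
move=> mX mY mh law iY.
pose X' : {mfun T >-> R} :=
  MeasurableFun.Pack (MeasurableFun.Class (isMeasurableFun.Build _ _ _ _ _ mX)).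
pose Y' : {mfun T >-> R} :=
  MeasurableFun.Pack (MeasurableFun.Class (isMeasurableFun.Build _ _ _ _ _ mY)).
have mEh : measurable_fun setT (EFin \o h) by apply/measurable_EFinP.
have eqm (g : R -> \bar R) : \int[distribution P X']_y g y = \int[distribution P Y']_y g y.
  by apply: eq_measure_integral => A mA _; apply: law.
have iX : P.-integrable setT (EFin \o (h \o X)).
  apply/integrableP; split; first by apply/measurable_EFinP; apply: measurableT_comp.
  have /integrableP[_] := iY.
  have abs (W : {mfun T >-> R}) :
      \int[P]_w `|(EFin \o (h \o W)) w| = \int[distribution P W]_y `|(h y)%:E|.
    rewrite /distribution ge0_integral_pushforward //.
    by apply: measurableT_comp.
  by rewrite (abs X') (abs Y') eqm.
split=> //.
have := eqm (EFin \o h); rewrite /distribution.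
by rewrite (integral_pushforward (phi := X')) // (integral_pushforward (phi := Y')).
Qed.

(** Uncorrelated summands leave only the m diagonal terms of the expanded square. *)
Lemma second_moment_sum (X : nat -> T -> R) m :
  (forall i, measurable_fun setT (X i)) ->
  (forall i, P.-integrable setT (EFin \o (fun w => X i w ^+ 2)%R)) ->
  (forall i, \int[P]_w (X i w ^+ 2)%:E <= 1) ->
  (forall i j, i != j -> \int[P]_w (X i w * X j w)%:E = 0) ->
  \int[P]_w ((\sum_(i < m) X i w) ^+ 2)%:E <= m%:R%:E.
Proof.
move=> mX iX X1 X0.
have iXX i j : P.-integrable setT (EFin \o (fun w => X i w * X j w)%R) by apply: integrable_mul.
have -> : \int[P]_w ((\sum_(i < m) X i w) ^+ 2)%:E =
    \int[P]_w (\sum_(i < m) \sum_(j < m) (X i w * X j w)%:E).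
  apply: eq_integral => w _; rewrite expr2 mulr_suml -sumEFin; apply: eq_bigr => i _.
  by rewrite mulr_sumr -sumEFin.
rewrite integral_sum //; last first.
  by move=> i; apply: integrable_sum => // j _; apply: iXX.
have -> : m%:R%:E = \sum_(i < m) (1 : \bar R).
  by rewrite sumEFin sumr_const card_ord.
apply: lee_sum => i _; rewrite integral_sum //; last by move=> j; apply: iXX.
rewrite (bigD1 i) //= big1 => [|j ji]; first by rewrite adde0 (le_trans _ (X1 i)).
by apply: X0; rewrite eq_sym.
Qed.

Lemma chebyshev_sqr (S : T -> R) (t c : R) : (0 < t)%R -> measurable_fun setT S ->
  \int[P]_w ((S w) ^+ 2)%:E <= c%:E ->
  P [set w | (t < `|S w|)%R] <= (c / t ^+ 2)%:E.
Proof.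
move=> t0 mS h.
have mE : measurable [set w | (t < `|S w|)%R].
  have mA : measurable_fun setT (fun w => `|S w|%R) by apply: measurableT_comp.
  have := mA measurableT _ (measurable_itv `]t, +oo[%R); rewrite setTI.
  by congr (measurable _); apply/seteqP; split => w /=; rewrite in_itv /= andbT.
have mS2 : measurable_fun setT (fun w => ((S w) ^+ 2)%:E).
  by apply/measurable_EFinP; apply: measurable_funX.
have h1 : (t ^+ 2)%:E * P [set w | (t < `|S w|)%R] <= c%:E.
  apply: le_trans h; rewrite -integral_cst //.
  apply: (@le_trans _ _ (\int[P]_(w in [set w | (t < `|S w|)%R]) ((S w) ^+ 2)%:E)).
    apply: ge0_le_integral => //.
    - by move=> w _; rewrite lee_fin sqr_ge0.
    - exact: measurable_funTS.
    - move=> w /= tw; rewrite lee_fin -[(S w ^+ 2)%R]real_normK ?num_real //.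
      by rewrite ler_sqr ?nnegrE ?normr_ge0 // ltW.
  by apply: ge0_subset_integral => // w _; rewrite lee_fin sqr_ge0.
have t2 : (0 < t ^+ 2)%R by rewrite exprn_gt0.
have fP : P [set w | (t < `|S w|)%R] \is a fin_num by apply: fin_num_measure.
move: h1; rewrite -(fineK fP) -EFinM !lee_fin => h1.
by rewrite ler_pdivlMr // mulrC.
Qed.

End Moments.

(** * Events of vanishing probability and concentration *)

Section Sampling.
Context (R : realType) (dT : measure_display) (T : measurableType dT) (P : probability T R).
Local Open Scope ereal_scope.

Definition vanishing (A : nat -> set T) :=
  (forall m, measurable (A m)) /\
  forall e : R, (0 < e)%R -> exists N, forall m, (N <= m)%N -> P (A m) < e%:E.

Lemma vanishingU (A B : nat -> set T) : vanishing A -> vanishing B ->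
  vanishing (fun m => A m `|` B m).
Proof.
move=> [mA hA] [mB hB]; split=> [m|e e0]; first exact: measurableU.
have e2 : (0 < e / 2)%R by rewrite divr_gt0.
have [N1 h1] := hA _ e2; have [N2 h2] := hB _ e2; exists (maxn N1 N2) => m.
rewrite geq_max => /andP[/h1 {}h1 /h2 {}h2].
apply: le_lt_trans (measureU2 P (mA m) (mB m)) _.
by rewrite (splitr e) EFinD lteD.
Qed.

Lemma vanishing_big (I : Type) (s : seq I) (A : I -> nat -> set T) :
  (forall i, vanishing (A i)) -> vanishing (fun m => \big[setU/set0]_(i <- s) A i m).
Proof.
move=> h; elim: s => [|i s IH].
  split=> [m|e e0]; first by rewrite big_nil.
  by exists 0%N => m _; rewrite big_nil measure0 lte_fin.
have [mU hU] := vanishingU (h i) IH; split=> [m|e e0]; first by rewrite big_cons.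
by have [N hN] := hU e e0; exists N => m /hN; rewrite big_cons.
Qed.

Lemma vanishing_sub (A B : nat -> set T) : (forall m, measurable (A m)) ->
  (exists N, forall m, (N <= m)%N -> A m `<=` B m) -> vanishing B -> vanishing A.
Proof.
move=> mA [N1 sub] [mB hB]; split=> // e e0; have [N hN] := hB e e0.
exists (maxn N N1) => m; rewrite geq_max => /andP[/hN h /sub s].
by apply: le_lt_trans h; apply: le_measure => //; exact: mem_set.
Qed.

Lemma measurable_gt (S : T -> R) (t : R) : measurable_fun setT S ->
  measurable [set w | (t < S w)%R].
Proof.
move=> mS; have := mS measurableT _ (measurable_itv `]t, +oo[%R); rewrite setTI.
by congr (measurable _); apply/seteqP; split => w /=; rewrite in_itv /= andbT.
Qed.

(** Chebyshev bounds the probability by 1 / (eps^2 m tau_m^2). The scale is [tau] = rho for the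
    noise and [tau] = 1 for the frequencies. *)
Lemma vanishing_mean (X : nat -> T -> R) (tau : nat -> R) (eps : R) : (0 < eps)%R ->
  (forall i, measurable_fun setT (X i)) ->
  (forall i, P.-integrable setT (EFin \o (fun w => X i w ^+ 2)%R)) ->
  (forall i, \int[P]_w (X i w ^+ 2)%:E <= 1) ->
  (forall i j, i != j -> \int[P]_w (X i w * X j w)%:E = 0) ->
  (forall m, 0 < tau m)%R ->
  (forall K : R, exists N, forall m, (N <= m)%N -> (K <= Num.sqrt (m%:R : R) * tau m)%R) ->
  vanishing (fun m => [set w | (eps * tau m < `|m%:R^-1 * \sum_(i < m) X i w|)%R]).
Proof.
move=> eps0 mX iX X1 X0 tau0 htau.
have mS m : measurable_fun setT (fun w => \sum_(i < m) X i w)%R by apply: measurable_sum.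
split=> [m|e e0].
  apply: measurable_gt; apply: measurableT_comp => //.
  by apply: measurable_funM.
have ee : (0 < eps ^+ 2 * e)%R by rewrite mulr_gt0 // exprn_gt0.
(* This makes eps^2 K = eps^2 + 1 / e exceed 1 / e strictly, and K >= 1 gives K <= K^2 <= m
   tau_m^2. *)
set K := (1 + (eps ^+ 2 * e)^-1)%R.
have K1 : (1 <= K)%R by rewrite lerDl invr_ge0 ltW.
have [N hN] := htau K; exists N.+1 => m Nm.
have m0 : (0 < m%:R :> R)%R by rewrite ltr0n (leq_trans _ Nm).
have hK := hN m (ltnW Nm).
have hK2 : (K <= m%:R * tau m ^+ 2)%R.
  have -> : (m%:R * tau m ^+ 2 = (Num.sqrt m%:R * tau m) ^+ 2)%R by rewrite exprMn sqr_sqrtr // ltW.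
  apply: (@le_trans _ _ (K ^+ 2)%R); first by rewrite expr2 ler_peMl // (le_trans ler01).
  by rewrite ler_sqr ?nnegrE // ?(le_trans _ hK) // (le_trans ler01).
have t0 : (0 < eps * tau m * m%:R)%R by rewrite !mulr_gt0.
have -> : [set w | (eps * tau m < `|m%:R^-1 * \sum_(i < m) X i w|)%R] =
          [set w | (eps * tau m * m%:R < `|\sum_(i < m) X i w|)%R].
  apply/seteqP; split => w /=; rewrite normrM normfV (gtr0_norm m0) (mulrC (m%:R^-1)%R) ltr_pdivlMr //.
apply: le_lt_trans (chebyshev_sqr t0 (mS m) (second_moment_sum m mX iX X1 X0)) _.
rewrite lte_fin.
have -> : (m%:R / (eps * tau m * m%:R) ^+ 2 = (eps ^+ 2 * (m%:R * tau m ^+ 2))^-1)%R.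
  by field; rewrite !gt_eqF.
have q0 : (0 < m%:R * tau m ^+ 2)%R by rewrite mulr_gt0 // exprn_gt0.
rewrite -[ltRHS]invrK ltf_pV2 ?posrE ?invr_gt0 ?mulr_gt0 ?exprn_gt0 //.
apply: (@lt_le_trans _ _ (eps ^+ 2 * K)%R); last by rewrite ler_wpM2l // sqr_ge0.
rewrite /K mulrDr mulr1 invfM mulrA mulfV ?gt_eqF ?exprn_gt0 // mul1r ltrDr exprn_gt0 //.
Qed.

Lemma indep_setC (U V : set T) : measurable U -> measurable V ->
  P (U `&` V) = P U * P V -> P (~` U `&` V) = P (~` U) * P V.
Proof.
move=> mU mV h.
have : P V = P (U `&` V) + P (~` U `&` V).
  rewrite -measureU ?setIUl //; first by rewrite -setIUl setUv setTI.
  - exact: measurableI.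
  - by apply: measurableI => //; apply: measurableC.
  - by rewrite setIACA setICr set0I.
rewrite h (probability_setC _ mU).
have fU : P U \is a fin_num by apply: fin_num_measure.
have fV : P V \is a fin_num by apply: fin_num_measure.
have fW : P (~` U `&` V) \is a fin_num.
  by apply: fin_num_measure; apply: measurableI => //; apply: measurableC.
rewrite -(fineK fU) -(fineK fV) -(fineK fW) -EFinM -EFinD => -[e].
by rewrite -EFinB -EFinM; congr (_%:E); lra.
Qed.

Section Observations.
Variables (d : nat) (om : nat -> T -> 'I_d) (xi : nat -> T -> R) (p : 'I_d -> R).
Hypothesis m_om : forall i k, measurable [set w | om i w = k].
Hypothesis P_om : forall i k, P [set w | om i w = k] = (p k)%:E.
Hypothesis m_xi : forall i, measurable_fun setT (xi i).
Hypothesis law_xi : forall i B, measurable B -> P (xi i @^-1` B) = P (xi 0%N @^-1` B).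
Hypothesis E_xi : \int[P]_w (xi 0%N w)%:E = 0.
Hypothesis V_xi : \int[P]_w ((xi 0%N w) ^+ 2)%:E = 1.
Hypothesis ind : indep_family P om xi.

Lemma measurable_om i (K : set 'I_d) : measurable [set w | K (om i w)].
Proof.
have -> : [set w | K (om i w)] = \bigcup_(k in K) [set w | om i w = k].
  by apply/seteqP; split=> [w Kw|w [k Kk /= ->]] //; exists (om i w).
by apply: fin_bigcup_measurable => //; exact: finite_finset.
Qed.

Lemma measurable_fun_om i (g : 'I_d -> R) : measurable_fun setT (fun w => g (om i w)).
Proof.
move=> _ Y mY; rewrite setTI; exact: (measurable_om i [set k | Y (g k)]).
Qed.

Lemma indep_two i j (K1 K2 : set 'I_d) (B1 B2 : set R) : i != j ->
  measurable B1 -> measurable B2 ->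
  P (([set w | K1 (om i w)] `&` [set w | B1 (xi i w)]) `&`
     ([set w | K2 (om j w)] `&` [set w | B2 (xi j w)])) =
  (P [set w | K1 (om i w)] * P [set w | B1 (xi i w)]) *
  (P [set w | K2 (om j w)] * P [set w | B2 (xi j w)]).
Proof.
move=> ij m1 m2.
have := @ind [:: i; j] (fun l => if l == i then K1 else K2)
  (fun l => if l == i then B1 else B2).
rewrite !big_cons !big_nil !eqxx (eq_sym j) (negPf ij) setIT mule1; apply.
  by rewrite /= inE ij.
by move=> l; case: ifP.
Qed.

Lemma P_setT_xi i : P [set w | [set: R] (xi i w)] = 1.
Proof. exact: probability_setT. Qed.

Lemma integrable_xi2 i : P.-integrable setT (EFin \o (fun w => xi i w ^+ 2)%R) /\
  \int[P]_w ((xi i w) ^+ 2)%:E = 1.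
Proof.
have m2 : measurable_fun setT (fun x : R => x ^+ 2)%R by apply: measurable_funX.
have i0 : P.-integrable setT (EFin \o ((fun x : R => x ^+ 2)%R \o xi 0%N)).
  apply/integrableP; split; first by apply/measurable_EFinP; apply: measurableT_comp.
  under eq_integral do rewrite /= ger0_norm ?sqr_ge0 //.
  by rewrite V_xi ltry.
have [iX e] := integral_same_law (m_xi i) (m_xi 0%N) m2 (law_xi i) i0.
by split=> //; rewrite e.
Qed.

Lemma integral_xi i : P.-integrable setT (EFin \o xi i) /\ \int[P]_w (xi i w)%:E = 0.
Proof.
have ii := integrable_of_sqr (m_xi i) (integrable_xi2 i).1; split=> //.
have i0 := integrable_of_sqr (m_xi 0%N) (integrable_xi2 0%N).1.
have [_ ->] := integral_same_law (m_xi i) (m_xi 0%N) (@measurable_id _ _ setT) (law_xi i) i0.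
exact: E_xi.
Qed.

Let ind1 i k w : R := (om i w == k)%:R%R.

(* If [A] contains 0 then the preimage of [A] is not a product event, but its
   complement is. *)
Lemma noise_indep i j k : i != j ->
  indep_rv P (fun w => ind1 i k w * ind1 j k w * xi i w)%R (xi j).
Proof.
move=> ij A B mA mB.
pose Rk (D : set R) := [set w | [set k] (om i w)] `&` [set w | D (xi i w)] `&`
  ([set w | [set k] (om j w)] `&` [set w | [set: R] (xi j w)]).
have mR D : measurable D -> measurable (Rk D).
  move=> mD; apply: measurableI; apply: measurableI; try exact: measurable_om.
    by have := m_xi i measurableT mD; rewrite setTI.
  exact: measurableT.
have mV : measurable (xi j @^-1` B) by have := m_xi j measurableT mB; rewrite setTI.
have key D : measurable D -> P (Rk D `&` xi j @^-1` B) = P (Rk D) * P (xi j @^-1` B).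
  move=> mD; have -> : Rk D `&` xi j @^-1` B =
     [set w | [set k] (om i w)] `&` [set w | D (xi i w)] `&`
     ([set w | [set k] (om j w)] `&` [set w | B (xi j w)]).
    by apply/seteqP; split=> w /=; rewrite /Rk /=; tauto.
  rewrite (indep_two _ _ ij mD mB) (indep_two _ _ ij mD measurableT) P_setT_xi mule1.
  by rewrite -!muleA.
have [A0|A0] := pselect (A 0%R).
  have -> : (fun w => ind1 i k w * ind1 j k w * xi i w)%R @^-1` A = ~` Rk (~` A).
    apply/seteqP; split=> w /=; rewrite /Rk /ind1 /=.
      by move=> h [[ei nA] [ej _]]; apply: nA; move: h; rewrite ei ej !eqxx !mul1r.
    have [ei|ei] := eqVneq (om i w) k; last by rewrite !mul0r.
    have [ej|ej] := eqVneq (om j w) k; last by rewrite mulr0 mul0r.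
    by rewrite !mul1r => h; apply: contrapT => nA; apply: h.
  apply: indep_setC => //; first by apply: mR; apply: measurableC.
  by apply: key; apply: measurableC.
have -> : (fun w => ind1 i k w * ind1 j k w * xi i w)%R @^-1` A = Rk A.
  apply/seteqP; split=> w /=; rewrite /Rk /ind1 /=.
    have [ei|ei] := eqVneq (om i w) k; last by rewrite !mul0r.
    have [ej|ej] := eqVneq (om j w) k; last by rewrite mulr0 mul0r.
    by rewrite !mul1r.
  by move=> [[ei h] [ej _]]; rewrite ei ej !eqxx !mul1r.
exact: key.
Qed.

Lemma ind1_01 i k w : (0 <= ind1 i k w <= 1)%R.
Proof. by rewrite /ind1; case: (_ == _); rewrite ?lexx ?ler01. Qed.

(** The cross term of observations i and j is regrouped so that [xi j] stands alone; the other
    factor is independent of it and [xi j] is centred. *)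
Lemma noise_vanishing k (tau : nat -> R) (eps : R) : (0 < eps)%R ->
  (forall m, 0 < tau m)%R ->
  (forall K : R, exists N, forall m, (N <= m)%N -> (K <= Num.sqrt (m%:R : R) * tau m)%R) ->
  vanishing (fun m => [set w | (eps * tau m < `|noise m (om^~ w) (xi^~ w) k|)%R]).
Proof.
move=> e0 t0 ht; pose X i w : R := (ind1 i k w * xi i w)%R.
have m1 i : measurable_fun setT (ind1 i k) := measurable_fun_om i (fun l => (l == k)%:R%R).
have mX i : measurable_fun setT (X i) by apply: measurable_funM.
have leX i w : (X i w ^+ 2 <= xi i w ^+ 2)%R.
  have /andP[a b] := ind1_01 i k w; rewrite /X exprMn ler_piMl ?sqr_ge0 //.
  by rewrite expr_le1.
have iX i : P.-integrable setT (EFin \o (fun w => X i w ^+ 2)%R).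
  apply: le_integrable (integrable_xi2 i).1 => //.
    by apply/measurable_EFinP; apply: measurable_funX.
  by move=> w _ /=; rewrite lee_fin !ger0_norm ?sqr_ge0.
apply: (vanishing_mean (X := X)) => //.
  move=> i; rewrite -(integrable_xi2 i).2.
  by apply: (le_integral measurableT (iX i) (integrable_xi2 i).1) => w _; rewrite lee_fin.
move=> i j ij.
have -> : \int[P]_w (X i w * X j w)%:E =
    \int[P]_w (ind1 i k w * ind1 j k w * xi i w * xi j w)%:E.
  by apply: eq_integral => w _; rewrite /X; congr (_%:E); ring.
apply: integral_mul_indep0 => //.
- by apply: measurable_funM => //; apply: measurable_funM.
- exact: noise_indep.
- exact: (integral_xi j).1.
- have := integrable_mul (mX i) (mX j) (iX i) (iX j); congr (_.-integrable _ _).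
  by apply/funext => w /=; rewrite /X; congr (_%:E); ring.
- exact: (integral_xi j).2.
Qed.

Lemma p_01 k : (0 <= p k <= 1)%R.
Proof.
by rewrite -!lee_fin -(P_om 0%N) measure_ge0 probability_le1.
Qed.

Lemma freq_vanishing k (eps : R) : (0 < eps)%R ->
  vanishing (fun m => [set w | (eps < `|freq R m (om^~ w) k - p k|)%R]).
Proof.
move=> e0; pose X i w : R := (ind1 i k w - p k)%R.
have mX i : measurable_fun setT (X i) := measurable_fun_om i (fun l => (l == k)%:R - p k)%R.
have X2 i w : (X i w ^+ 2 <= 1)%R.
  have /andP[a b] := ind1_01 i k w; have /andP[u v] := p_01 k; rewrite /X; nra.
have i1 := finite_measure_integrable_cst P 1 (@measurableT _ T).
have iX i : P.-integrable setT (EFin \o (fun w => X i w ^+ 2)%R).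
  apply: le_integrable i1 => //; first by apply/measurable_EFinP; apply: measurable_funX.
  by move=> w _ /=; rewrite lee_fin !ger0_norm ?sqr_ge0.
have EX i : \int[P]_w (X i w)%:E = 0.
  have mE : measurable [set w | om i w = k] by [].
  have -> : \int[P]_w (X i w)%:E = \int[P]_w ((\1_[set w | om i w = k] w)%:E - (p k)%:E).
    apply: eq_integral => w _; rewrite -EFinB /X /ind1 indicE.
    suff -> : (om i w == k) = (w \in [set w | om i w = k]) by [].
    by apply/idP/idP => [/eqP h|/set_mem /= ->]; [exact: mem_set|exact: eqxx].
  rewrite integralB //; first last.
  - exact: finite_measure_integrable_cst.
  - exact: integrable_indic.
  by rewrite integral_indic // setIT integral_cst //= probability_setT mule1 P_om subee.
have V1 : vanishing (fun m => [set w | (eps * 1 < `|m%:R^-1 * \sum_(i < m) X i w|)%R]).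
  apply: (vanishing_mean (tau := fun=> 1%R)) => //.
  - move=> i; apply: (@le_trans _ _ (\int[P]_w (cst 1%:E w))); last first.
      by rewrite integral_cst //= probability_setT mul1e.
    by apply: (le_integral measurableT (iX i) i1) => w _; rewrite lee_fin.
  - move=> i j ij; apply: integral_mul_indep0 => //; last first.
    + exact: integrable_mul.
    + exact: integrable_of_sqr.
    move=> A B mA mB.
    have := indep_two [set l | A ((l == k)%:R - p k)%R] [set l | B ((l == k)%:R - p k)%R]
      ij (@measurableT _ R) (@measurableT _ R).
    rewrite !P_setT_xi !mule1 => <-; congr (P _).
    by apply/seteqP; split=> w /=; tauto.
  (* Any integer above K^2 has a square root of at least |K|. *)
  - move=> K; exists (Num.truncn (K ^+ 2)).+1 => m Km; rewrite mulr1.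
    apply: le_trans (ler_norm _) _; rewrite -sqrtr_sqr ler_wsqrtr //.
    apply: ltW; apply: lt_le_trans (truncnS_gt _) _; by rewrite ler_nat.
apply: vanishing_sub V1.
  move=> m; apply: measurable_gt; apply: measurableT_comp => //.
  apply: measurable_funB => //; apply: measurable_funM => //.
  by apply: measurable_sum => i; exact: (measurable_fun_om i (fun l => (l == k)%:R%R)).
(* At m = 0 the empty mean is 0 while the centred frequency is - p k, hence m >= 1. *)
exists 1%N => m m0 w /=; rewrite mulr1 /freq.
have -> : (m%:R^-1 * \sum_(i < m) X i w = m%:R^-1 * \sum_(i < m) (om i w == k)%:R - p k)%R.
  rewrite /X sumrB sumr_const card_ord -[(p k *+ m)%R]mulr_natr mulrBr; congr (_ - _)%R.
  by rewrite mulrC mulfK // pnatr_eq0 -lt0n.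
by [].
Qed.

End Observations.
End Sampling.

(** * Convergence in probability *)

Section Vanishing.
Context (R : realType) (dT : measure_display) (T : measurableType dT) (P : probability T R).

Lemma vanishing_of_cvg (A : nat -> set T) : (forall m, measurable (A m)) ->
  (fun m => P (A m)) @ \oo --> 0%E -> vanishing P A.
Proof.
move=> mA /fine_cvgP[_ /cvgrPdist_lt h]; split=> // e e0.
have [N _ hN] := h e e0; exists N => m Nm; have := hN m Nm.
have fA : P (A m) \is a fin_num by apply: fin_num_measure.
by rewrite /= sub0r normrN ger0_norm ?fine_ge0 // -lte_fin fineK.
Qed.

Lemma cvg1_of_vanishing (A B : nat -> set T) : (exists N, forall m, (N <= m)%N -> A m = ~` B m) ->
  vanishing P B -> (fun m => P (A m)) @ \oo --> 1%E.
Proof.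
move=> [N hN] [mB hB].
have PA m : (N <= m)%N -> P (A m) = (1 - fine (P (B m)))%:E.
  move=> Nm; rewrite hN // probability_setC // EFinB fineK //; exact: fin_num_measure.
apply/fine_cvgP; split; first by exists N => // m /= Nm; rewrite PA.
apply/cvgrPdist_lt => e e0; have [N2 h] := hB e e0.
exists (maxn N N2) => // m /=; rewrite geq_max => /andP[Nm /h].
have fB : P (B m) \is a fin_num by apply: fin_num_measure.
by rewrite PA //= opprB addrCA subrr addr0 ger0_norm ?fine_ge0 // -lte_fin fineK.
Qed.

Lemma vanishing_Op (gam : nat -> T -> R) (U : nat -> T -> R) (eps : R) : 0 < eps ->
  (forall m w, 0 <= gam m w) -> (forall m w, 0 <= U m w) ->
  (forall m, measurable_fun setT (gam m)) -> (forall m, measurable_fun setT (U m)) ->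
  (forall e : R, 0 < e -> exists (M : R) (N : nat),
     forall m, (N <= m)%N -> (P [set w | (M < gam m w)%R] < e%:E)%E) ->
  (forall t, 0 < t -> vanishing P (fun m => [set w | t < U m w])) ->
  vanishing P (fun m => [set w | eps < gam m w * U m w]).
Proof.
move=> eps0 g0 U0 mg mU Og vU.
have mB m : measurable [set w | eps < gam m w * U m w].
  by apply: measurable_gt; apply: measurable_funM.
split=> // e e0; have e2 : 0 < e / 2 by rewrite divr_gt0.
have [M [N1 h1]] := Og _ e2.
have M0 : 0 < `|M| + 1 by rewrite ltr_wpDl.
have [mt ht] := vU _ (divr_gt0 eps0 M0); have [N2 h2] := ht _ e2.
exists (maxn N1 N2) => m; rewrite geq_max => /andP[/h1 {}h1 /h2 {}h2].
have mM : measurable [set w | M < gam m w] by apply: measurable_gt.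
apply: (@le_lt_trans _ _ (P ([set w | M < gam m w] `|` [set w | eps / (`|M| + 1) < U m w]))).
  apply: le_measure; [exact: mem_set|by apply/mem_set/measurableU|].
  move=> w /= h; have [gM|gM] := ltP M (gam m w); first by left.
  right; rewrite ltr_pdivrMr //; apply: lt_le_trans h _.
  rewrite mulrC ler_wpM2l // (le_trans gM) // (le_trans (ler_norm M)) // lerDl ler01 //.
apply: le_lt_trans (measureU2 P mM (mt m)) _.
by rewrite (splitr e) EFinD lteD.
Qed.

Lemma big_setU_mem (I : eqType) (s : seq I) (A : I -> set T) i w : i \in s -> A i w ->
  (\big[setU/set0]_(k <- s) A k) w.
Proof.
elim: s => // k s IH; rewrite inE big_cons => /orP[/eqP <- Aw|/IH h /h]; [by left|by right].
Qed.

Lemma measurable_frob n (X : T -> 'M[R[i]]_n) (Y : 'M[R[i]]_n) :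
  (forall i j, measurable_fun setT (fun w => complex.Re (X w i j)) /\
               measurable_fun setT (fun w => complex.Im (X w i j))) ->
  measurable_fun setT (fun w => frob (X w - Y)).
Proof.
move=> mX.
have -> : (fun w => frob (X w - Y)) = Num.sqrt \o (fun w => \sum_i \sum_j
    ((complex.Re (X w i j) - complex.Re (Y i j)) ^+ 2 +
     (complex.Im (X w i j) - complex.Im (Y i j)) ^+ 2)).
  apply/funext => w /=; rewrite /frob ipxx; congr Num.sqrt.
  apply: eq_bigr => i _; apply: eq_bigr => j _; rewrite !mxE.
  case: (X w i j) (Y i j) => [a b] [c e] /=.
  by rewrite sqr_sqrtr // addr_ge0 // sqr_ge0.
apply: measurableT_comp.
  by apply: continuous_measurable_fun; exact: sqrt_continuous.
apply: measurable_sum => i; apply: measurable_sum => j.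
by apply: measurable_funD; apply: measurable_funX; apply: measurable_funB => //; case: (mX i j).
Qed.

End Vanishing.

(** * From realizations to rank consistency *)

Theorem mainTheorem19 (R : realType) (dT : measure_display) (T : measurableType dT)
  (P : probability T R)
  (cplx : bool) (n d : nat) (Theta : 'I_d -> 'M[R[i]]_n) (alpha : {set 'I_d})
  (Xbar : 'M[R[i]]_n) (nu : R)
  (om : nat -> T -> 'I_d) (xi : nat -> T -> R)
  (f : 'cV[R]_n -> 'cV[R]_n) (F : 'M[R[i]]_n -> 'M[R[i]]_n)
  (Xt : nat -> T -> 'M[R[i]]_n) (rho : nat -> R) (gamma : nat -> T -> R)
  (Xhat : nat -> T -> 'M[R[i]]_n) :
  (* setting (a) or (b), with rank(Xbar) = r >= 1 *)
  setting cplx Theta alpha Xbar ->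
  (0 < \rank Xbar)%N ->
  (* observation model: omega_i i.i.d. uniform on beta = complement of alpha *)
  0 < nu ->
  (forall i k, measurable [set w | om i w = k]) ->
  (forall i k, P [set w | om i w = k] =
     (if k \in ~: alpha then (#|~: alpha|%:R)^-1 else 0)%:E) ->
  (* xi_i i.i.d., mean 0, variance 1 *)
  (forall i, measurable_fun setT (xi i)) ->
  (forall i B, measurable B -> P (xi i @^-1` B) = P (xi 0%N @^-1` B)) ->
  P.-integrable setT (EFin \o xi 0%N) ->
  (\int[P]_w (xi 0%N w)%:E = 0)%E ->
  (\int[P]_w ((xi 0%N w) ^+ 2)%:E = 1)%E ->
  (* all omega_i, xi_i mutually independent *)
  indep_family P om xi ->
  (* F is the spectral operator of a symmetric f with the stated sign properties *)
  symmetric_fun f ->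
  (forall (i : 'I_n) (x : 'cV[R]_n), (forall j, 0 <= x j 0) -> 0 <= f x i 0) ->
  (forall (i : 'I_n) (x : 'cV[R]_n), f x i 0 = 0 <-> x i 0 = 0) ->
  spectral_op cplx f F ->
  (* F continuous at Xbar *)
  (forall e : R, 0 < e -> exists2 delta : R, 0 < delta &
     forall X, inS cplx X -> psd X -> frob (X - Xbar) < delta ->
       frob (F X - F Xbar) < e) ->
  (* positive semidefinite initial estimator converging in probability to Xbar *)
  (forall m w, inS cplx (Xt m w) /\ psd (Xt m w)) ->
  (forall m i j, measurable_fun setT (fun w => complex.Re (Xt m w i j)) /\
                 measurable_fun setT (fun w => complex.Im (Xt m w i j))) ->
  (forall e : R, 0 < e ->
     (fun m => P [set w | e < frob (Xt m w - Xbar)]) @ \oo --> 0%E) ->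
  (* rho_m > 0, rho_m -> 0, sqrt m * rho_m -> +oo *)
  (forall m, 0 < rho m) ->
  rho @ \oo --> 0 ->
  (fun m => Num.sqrt (m%:R : R) * rho m) @ \oo --> +oo ->
  (* gamma_m >= 0, gamma_m = O_p(1) *)
  (forall m w, 0 <= gamma m w) ->
  (forall m, measurable_fun setT (gamma m)) ->
  (forall e : R, 0 < e -> exists (M : R) (N : nat),
     forall m, (N <= m)%N -> (P [set w | (M < gamma m w)%R] < e%:E)%E) ->
  (* Xhat_m is an optimal solution of (RC+) *)
  (forall m w,
     rc_feasible cplx Theta alpha Xbar (Xhat m w) /\
     forall X, rc_feasible cplx Theta alpha Xbar X ->
       rc_obj Theta Xbar nu m (om^~ w) (xi^~ w) F (Xt m w) (rho m) (gamma m w) (Xhat m w)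
       <= rc_obj Theta Xbar nu m (om^~ w) (xi^~ w) F (Xt m w) (rho m) (gamma m w) X) ->
  (* rank consistency: Pr(rank Xhat_m = rank Xbar) -> 1 (via measurable inner events) *)
  exists A : nat -> set T,
    (forall m, measurable (A m)) /\
    (forall m, A m `<=` [set w | \rank (Xhat m w) = \rank Xbar]) /\
    (fun m => P (A m)) @ \oo --> 1%E.
Proof.
move=> hset rk nu0 m_om P_om m_xi law ixi E_xi V_xi ind symf f0 fE FE Fcont sXt mXt cXt
  rho0 rhoc srho gam0 mgam Ogam opt.
pose k0 : R := (#|~: alpha|%:R)^-1.
have P_om' i k : P [set w | om i w = k] = (prob alpha k0 k)%:E by rewrite P_om.
(* With no unconstrained index the sampling law would have total mass 0 instead of 1. *)
have card0 : (0 < #|~: alpha|)%N.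
  rewrite lt0n; apply/eqP => c0.
  have v k : vanishing P (fun _ : nat => [set w | om 0%N w = k]).
    split=> // e e0; exists 0%N => m _.
    by rewrite P_om (card0_eq c0) lte_fin.
  have [_ h] := vanishing_big (index_enum 'I_d) v; have [N hN] := h 1 ltr01.
  have := hN N (leqnn N).
  have -> : \big[setU/set0]_(k <- index_enum 'I_d) [set w | om 0%N w = k] = setT.
    apply/seteqP; split=> // w _.
    exact: (big_setU_mem (A := fun k => [set w | om 0%N w = k]) (mem_index_enum (om 0%N w))).
  by rewrite probability_setT ltxx.
have k00 : 0 < k0 by rewrite invr_gt0 ltr0n.
have [e0 e00 H] := rank_conclusion_of_setting nu hset rk k00 f0 fE FE.
(* The single error level for all realizations: the rank threshold [e0] together with the bounds 1
   and k0 / 2 required in [datum]. *)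
pose eps := Num.min (Num.min e0 1) (k0 / 2).
have eps0 : 0 < eps by rewrite !lt_min e00 ltr01 divr_gt0.
have [delta d0 Hd] := Fcont eps eps0.
(* Off the bad event the distance is only known to be at most this value, while continuity asks for
   strictly less than [delta]. *)
have d2 : 0 < delta / 2 by rewrite divr_gt0.
have sqrt_rho K : exists N, forall m, (N <= m)%N -> K <= Num.sqrt (m%:R : R) * rho m.
  by move/cvgryPge : srho => /(_ K)[N _ hN]; exists N => m Nm; apply: hN.
have vfrob t : 0 < t -> vanishing P (fun m => [set w | t < frob (Xt m w - Xbar)]).
  move=> t0; apply: vanishing_of_cvg => [m|]; last exact: cXt.
  by apply: measurable_gt; apply: measurable_frob.
have rho_le t : 0 < t -> exists N, forall m, (N <= m)%N -> rho m <= t.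
  move=> t0; move/cvgrPdist_lt : rhoc => /(_ t t0)[N _ hN]; exists N => m Nm.
  by have := hN m Nm; rewrite /= sub0r normrN => /ltW; apply: le_trans; apply: ler_norm.
(* The deterministic rho is viewed as random so that [vanishing_Op] also covers gamma rho. *)
have vrho t : 0 < t -> vanishing P (fun m => [set w : T | t < rho m]).
  move=> t0; split=> [m|e e_gt0]; first by apply: measurable_gt; exact: measurable_cst.
  have [N hN] := rho_le t t0; exists N => m Nm.
  have -> : [set w : T | t < rho m] = set0.
    by apply/seteqP; split=> // w /=; rewrite ltNge hN.
  by rewrite measure0 lte_fin.
pose B m := [set w | eps < gamma m w * rho m] `|`
  [set w | eps < gamma m w * frob (Xt m w - Xbar)] `|`
  [set w | delta / 2 < frob (Xt m w - Xbar)] `|`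
  \big[setU/set0]_(k <- index_enum 'I_d)
     [set w | eps < `|freq R m (om^~ w) k - prob alpha k0 k|] `|`
  \big[setU/set0]_(k <- index_enum 'I_d)
     [set w | eps * rho m < `|noise m (om^~ w) (xi^~ w) k|].
have vB : vanishing P B.
  do 4?apply: vanishingU.
  - by apply: vanishing_Op => // m w; exact: ltW.
  - apply: vanishing_Op => // m; first by move=> w; exact: frob_ge0.
    exact: measurable_frob.
  - exact: vfrob.
  - by apply: vanishing_big => k; apply: freq_vanishing ind _ _ _.
  - by apply: vanishing_big => k; apply: (noise_vanishing m_om m_xi law E_xi V_xi ind).
(* Off [B m] the realization is a [datum] at level [eps], provided that rho m <= eps; this fails for
   finitely many m only, and there the empty event is taken. *)
exists (fun m => if rho m <= eps then ~` B m else set0); split; last split.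
- by move=> m; case: ifP => // _; apply: measurableC; case: vB.
- move=> m w; case: ifP => // rho_eps nB.
  have [[[[nB1 nB2] nB3] nB4] nB5] : ((((~ eps < gamma m w * rho m) /\
     ~ eps < gamma m w * frob (Xt m w - Xbar)) /\ ~ delta / 2 < frob (Xt m w - Xbar)) /\
     forall k, ~ eps < `|freq R m (om^~ w) k - prob alpha k0 k|) /\
     forall k, ~ eps * rho m < `|noise m (om^~ w) (xi^~ w) k|.
    split; first split; first split; first split.
    + by move=> h; apply: nB; left; left; left; left.
    + by move=> h; apply: nB; left; left; left; right.
    + by move=> h; apply: nB; left; left; right.
    + move=> k h; apply: nB; left; right.
      exact: (big_setU_mem (A := fun k => [set w | eps < `|freq R m (om^~ w) k - prob alpha k0 k|]) (mem_index_enum k)).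
    + move=> k h; apply: nB; right.
      exact: (big_setU_mem (A := fun k => [set w | eps * rho m < `|noise m (om^~ w) (xi^~ w) k|]) (mem_index_enum k)).
  have [sX pX] := sXt m w.
  have [_ sFX _ _] := spectral_op_psd f0 fE FE sX pX.
  have eps1 : eps <= 1 by rewrite !ge_min lexx orbT.
  have epsk : eps <= k0 / 2 by rewrite !ge_min lexx !orbT.
  have leN (x y : R) : ~ x < y -> y <= x by move=> /negP; rewrite -leNgt.
  have c_F : frob (F (Xt m w) - F Xbar) <= eps.
    apply/ltW/Hd => //; apply: le_lt_trans (leN _ _ nB3) _.
    by rewrite ltr_pdivrMr // ltr_pMr // ltr1n.
  have := H (Datum (rho0 m) (gam0 m w) eps1 epsk rho_eps (leN _ _ nB1) (leN _ _ nB2) c_F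
    (fun k => leN _ _ (nB4 k)) (fun k => leN _ _ (nB5 k)) sFX sX (opt m w).1 (opt m w).2).
  by apply; rewrite /= !ge_min lexx.
apply: cvg1_of_vanishing vB.
by have [N hN] := rho_le eps eps0; exists N => m /hN ->.
Qed.
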